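(* Let $X$ and $Y$ be metric spaces with bounded geometry, let $p\in[1,\infty)\setminus\{2\}$, and let $A^p(X)$ and $A^p(Y)$ be $\ell^p$ Roe-type algebras associated to $X$ and $Y$ respectively. If $A^p(X)$ and $A^p(Y)$ are isometrically isomorphic, then $X$ and $Y$ are coarsely equivalent. The same conclusion holds if $B^p_s(X)$ and $B^p_s(Y)$ are isometrically isomorphic. The converse holds for the algebras $UB^p(X)$, $B^p(X)$, and $B^p_s(X)$: if $X$ and $Y$ are coarsely equivalent, then $UB^p(X)\cong UB^p(Y)$, $B^p(X)\cong B^p(Y)$ and $B^p_s(X)\cong B^p_s(Y)$ isometrically. In particular, writing $K_q=K(\ell^q(\mathbb{N}))$ for the algebra of compact operators on $\ell^q(\mathbb{N})$ (and since $B^q_s(X)\cong B^q_u(X)\otimes K_q$ for $q\in[1,\infty)$), the following hold. (A) For metric spaces $X,Y$ with bounded geometry the following are equivalent: (A1) $X$ and $Y$ are coarsely equivalent. (A2) For every $q\in[1,\infty)$ there is an isometric isomorphism $\phi:B^q_u(X)\otimes K_q\to B^q_u(Y)\otimes K_q$ such that $\phi(\ell^\infty(X)\otimes C_0(\mathbb{N}))=\ell^\infty(Y)\otimes C_0(\mathbb{N})$. (A3) $B^q_u(X)\otimes K_q$ and $B^q_u(Y)\otimes K_q$ are isometrically isomorphic for every $q\in[1,\infty)$. (A4) $B^q_u(X)\otimes K_q$ and $B^q_u(Y)\otimes K_q$ are isometrically isomorphic for some $q\in[1,\infty)\setminus\{2\}$. (A5) For some $q\in[1,\infty)$ there is an isometric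 isomorphism $\phi$ as in (A2). (B) For finitely generated groups $\Gamma,\Lambda$ the following are equivalent: (B1) $\Gamma$ and $\Lambda$ are quasi-isometric. (B2) For every $q\in[1,\infty)$ there is an isometric isomorphism $\phi:(\ell^\infty(\Gamma)\rtimes_{\lambda,q}\Gamma)\otimes K_q\to(\ell^\infty(\Lambda)\rtimes_{\lambda,q}\Lambda)\otimes K_q$ such that $\phi(\ell^\infty(\Gamma)\otimes C_0(\mathbb{N}))=\ell^\infty(\Lambda)\otimes C_0(\mathbb{N})$. (B3) $(\ell^\infty(\Gamma)\rtimes_{\lambda,q}\Gamma)\otimes K_q$ and $(\ell^\infty(\Lambda)\rtimes_{\lambda,q}\Lambda)\otimes K_q$ are isometrically isomorphic for every $q\in[1,\infty)$. (B4) $(\ell^\infty(\Gamma)\rtimes_{\lambda,q}\Gamma)\otimes K_q$ and $(\ell^\infty(\Lambda)\rtimes_{\lambda,q}\Lambda)\otimes K_q$ are isometrically isomorphic for some $q\in[1,\infty)\setminus\{2\}$. (B5) For some $q\in[1,\infty)$ there is an isometric isomorphism $\phi$ as in (B2). If moreover $\Gamma$ and $\Lambda$ are non-amenable, these are also equivalent to: (B6) $\ell^\infty(\Gamma)\rtimes_{\lambda,q}\Gamma$ and $\ell^\infty(\Lambda)\rtimes_{\lambda,q}\Lambda$ are isometrically isomorphic for every $q\in[1,\infty)$. (B7) $\ell^\infty(\Gamma)\rtimes_{\lambda,q}\Gamma$ and $\ell^\infty(\Lambda)\rtimes_{\lambda,q}\Lambda$ are isometrically isomorphic for some $q\in[1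,\infty)\setminus\{2\}$.
   Context: A metric space $X$ has bounded geometry if for all $R\ge 0$ there is $N_R\in\mathbb{N}$ such that every ball of radius $R$ in $X$ has at most $N_R$ elements. A map $f:X\to Y$ is uniformly expansive if for all $R>0$ there is $S>0$ such that $d(x_1,x_2)\le R$ implies $d(f(x_1),f(x_2))\le S$. Two maps are close if they are at uniformly bounded distance. $X$ and $Y$ are coarsely equivalent if there are uniformly expansive maps $f:X\to Y$, $g:Y\to X$ such that $f\circ g$ and $g\circ f$ are close to the identity maps. Finitely generated groups carry word metrics. Isometric isomorphism means an isometric (complex-linear, multiplicative, bijective) algebra isomorphism. An operator $T\in B(\ell^p(X))$ has matrix entries $T_{xy}=(T\delta_y)(x)$; for a set $S$ an operator $T\in B(\ell^p(X,\ell^p(S)))$ has entries $T_{xy}\in B(\ell^p(S))$, $x,y\in X$. Its propagation is $\sup\{d(x,y):T_{xy}\ne 0\}$. $B^p_u(X)$ is the operator norm closure in $B(\ell^p(X))$ of the algebra of all bounded operators on $\ell^p(X)$ of finite propagation. Let $S$ be $\mathbb{N}$ or $\{1,\dots,n\}$ for some $n\in\mathbb{N}$. $T=(T_{xy})\in B(\ell^p(X,\ell^p(S)))$ is locally compact if every $T_{xy}$ is a compact operator on $\ell^p(S)$. A subalgebra $A^p[X]\subseteq B(\ell^p(X,\ell^p(S)))$ is an algebraic $\ell^p$ Roe-type algebra if it consists only of locally compact, finite propagation operators and contains all finite propagation operators $T$ for which there is $N\in\mathbb{N}$ with $\operatorname{rank}T_{xy}\le N$ for all $x,y$. An $\ell^p$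 Roe-type algebra $A^p(X)$ is the operator norm closure of some algebraic $\ell^p$ Roe-type algebra. With $\ell^p=\ell^p(\mathbb{N})$ and $\overline{M}^p_\infty=\overline{\bigcup_{n}M_n(\mathbb{C})}\subset B(\ell^p(\mathbb{N}))$: $UB^p(X)$ is the norm closure of the algebra of all finite propagation bounded operators $T$ on $\ell^p(X,\ell^p)$ for which there is $N\in\mathbb{N}$ with $\operatorname{rank}T_{xy}\le N$ for all $x,y$. $B^p(X)$ is the norm closure of the algebra of all finite propagation bounded operators $T$ on $\ell^p(X,\ell^p)$ with $T_{xy}\in\overline{M}^p_\infty$ for all $x,y$. $B^p_s(X)$ is the norm closure of the algebra of all finite propagation bounded operators $T$ on $\ell^p(X,\ell^p)$ for which there is a finite-dimensional subspace $E_T\subset\ell^p$ such that $T_{xy}\in B(E_T)$ for all $x,y$; here $T_{xy}\in B(E_T)$ means $T_{xy}=PT_{xy}P$ for a bounded idempotent $P=P_T$ on $\ell^p$ with range $E_T$, chosen independently of $x,y$. For norm-closed subalgebras $A\subseteq B(\ell^p(I))$, $B\subseteq B(\ell^p(J))$ with $I,J$ countable, $A\otimes B\subseteq B(\ell^p(I\times J))$ is the closed linear span of the operators $a\otimes b$, where $(a\otimes b)(\xi\otimes\eta)=a\xi\otimes b\eta$ and $(\xi\otimes\eta)(i,j)=\xi(i)\eta(j)$. $\ell^\infty(X)$ acts on $\ell^p(X)$ and $C_0(\mathbb{N})$ on $\ell^p(\mathbb{N})$ by multiplication. For a countable group $\Gamma$, let $\alpha$ be the left translation action of $\Gamma$ on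 $\ell^\infty(\Gamma)$, $(\alpha_s a)(t)=a(s^{-1}t)$. The $L^p$ reduced crossed product $\ell^\infty(\Gamma)\rtimes_{\lambda,p}\Gamma$ is defined like the reduced crossed product $C^*$-algebra: it is the norm closure in $B(\ell^p(\Gamma\times\Gamma))$ of the linear span of the operators $\pi(a)(1\otimes\lambda_s)$, $a\in\ell^\infty(\Gamma)$, $s\in\Gamma$, where $\pi(a)(\xi\otimes\delta_g)=(\alpha_{g^{-1}}(a)\xi)\otimes\delta_g$ and $\lambda_s\delta_g=\delta_{sg}$. The copy of $\ell^\infty(\Gamma)$ in it is $\pi(\ell^\infty(\Gamma))$. (It is isometrically isomorphic to $B^p_u(\Gamma)$.) *)

(* Defs.v *)
From HB Require Import structures.
From mathcomp Require Import all_boot all_order all_algebra.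
From mathcomp Require Import all_classical all_reals all_analysis.
From mathcomp Require Import complex.
From mathcomp Require Import ring.

Set Implicit Arguments.
Unset Strict Implicit.
Unset Printing Implicit Defensive.

Import Order.TTheory GRing.Theory Num.Theory.
Import numFieldNormedType.Exports.

Local Open Scope classical_set_scope.
Local Open Scope complex_scope.
Local Open Scope ring_scope.

Record exponent (R : realType) := Exponent {
  exponent_val :> R ;
  exponent_ge1 : 1 <= exponent_val }.

Section lp_space.
Context {R : realType}.
Implicit Types (p : exponent R) (I : choiceType) (a b c : R).

Definition lpsum p I (xi : I -> R[i]) : \bar R :=
  \esum_(i in setT) (Normc.normc (xi i) `^ p)%:E.

Definition lp_finite p I : {pred I -> R[i]} :=
  fun xi => `[< lpsum p xi < +oo >]%E.

Lemma exponent_gt0 p : 0 < (p : R).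
Proof. exact: lt_le_trans (exponent_ge1 p). Qed.

Lemma normc_ge0 (z : R[i]) : 0 <= Normc.normc z.
Proof. by case: z => x y; exact: sqrtr_ge0. Qed.

Lemma normc_norm (z : R[i]) : `|z| = (Normc.normc z)%:C.
Proof. by case: z. Qed.

Lemma normcD_le (z w : R[i]) :
  Normc.normc (z + w) <= Normc.normc z + Normc.normc w.
Proof. exact: le_normcD. Qed.

Lemma lpsum_ge0 p I (xi : I -> R[i]) : (0 <= lpsum p xi)%E.
Proof. by apply: esum_ge0 => i _; rewrite lee_fin powR_ge0. Qed.

Lemma esumZ_le I (u : I -> R) a : 0 <= a -> (forall i, 0 <= u i) ->
  (\esum_(i in setT) (a * u i)%:E <= a%:E * \esum_(i in setT) (u i)%:E)%E.
Proof.
move=> a0 u0; apply: ge_ereal_sup => _ [X [finX _] <-].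
rewrite fsbig_finite//= sumEFin -mulr_sumr EFinM lee_wpmul2l ?lee_fin//.
by apply: ereal_sup_ubound; exists X => //; rewrite fsbig_finite//= sumEFin.
Qed.

Lemma powR_convex p a b (x y : R) : 0 < a -> 0 < b -> 0 <= x -> 0 <= y ->
  (x + y) `^ p <=
    (a + b) `^ p * (a / (a + b) * (x / a) `^ p + b / (a + b) * (y / b) `^ p).
Proof.
move=> a0 b0 x0 y0; have ab0 : 0 < a + b by rewrite addr_gt0.
have t01 : 0 <= a / (a + b) <= 1.
  by rewrite divr_ge0 ?(ltW a0) ?(ltW ab0)//= ler_pdivrMr// mul1r lerDl ltW.
have tE : 1 - a / (a + b) = b / (a + b).
  by apply: (mulIf (lt0r_neq0 ab0)); field; rewrite lt0r_neq0.
case/andP: t01 => t0 t1.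
have := @convex_powR R (exponent_val p) (exponent_ge1 p) (Itv01 t0 t1) (x / a) (y / b).
rewrite !inE/= !in_itv/= !andbT !divr_ge0 ?(ltW a0) ?(ltW b0)// => /(_ isT isT).
rewrite [X in _ <= X]convRE/= => h.
have -> : x + y = (a + b) * (a / (a + b) * (x / a) + b / (a + b) * (y / b)).
  by field; rewrite !lt0r_neq0.
rewrite powRM ?(ltW ab0)//; last first.
  by rewrite addr_ge0// mulr_ge0// divr_ge0// ltW.
rewrite ler_wpM2l ?powR_ge0//; move: h; rewrite /unstable.onem tE.
by rewrite [conv _ _ _]convRE /= /unstable.onem tE.
Qed.

Lemma lpsumZ p I (z : R[i]) (xi : I -> R[i]) :
  (lpsum p (z *: xi)%R <= (Normc.normc z `^ p)%:E * lpsum p xi)%E.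
Proof.
rewrite /lpsum.
under eq_esum => i _ do rewrite [Normc.normc _]Normc.normcM powRM ?normc_ge0//.
by apply: esumZ_le => [|i]; rewrite powR_ge0.
Qed.

Lemma lpsumD p I a b (xi eta : I -> R[i]) : 0 < a -> 0 < b ->
  (lpsum p (xi + eta)%R <=
     ((a + b) `^ p * (a / (a + b)) * (a `^ p)^-1)%:E * lpsum p xi +
     ((a + b) `^ p * (b / (a + b)) * (b `^ p)^-1)%:E * lpsum p eta)%E.
Proof.
move=> a0 b0.
set u := (X in (X%:E * _ + _)%E); set v := (X in (_ + X%:E * _)%E).
have u0 : 0 <= u.
  by rewrite !mulr_ge0 ?invr_ge0 ?powR_ge0 ?addr_ge0// ltW.
have v0 : 0 <= v.
  by rewrite !mulr_ge0 ?invr_ge0 ?powR_ge0 ?addr_ge0// ltW.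
apply: le_trans (leeD (esumZ_le u0 _) (esumZ_le v0 _)); last 2 first.
- by move=> i; rewrite powR_ge0.
- by move=> i; rewrite powR_ge0.
rewrite -esumD; last 2 first.
- by move=> i _; rewrite lee_fin mulr_ge0// powR_ge0.
- by move=> i _; rewrite lee_fin mulr_ge0// powR_ge0.
apply: le_esum => i _; rewrite -EFinD lee_fin.
apply: (@le_trans _ _ ((Normc.normc (xi i) + Normc.normc (eta i)) `^ p)).
  by rewrite ge0_ler_powR ?nnegrE ?addr_ge0 ?normc_ge0 ?normcD_le// ltW//
    exponent_gt0.
apply: le_trans (powR_convex p a0 b0 (normc_ge0 _) (normc_ge0 _)) _.
rewrite !powRM ?normc_ge0 ?invr_ge0 ?(ltW a0) ?(ltW b0)//.
have powV c : 0 < c -> c^-1 `^ p = (c `^ p)^-1.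
  by move=> c0; rewrite -powR_inv1 ?ltW// -powRrM mulN1r powRN.
rewrite !powV// /u /v.
by rewrite le_eqVlt; apply/orP; left; apply/eqP; ring.
Qed.

Lemma lpsum0 p I : lpsum p (0 : I -> R[i]) = 0%E.
Proof.
apply: esum1 => i _.
by rewrite [Normc.normc _]Normc.normc0 powR0// gt_eqF// exponent_gt0.
Qed.

Lemma lp_finite_submod p I : submod_closed (@lp_finite p I).
Proof.
split; first by apply/asboolP; rewrite lpsum0.
move=> z xi eta /asboolP fx /asboolP fy; apply/asboolP.
apply: le_lt_trans (lpsumD p _ _ ltr01 ltr01) _.
have kge0 : 0 <= (1 + 1 : R) `^ p * (1 / (1 + 1)) * (1 `^ p)^-1.
  by rewrite !mulr_ge0 ?invr_ge0 ?powR_ge0// addr_ge0.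
rewrite lte_add_pinfty//; apply: lte_mul_pinfty => //.
apply: le_lt_trans (lpsumZ _ _ _) _.
by apply: lte_mul_pinfty => //; rewrite lee_fin powR_ge0.
Qed.

HB.instance Definition _ p I :=
  GRing.isSubmodClosed.Build R[i] (I -> R[i]) (@lp_finite p I)
    (@lp_finite_submod p I).

Record lp p I := Lp { lp_fun :> I -> R[i] ; lp_funP : lp_fun \in @lp_finite p I }.

HB.instance Definition _ p I := [isSub for @lp_fun p I].
HB.instance Definition _ p I := [Choice of lp p I by <:].
HB.instance Definition _ p I := [SubChoice_isSubLmodule of lp p I by <:].

End lp_space.

(* Locked for performance; unfolds by unlock. *)
HB.lock Definition lpnorm {R : realType} (p : exponent R) (I : choiceType)
  (xi : I -> R[i]) : R := fine (lpsum p xi) `^ (p : R)^-1.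
Canonical locked_lpnorm := Unlockable lpnorm.unlock.
Arguments lpnorm {R} p {I} xi.

Section lp_norm.
Context {R : realType}.
Implicit Types (p : exponent R) (I : choiceType).


Lemma lpnorm_ge0 p I (xi : I -> R[i]) : 0 <= lpnorm p xi.
Proof. by rewrite unlock powR_ge0. Qed.

Lemma lpsum_fin p I (xi : lp p I) : lpsum p xi \is a fin_num.
Proof.
by rewrite ge0_fin_numE ?lpsum_ge0//; apply/asboolP; exact: (lp_funP xi).
Qed.

Lemma lpsumE p I (xi : lp p I) : lpsum p xi = (lpnorm p xi `^ p)%:E.
Proof.
rewrite unlock -powRrM mulVf ?gt_eqF ?exponent_gt0// powRr1.
  by rewrite fineK// lpsum_fin.
by rewrite fine_ge0// lpsum_ge0.
Qed.

Lemma lpnorm_le p I (xi : I -> R[i]) (c : R) : 0 <= c ->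
  (lpsum p xi <= (c `^ p)%:E)%E -> lpnorm p xi <= c.
Proof.
move=> c0 h; have p0 := exponent_gt0 p.
have fx : lpsum p xi \is a fin_num.
  by rewrite ge0_fin_numE ?lpsum_ge0//; apply: le_lt_trans h _; rewrite ltry.
have -> : c = (c `^ p) `^ (p : R)^-1.
  by rewrite -powRrM mulfV ?gt_eqF// powRr1.
rewrite unlock ge0_ler_powR ?nnegrE ?powR_ge0 ?fine_ge0 ?lpsum_ge0//.
  by rewrite invr_ge0 ltW.
by rewrite -lee_fin fineK.
Qed.

Lemma le_lpnorm p I (xi : lp p I) (i : I) : Normc.normc (xi i) <= lpnorm p xi.
Proof.
have p0 := exponent_gt0 p.
have h : ((Normc.normc (xi i) `^ p)%:E <= (lpnorm p xi `^ p)%:E)%E.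
  rewrite -lpsumE; apply: esum_ge; exists [set i]; first by split.
  by rewrite fsbig_set1.
rewrite lee_fin in h; rewrite leNgt; apply/negP => h'.
by move: h; rewrite leNgt gt0_ltr_powR// nnegrE ?lpnorm_ge0 ?normc_ge0.
Qed.

Lemma lpnorm_eq0 p I (xi : lp p I) : lpnorm p xi = 0 -> xi = 0.
Proof.
move=> x0; apply/val_inj/funext => i; apply: Normc.eq0_normc.
by apply/eqP; rewrite eq_le normc_ge0 andbT -x0 le_lpnorm.
Qed.

Lemma lpnorm0 p I : lpnorm p (0 : lp p I) = 0.
Proof.
rewrite unlock (lpsum0 p I) /= powR0// invr_eq0 gt_eqF//.
exact: exponent_gt0.
Qed.

Lemma lpnormZ_le p I (z : R[i]) (xi : lp p I) :
  lpnorm p (z *: xi) <= Normc.normc z * lpnorm p xi.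
Proof.
apply: lpnorm_le; first by rewrite mulr_ge0 ?normc_ge0 ?lpnorm_ge0.
by rewrite powRM ?normc_ge0 ?lpnorm_ge0// EFinM -lpsumE; exact: lpsumZ.
Qed.

Lemma lpnormZ p I (z : R[i]) (xi : lp p I) :
  lpnorm p (z *: xi) = Normc.normc z * lpnorm p xi.
Proof.
have [->|z0] := eqVneq z 0; first by rewrite scale0r lpnorm0 Normc.normc0 mul0r.
apply/eqP; rewrite eq_le lpnormZ_le/=.
have nz : 0 < Normc.normc z.
  by rewrite lt_neqAle normc_ge0 andbT; apply: contra z0 => /eqP/esym/Normc.eq0_normc ->.
rewrite -ler_pdivlMl// -Normc.normcV.
rewrite -[in X in X <= _](scalerK z0 xi); exact: lpnormZ_le.
Qed.

Lemma lpnormD p I (xi eta : lp p I) :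
  lpnorm p (xi + eta) <= lpnorm p xi + lpnorm p eta.
Proof.
have [x0|x0] := eqVneq (lpnorm p xi) 0.
  by rewrite x0 (lpnorm_eq0 x0) !add0r.
have [y0|y0] := eqVneq (lpnorm p eta) 0.
  by rewrite y0 (lpnorm_eq0 y0) !addr0.
have xp : 0 < lpnorm p xi by rewrite lt_neqAle eq_sym x0 lpnorm_ge0.
have yp : 0 < lpnorm p eta by rewrite lt_neqAle eq_sym y0 lpnorm_ge0.
apply: lpnorm_le; first by rewrite addr_ge0 ?lpnorm_ge0.
apply: le_trans (lpsumD p xi eta xp yp) _.
rewrite (lpsumE xi).
rewrite (lpsumE eta).
rewrite -!EFinM.
rewrite -EFinD.
rewrite lee_fin.
have xpp : lpnorm p xi `^ p != 0 by rewrite gt_eqF// powR_gt0.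
have ypp : lpnorm p eta `^ p != 0 by rewrite gt_eqF// powR_gt0.
rewrite -!mulrA mulVf// mulVf// !mulr1 -mulrDr -mulrDl mulfV ?mulr1//.
by rewrite gt_eqF// addr_gt0.
Qed.

Let cnorm p I (xi : lp p I) : R[i] := (lpnorm p xi)%:C.

Let cnormD p I (xi eta : lp p I) : cnorm (xi + eta) <= cnorm xi + cnorm eta.
Proof. by rewrite /cnorm -rmorphD/= lecR lpnormD. Qed.

Let cnormZ p I (z : R[i]) (xi : lp p I) : cnorm (z *: xi) = `|z| * cnorm xi.
Proof. by rewrite /cnorm lpnormZ rmorphM/= normc_norm. Qed.

Let cnorm_eq0 p I (xi : lp p I) : cnorm xi = 0 -> xi = 0.
Proof. by move=> /complexI/lpnorm_eq0. Qed.

(* In a normed module over R[i] the norm takes values in R[i]: it is the real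
   number lpnorm, embedded in R[i]. The same applies to bop and opnorm below. *)
HB.instance Definition _ p I := Lmodule_isNormed.Build R[i] (lp p I)
  (@cnormD p I) (@cnormZ p I) (@cnorm_eq0 p I).

Lemma lp_normE p I (xi : lp p I) : `|xi| = (lpnorm p xi)%:C.
Proof. by []. Qed.

End lp_norm.

Definition bounded_op {R : realType} (V : normedModType R[i]) : {pred V -> V} :=
  fun T => `[< linear T /\ exists M : R, forall x, `|T x| <= M%:C * `|x| >].

Arguments bounded_op {R} V _.

Record bop {R : realType} (V : normedModType R[i]) := Bop {
  bop_fun :> V -> V ;
  bop_funP : bop_fun \in bounded_op V }.

HB.lock Definition opnorm {R : realType} (V : normedModType R[i]) (T : V -> V) : R :=
  sup [set complex.Re `|T x| | x in [set x : V | `|x| <= 1]].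
Canonical locked_opnorm := Unlockable opnorm.unlock.
Arguments opnorm {R V} T.

Section bop_theory.
Context {R : realType} (V : normedModType R[i]).
Implicit Types (S T : bop V) (x y : V) (z : R[i]).

Lemma Re_norm (W : normedModType R[i]) (x : W) : (complex.Re `|x|)%:C = `|x|.
Proof. by rewrite RRe_real// ger0_real. Qed.

Lemma Re_norm_ge0 (W : normedModType R[i]) (x : W) : 0 <= complex.Re `|x|.
Proof. by rewrite -ler0c Re_norm. Qed.

Lemma bounded_op_submod : submod_closed (bounded_op V).
Proof.
split.
  apply/asboolP; split; first by move=> z x y; rewrite scaler0 addr0.
  by exists 0 => x; rewrite normr0 mul0r.
move=> z f g /asboolP[lf [Mf fM]] /asboolP[lg [Mg gM]]; apply/asboolP; split.
  move=> w x y; rewrite !fctE lf lg !scalerDr !scalerA (mulrC z w).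
  by rewrite addrACA.
exists (Normc.normc z * Mf + Mg) => x.
rewrite rmorphD rmorphM/= mulrDl -mulrA -normc_norm.
apply: le_trans (ler_normD _ _) _; rewrite lerD ?gM//.
by rewrite [in leLHS]normrZ ler_wpM2l ?fM.
Qed.

HB.instance Definition _ := GRing.isSubmodClosed.Build R[i] (V -> V)
  (bounded_op V) bounded_op_submod.

HB.instance Definition _ := [isSub for @bop_fun R V].
HB.instance Definition _ := [Choice of bop V by <:].
HB.instance Definition _ := [SubChoice_isSubLmodule of bop V by <:].

Lemma bop_linear T : linear T.
Proof. by have /asboolP[] := bop_funP T. Qed.

Lemma bop_bounded T : exists2 M : R, 0 <= M & forall x, `|T x| <= M%:C * `|x|.
Proof.
have /asboolP[_ [M MP]] := bop_funP T; exists `|M|; first exact: normr_ge0.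
by move=> x; apply: le_trans (MP x) _; rewrite ler_wpM2r// lecR ler_norm.
Qed.

HB.instance Definition _ T := GRing.isLinear.Build R[i] V V *:%R T (bop_linear T).

Lemma bopP S T : (forall x, S x = T x) -> S = T.
Proof. by move=> ST; apply/val_inj/funext. Qed.

Lemma bop0E x : (0 : bop V) x = 0. Proof. by []. Qed.

Lemma bopDE S T x : (S + T) x = S x + T x. Proof. by []. Qed.

Lemma bopNE T x : (- T) x = - T x. Proof. by []. Qed.

Lemma bopZE z T x : (z *: T) x = z *: T x. Proof. by []. Qed.

Let unit_ball := [set x : V | `|x| <= 1].

Let has_sup_opnorm T : has_sup [set complex.Re `|T x| | x in unit_ball].
Proof.
split; first by exists (complex.Re `|T 0|), 0 => //; rewrite /unit_ball/= normr0.
have [M M0 TM] := bop_bounded T; exists M => _ [x xB <-].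
rewrite -lecR Re_norm; apply: le_trans (TM x) _.
by rewrite -[leRHS]mulr1 ler_wpM2l// ler0c.
Qed.

Lemma opnorm_ge0 T : 0 <= opnorm T.
Proof.
rewrite unlock; apply: (@le_trans _ _ (complex.Re `|T 0|)).
  exact: Re_norm_ge0.
apply: ub_le_sup; first exact: (has_sup_opnorm T).2.
by exists 0 => //; rewrite /unit_ball/= normr0.
Qed.

Lemma le_opnorm T x : `|T x| <= (opnorm T)%:C * `|x|.
Proof.
have [->|x0] := eqVneq x 0; first by rewrite linear0 !normr0 mulr0.
have nx : 0 < `|x| by rewrite normr_gt0.
rewrite -ler_pdivrMr// mulrC.
have -> : `|x|^-1 * `|T x| = `|T (`|x|^-1 *: x)|.
  by rewrite linearZ normrZ normfV normr_id.
rewrite -Re_norm lecR unlock; apply: ub_le_sup.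
  exact: (has_sup_opnorm T).2.
exists (`|x|^-1 *: x) => //.
by rewrite /= normrZ normfV normr_id mulVf// gt_eqF.
Qed.

Lemma opnorm_le T (M : R) : 0 <= M -> (forall x, `|T x| <= M%:C * `|x|) ->
  opnorm T <= M.
Proof.
move=> M0 TM; rewrite unlock; apply: ge_sup.
  exact: (has_sup_opnorm T).1.
move=> _ [x xB <-]; rewrite -lecR Re_norm; apply: le_trans (TM x) _.
by rewrite -[leRHS]mulr1 ler_wpM2l// ler0c.
Qed.

Lemma opnormD S T : opnorm (S + T : bop V) <= opnorm S + opnorm T.
Proof.
apply: opnorm_le => [|x]; first by rewrite addr_ge0 ?opnorm_ge0.
rewrite rmorphD/= mulrDl; apply: le_trans (ler_normD _ _) _.
by rewrite lerD ?le_opnorm.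
Qed.

Let opnormZ_le z T : opnorm (z *: T : bop V) <= Normc.normc z * opnorm T.
Proof.
apply: opnorm_le => [|x]; first by rewrite mulr_ge0 ?normc_ge0 ?opnorm_ge0.
rewrite rmorphM/= -normc_norm -mulrA [leLHS]normrZ.
by rewrite ler_wpM2l ?le_opnorm.
Qed.

Lemma opnorm_eq0 T : opnorm T = 0 -> T = 0.
Proof.
move=> T0; apply: bopP => x; apply/eqP; rewrite -normr_le0.
by have := le_opnorm T x; rewrite T0 mul0r.
Qed.

Lemma opnormZ z T : opnorm (z *: T : bop V) = Normc.normc z * opnorm T.
Proof.
apply/eqP; rewrite eq_le opnormZ_le andTb.
have [->|z0] := eqVneq z 0; first by rewrite Normc.normc0 mul0r opnorm_ge0.
have nz : 0 < Normc.normc z.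
  rewrite lt_neqAle normc_ge0 andbT.
  by apply: contra z0 => /eqP/esym/Normc.eq0_normc ->.
rewrite -ler_pdivlMl// -Normc.normcV.
by rewrite -[in X in X <= _](scalerK z0 T); exact: opnormZ_le.
Qed.

Let cnorm T : R[i] := (opnorm T)%:C.

Let cnormD S T : cnorm (S + T) <= cnorm S + cnorm T.
Proof. by rewrite /cnorm -rmorphD/= lecR opnormD. Qed.

Let cnormZ z T : cnorm (z *: T) = `|z| * cnorm T.
Proof. by rewrite /cnorm opnormZ rmorphM/= normc_norm. Qed.

Let cnorm_eq0 T : cnorm T = 0 -> T = 0.
Proof. by move=> /complexI/opnorm_eq0. Qed.

HB.instance Definition _ := Lmodule_isNormed.Build R[i] (bop V)
  cnormD cnormZ cnorm_eq0.

Lemma bop_normE T : `|T| = (opnorm T)%:C. Proof. by []. Qed.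

Lemma bop_comp_subproof S T : (S \o T : V -> V) \in bounded_op V.
Proof.
apply/asboolP; split; first by move=> z x y; rewrite /= !linearP.
exists (opnorm S * opnorm T) => x; apply: le_trans (le_opnorm S _) _.
rewrite rmorphM/= -mulrA ler_wpM2l ?ler0c ?opnorm_ge0//.
exact: le_opnorm.
Qed.

Lemma bop_id_subproof : (id : V -> V) \in bounded_op V.
Proof.
by apply/asboolP; split => //; exists 1 => x; rewrite mul1r.
Qed.

Definition bop_comp S T : bop V := Bop (bop_comp_subproof S T).
Definition bop_id : bop V := Bop bop_id_subproof.

Let compA : associative bop_comp. Proof. by move=> A B C; exact: bopP. Qed.
Let comp1l : left_id bop_id bop_comp. Proof. by move=> A; exact: bopP. Qed.
Let comp1r : right_id bop_id bop_comp. Proof. by move=> A; exact: bopP. Qed.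
Let compDl : left_distributive bop_comp +%R.
Proof. by move=> A B C; exact: bopP. Qed.
Let compDr : right_distributive bop_comp +%R.
Proof. by move=> A B C; apply: bopP => x; rewrite /= linearD. Qed.

HB.instance Definition _ := GRing.Zmodule_isPzRing.Build (bop V)
  compA comp1l comp1r compDl compDr.

Lemma bopM S T x : (S * T) x = S (T x). Proof. by []. Qed.

Lemma bop1E x : (1 : bop V) x = x. Proof. by []. Qed.

End bop_theory.

Section lp_vectors.
Context {R : realType}.
Implicit Types (p : exponent R) (I J : choiceType).

Lemma lpsum_delta p I (y : I) :
  lpsum p (fun i => (i == y)%:R : R[i]) = 1%E.
Proof.
rewrite /lpsum.
transitivity (\esum_(i in [set: I])
    if i \in [set j | j = y] then 1%:E else 0%E : \bar R)%E.
  apply: eq_esum => i _; have [->|/eqP iy] := eqVneq i y.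
    by rewrite mem_set// Normc.normc1 powR1.
  by rewrite memNset// Normc.normc0 powR0// gt_eqF// exponent_gt0.
by rewrite -esum_mkcondr setTI esum_set1// lee_fin.
Qed.

Lemma lpdelta_subproof p I (y : I) :
  (fun i => (i == y)%:R : R[i]) \in @lp_finite R p I.
Proof. by apply/asboolP; rewrite lpsum_delta ltry. Qed.

Definition lpdelta p I (y : I) : lp p I := Lp (lpdelta_subproof p y).

Lemma lpsum_tensor p I J (xi : lp p I) (eta : lp p J) :
  (lpsum p (fun k : I * J => xi k.1 * eta k.2)%R <=
     ((lpnorm p xi * lpnorm p eta) `^ p)%:E)%E.
Proof.
have u0 (K : choiceType) (f : K -> R[i]) k : 0 <= Normc.normc (f k) `^ p.
  by rewrite powR_ge0.
rewrite /lpsum.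
have -> : [set: I * J] = [set: I] `*`` (fun=> [set: J]).
  by apply/seteqP; split.
under eq_esum => k _ do rewrite Normc.normcM powRM ?normc_ge0//.
rewrite -(@esum_esum _ _ _ setT (fun=> setT)
   (fun i j => (Normc.normc (xi i) `^ p * Normc.normc (eta j) `^ p)%:E)); last first.
  by move=> i j _ _; rewrite lee_fin mulr_ge0.
apply: (@le_trans _ _ (\esum_(i in [set: I])
    (lpnorm p eta `^ p * Normc.normc (xi i) `^ p)%:E)%E).
  apply: le_esum => i _; apply: le_trans (esumZ_le _ _) _ => //.
  by rewrite -/(lpsum p eta) lpsumE -EFinM mulrC.
apply: le_trans (esumZ_le _ _) _; rewrite ?powR_ge0//.
by rewrite -/(lpsum p xi) lpsumE -EFinM powRM ?lpnorm_ge0// mulrC.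
Qed.

Lemma lptensor_subproof p I J (xi : lp p I) (eta : lp p J) :
  (fun k : I * J => xi k.1 * eta k.2) \in @lp_finite R p (I * J)%type.
Proof. by apply/asboolP; apply: le_lt_trans (lpsum_tensor _ _) _; rewrite ltry. Qed.

Definition lptensor p I J (xi : lp p I) (eta : lp p J) : lp p (I * J)%type :=
  Lp (lptensor_subproof xi eta).

Lemma lpsum_slice p I J (F : lp p (I * J)%type) (i : I) :
  (lpsum p (fun j : J => F (i, j)) <= lpsum p F)%E.
Proof.
rewrite /lpsum.
rewrite -(@esum_image _ _ _ setT (pair i)
  (fun k => (Normc.normc (F k) `^ p)%:E)); last by move=> j k _ _ [].
rewrite esum_mkcond; apply: le_esum => k _.
by case: ifP => // _; rewrite lee_fin powR_ge0.
Qed.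

Lemma lpslice_subproof p I J (F : lp p (I * J)%type) (i : I) :
  (fun j : J => F (i, j)) \in @lp_finite R p J.
Proof.
by apply/asboolP; apply: le_lt_trans (lpsum_slice _ _) _; rewrite lpsumE ltry.
Qed.

Definition lpslice p I J (F : lp p (I * J)%type) (i : I) : lp p J :=
  Lp (lpslice_subproof F i).

Lemma lpnorm_tensor p I J (xi : lp p I) (eta : lp p J) :
  `|lptensor xi eta| <= `|xi| * `|eta|.
Proof.
rewrite !lp_normE -rmorphM/= lecR; apply: lpnorm_le (lpsum_tensor _ _).
by rewrite mulr_ge0 ?lpnorm_ge0.
Qed.

Lemma lpnorm_slice p I J (F : lp p (I * J)%type) (i : I) :
  `|lpslice F i| <= `|F|.
Proof.
rewrite !lp_normE lecR; apply: lpnorm_le; first exact: lpnorm_ge0.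
by apply: le_trans (lpsum_slice _ _) _; rewrite lpsumE.
Qed.

(* For T in B(l^p(X)): T_xy = (T delta_y)(x). *)
Definition scalar_entry p I (T : bop (lp p I)) (x y : I) : R[i] :=
  T (lpdelta p y) x.

Lemma entry_subproof p I J (T : bop (lp p (I * J)%type)) (x y : I) :
  (fun eta : lp p J => lpslice (T (lptensor (lpdelta p y) eta)) x)
    \in bounded_op (lp p J).
Proof.
apply/asboolP; split.
  move=> z xi eta.
  have -> : lptensor (lpdelta p y) (z *: xi + eta) =
      z *: lptensor (lpdelta p y) xi + lptensor (lpdelta p y) eta.
    apply/val_inj/funext => k; rewrite /= mulrDr; congr (_ + _).
    by rewrite mulrCA.
  by rewrite linearP; exact/val_inj/funext.
exists (opnorm T * lpnorm p (lpdelta p y)) => eta.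
apply: le_trans (lpnorm_slice _ _) _; apply: le_trans (le_opnorm _ _) _.
rewrite rmorphM/= -mulrA ler_wpM2l ?ler0c ?opnorm_ge0//.
exact: lpnorm_tensor.
Qed.

(* l^p(X, l^p(S)) is identified isometrically with l^p(X * S), the section
   F (x, .) being the value of F at x. The entry T_xy sends eta to
   (T (delta_y tensor eta)) (x, .). *)
Definition entry p I J (T : bop (lp p (I * J)%type)) (x y : I) : bop (lp p J) :=
  Bop (entry_subproof T x y).

End lp_vectors.

Section coarse.
Context {R : realType}.
Implicit Types X Y : metricType R.

Definition bounded_geometry X : Prop :=
  forall r : R, 0 <= r -> exists N : nat,
    forall x : X, ([set y | mdist x y <= r] #<= `I_N)%card.

Definition uniformly_expansive X Y (f : X -> Y) : Prop :=
  forall r : R, 0 < r -> exists2 s : R, 0 < s &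
    forall x1 x2, mdist x1 x2 <= r -> mdist (f x1) (f x2) <= s.

Definition close (T : Type) Y (f g : T -> Y) : Prop :=
  exists C : R, forall t, mdist (f t) (g t) <= C.

Definition coarsely_equivalent X Y : Prop :=
  exists (f : X -> Y) (g : Y -> X),
    [/\ uniformly_expansive f, uniformly_expansive g,
        close (f \o g) idfun & close (g \o f) idfun].

End coarse.

Section groups.
Context {R : realType}.
Implicit Types G H : groupType.

Definition is_word G (gens w : seq G) : bool :=
  all (fun s => (s \in gens) || (s^-1%g \in gens)) w.

Definition generates G (gens : seq G) : Prop :=
  forall g : G, exists2 w, is_word gens w & (\prod_(s <- w) s)%g = g.

Definition word_length G (gens : seq G) (g : G) : R :=
  inf [set (size w)%:R | w in
         [set w | is_word gens w /\ (\prod_(s <- w) s)%g = g]].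

Definition word_dist G (gens : seq G) (g h : G) : R :=
  word_length gens (g^-1 * h)%g.

Definition quasi_isometric (S T : Type) (dS : S -> S -> R) (dT : T -> T -> R) :
    Prop :=
  exists (f : S -> T) (A B : R),
    [/\ 1 <= A, 0 <= B,
        forall s t, A^-1 * dS s t - B <= dT (f s) (f t) <= A * dS s t + B &
        forall t, exists s, dT (f s) t <= B].

Definition ltranslate (U : Type) G (s : G) (a : G -> U) : G -> U :=
  fun t => a (s^-1 * t)%g.

Definition invariant_mean G (m : (G -> R) -> R) : Prop :=
  [/\ forall (c : R) (u v : G -> R), bounded_fun u -> bounded_fun v ->
        m (fun t => c * u t + v t) = c * m u + m v,
      forall u : G -> R, bounded_fun u -> (forall t, 0 <= u t) -> 0 <= m u,
      m (fun=> 1) = 1 &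
      forall s (u : G -> R), bounded_fun u -> m (ltranslate s u) = m u].

Definition amenable G : Prop := exists m : (G -> R) -> R, invariant_mean m.

End groups.
Arguments amenable R G : clear implicits.

Section operator_sets.
Context {R : realType}.
Implicit Types V W : normedModType R[i].

Definition lin_span V (A : set V) : set V :=
  [set v | exists n (c : 'I_n -> R[i]) (a : 'I_n -> V),
     (forall i, A (a i)) /\ v = \sum_i c i *: a i].

Definition rank_le V (T : bop V) (N : nat) : Prop :=
  exists e : 'I_N -> V, range T `<=` lin_span (range e).

Definition compact_op V (T : bop V) : Prop :=
  precompact (T @` [set x | `|x| <= 1]).

Definition subalgebra V (A : set (bop V)) : Prop :=
  [/\ A 0, forall z S T, A S -> A T -> A (z *: S + T) &
      forall S T, A S -> A T -> A (S * T)].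

Definition isometric_iso V W (A : set (bop V)) (B : set (bop W))
    (phi : bop V -> bop W) : Prop :=
  [/\ set_bij A B phi,
      forall z S T, A S -> A T -> phi (z *: S + T) = z *: phi S + phi T,
      forall S T, A S -> A T -> phi (S * T) = phi S * phi T &
      forall T, A T -> `|phi T| = `|T|].

Definition isometrically_isomorphic V W (A : set (bop V)) (B : set (bop W)) :
  Prop := exists phi, isometric_iso A B phi.

End operator_sets.

Section lp_algebras.
Context {R : realType}.
Implicit Types (p : exponent R) (X : metricType R) (I J S : choiceType).

(* The tensors xi tensor eta span a dense subspace of l^p(I * J), so that a
   bounded operator is determined by its values on them. The same remark
   applies to is_pi and is_lambda below. *)
Definition is_tensor p I J (a : bop (lp p I)) (b : bop (lp p J))
    (T : bop (lp p (I * J)%type)) : Prop :=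
  forall xi eta, T (lptensor xi eta) = lptensor (a xi) (b eta).

Definition tensor_alg p I J (A : set (bop (lp p I))) (B : set (bop (lp p J))) :
    set (bop (lp p (I * J)%type)) :=
  closure (lin_span
    [set T | exists a b, [/\ A a, B b & is_tensor a b T]]).

Definition linf_ops p I : set (bop (lp p I)) :=
  [set T : bop (lp p I) |
    exists2 a : I -> R[i], bounded_fun (a : I -> R[i]^o) &
      forall (xi : lp p I) i, T xi i = a i * xi i].

Definition C0_ops p : set (bop (lp p nat)) :=
  [set T : bop (lp p nat) |
    exists2 a : nat -> R[i], (a : nat -> R[i]^o) @ \oo --> (0 : R[i]^o) &
      forall (xi : lp p nat) n, T xi n = a n * xi n].

Definition compact_ops p : set (bop (lp p nat)) := [set T | compact_op T].

(* nz x y stands for T_xy != 0. *)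
Definition propagation X (nz : X -> X -> Prop) : \bar R :=
  ereal_sup [set (mdist xy.1 xy.2)%:E | xy in [set xy | nz xy.1 xy.2]].

Definition fin_prop_u p X (T : bop (lp p X)) : Prop :=
  (propagation (fun x y => scalar_entry T x y != 0)%R < +oo)%E.

Definition fin_prop p X S (T : bop (lp p (X * S)%type)) : Prop :=
  (propagation (fun x y => entry T x y != 0)%R < +oo)%E.

Definition bounded_rank p X S (T : bop (lp p (X * S)%type)) : Prop :=
  exists N : nat, forall x y, rank_le (entry T x y) N.

Definition Bu p X : set (bop (lp p X)) := closure [set T | fin_prop_u T].

(* The possible coefficient sets S: fiber None is N and fiber (Some n) is a set
   with n + 1 elements, so that the finite case is never empty. *)
Definition fiber (s : option nat) : choiceType :=
  if s is Some n then 'I_n.+1 else nat.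

Definition alg_roe_type p X s (A : set (bop (lp p (X * fiber s)%type))) : Prop :=
  [/\ subalgebra A,
      forall T, A T -> fin_prop T /\ forall x y, compact_op (entry T x y) &
      forall T, fin_prop T -> bounded_rank T -> A T].

Definition roe_type p X s (A : set (bop (lp p (X * fiber s)%type))) : Prop :=
  exists2 A0 : set (bop (lp p (X * fiber s)%type)),
    alg_roe_type A0 & A = closure A0.

(* M_n(C), acting on the first n coordinates of l^p(N). *)
Definition matrix_corner p (n : nat) : set (bop (lp p nat)) :=
  [set T | forall i j, ~~ ((i < n) && (j < n))%N -> scalar_entry T i j = 0].

Definition Minf p : set (bop (lp p nat)) :=
  closure (\bigcup_n @matrix_corner p n).

Definition UB p X : set (bop (lp p (X * nat)%type)) :=
  closure [set T | fin_prop T /\ bounded_rank T].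

Definition Broe p X : set (bop (lp p (X * nat)%type)) :=
  closure [set T | fin_prop T /\ forall x y, @Minf p (entry T x y)].

(* E_T is the span of e, and P is the idempotent onto E_T realizing
   T_xy \in B(E_T) uniformly in x and y. *)
Definition in_fixed_corner p X (T : bop (lp p (X * nat)%type)) : Prop :=
  exists (n : nat) (e : 'I_n -> lp p nat) (P : bop (lp p nat)),
    [/\ P * P = P, range P = lin_span (range e) &
        forall x y, entry T x y = P * entry T x y * P].

Definition Bs p X : set (bop (lp p (X * nat)%type)) :=
  closure [set T | fin_prop T /\ in_fixed_corner T].

End lp_algebras.
Arguments linf_ops {R} p I _.
Arguments C0_ops {R} p _.
Arguments compact_ops {R} p _.
Arguments Bu {R} p X _.
Arguments matrix_corner {R} p n _.
Arguments Minf {R} p _.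
Arguments UB {R} p X _.
Arguments Broe {R} p X _.
Arguments Bs {R} p X _.

Section crossed_product.
Context {R : realType}.
Variables (p : exponent R) (G : groupType).

(* pi(a) (xi tensor delta_g) = (alpha_(g^-1)(a) xi) tensor delta_g *)
Definition is_pi (a : G -> R[i]) (P : bop (lp p (G * G)%type)) : Prop :=
  forall (xi : lp p G) (g t h : G),
    P (lptensor xi (lpdelta p g)) (t, h) =
      (ltranslate g^-1%g a t * xi t) * lpdelta p g h.

Definition is_lambda (s : G) (L : bop (lp p G)) : Prop :=
  forall g, L (lpdelta p g) = lpdelta p (s * g)%g.

Definition crossed_linf : set (bop (lp p (G * G)%type)) :=
  [set P | exists2 a : G -> R[i], bounded_fun (a : G -> R[i]^o) & is_pi a P].

Definition crossed_translation : set (bop (lp p (G * G)%type)) :=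
  [set U | exists s L, is_lambda s L /\ is_tensor 1 L U].

Definition crossed_product : set (bop (lp p (G * G)%type)) :=
  closure (lin_span
    [set T | exists P U, [/\ crossed_linf P, crossed_translation U & T = P * U]]).

End crossed_product.
Arguments crossed_linf {R} p G _.
Arguments crossed_translation {R} p G _.
Arguments crossed_product {R} p G _.

(* Main.v *)
(* If e is a diagonal matrix unit e_kk, then |T + (z - 1) e T| <= |T| for all T
   and all z of modulus 1. An isometric isomorphism transports this property to
   the idempotent f = phi(e). Testing it on T = e_mm gives
   |1 + (z - 1) c|^p + |z - 1|^p w <= 1 for c = f_mm and w the p-th power norm of
   the rest of the m-th column of f, and p <> 2 forces w = 0. Thus f is diagonal,
   hence some e_ll by minimality, phi permutes the diagonal matrix units, and since
   |T_kl| = |e_kk T e_ll| it preserves the moduli of entries. The permutation followed by the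
   projection to the space is a coarse equivalence: the image of a partial
   translation has entries of modulus 1 only at bounded distance, and local
   compactness allows only finitely many indices of a fibre to be hit.

   Conversely a coarse equivalence matches X and Y with uniformly finite fibres
   over a common set; enumerating fibres gives a bijection of X x nat with Y x
   nat. Only finitely many types of blocks occur, so conjugation by it preserves
   rank bounds, finite corners and the diagonal. The equality Bs = Bu (x) K comes
   from biorthogonal coordinates of a finite-rank idempotent. Up to a permutation
   the crossed product is 1 (x) Bu. For nonamenable groups the Folner condition
   fails, so large balls expand finite sets by any factor, and Hall's theorem
   followed by Cantor-Schroder-Bernstein replaces a coarse equivalence by a
   bijective one. *)

Require Import Defs.
From HB Require Import structures.
From mathcomp Require Import all_boot all_order all_algebra finmap.
From mathcomp Require Import all_classical all_reals all_analysis.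
From mathcomp Require Import complex ring lra.

Set Implicit Arguments.
Unset Strict Implicit.
Unset Printing Implicit Defensive.

Import Order.TTheory GRing.Theory Num.Theory.
Import numFieldNormedType.Exports.

Local Open Scope classical_set_scope.
Local Open Scope complex_scope.
Local Open Scope ring_scope.

Local Notation normc := Normc.normc.

(** * Operators on l^p *)

(** The algebras need not be unital, so each test is written inside the algebra, as T + (z - 1) e T;
    using z and its inverse together turns the one-sided estimate into an equality. At exponent 2
    this test is useless, since every orthogonal projection passes it. Diagonality must then come
    from the hypothesis on the diagonal subalgebra, which is why rigidity starts from a disjunction.

    To pass from entries to coarse maps, a bound uniform in x has to come out of one operator.
    Bounded geometry makes balls finite, so a worst partner of each point can be chosen, and a
    single partial translation tests all points at once.

    There are no orthogonal projections on l^p, so two finite corners have no canonical common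
    corner. A common idempotent must fix finitely many vectors and preserve finitely many
    functionals at the same time; elimination with evaluations as coordinates provides it. Closures
    are carried through embeddings of operator algebras by means of contractive left inverses. *)

Section lp_estimates.
Context {R : realType}.
Implicit Types (p : exponent R) (I J : choiceType).

Lemma le_opnorm_lp p I (T : bop (lp p I)) (xi : lp p I) :
  lpnorm p (T xi) <= opnorm T * lpnorm p xi.
Proof. by rewrite -lecR rmorphM/= -!lp_normE le_opnorm. Qed.

Lemma opnorm_le_lp p I (T : bop (lp p I)) (M : R) : 0 <= M ->
  (forall xi : lp p I, lpnorm p (T xi) <= M * lpnorm p xi) -> opnorm T <= M.
Proof.
by move=> M0 h; apply: opnorm_le => // xi; rewrite !lp_normE -rmorphM/= lecR.
Qed.

Lemma bop_D (V : normedModType R[i]) (T : bop V) x y : T (x + y) = T x + T y.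
Proof. exact: linearD. Qed.

Lemma bop_B (V : normedModType R[i]) (T : bop V) x y : T (x - y) = T x - T y.
Proof. exact: linearB. Qed.

Lemma bop_Z (V : normedModType R[i]) (T : bop V) z x : T (z *: x) = z *: T x.
Proof. exact: linearZ. Qed.

Lemma bop_sum (V : normedModType R[i]) (T : bop V) (K : Type) (s : seq K)
    (P : pred K) (F : K -> V) :
  T (\sum_(k <- s | P k) F k) = \sum_(k <- s | P k) T (F k).
Proof. exact: linear_sum. Qed.

Lemma opnormM (V : normedModType R[i]) (S T : bop V) :
  opnorm (S * T : bop V) <= opnorm S * opnorm T.
Proof.
apply: opnorm_le => [|x]; first by rewrite mulr_ge0 ?opnorm_ge0.
apply: le_trans (le_opnorm S _) _.
by rewrite rmorphM/= -mulrA ler_wpM2l ?ler0c ?opnorm_ge0// le_opnorm.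
Qed.

Lemma opnorm0 (V : normedModType R[i]) : opnorm (0 : bop V) = 0.
Proof. by apply: complexI; rewrite -bop_normE normr0. Qed.

Lemma opnormN (V : normedModType R[i]) (T : bop V) : opnorm (- T : bop V) = opnorm T.
Proof. by apply: complexI; rewrite -!bop_normE normrN. Qed.

Lemma closure_bopP (V : normedModType R[i]) (A : set (bop V)) (T : bop V) :
  closure A T <->
  (forall e : R, 0 < e -> exists2 S, A S & opnorm (T - S : bop V) < e).
Proof.
split=> [cT e e0|h B /nbhs_ballP[d /= d0 dB]].
  have e0' : 0 < e%:C by rewrite (ltcR 0 e).
  have /cT[S [AS]] := nbhsx_ballx T _ e0'.
  by rewrite -ball_normE/= bop_normE ltcR; exists S.
have dR : d = (complex.Re d)%:C by rewrite RRe_real// gtr0_real.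
have d0' : 0 < complex.Re d by rewrite -(ltcR 0) -dR.
have [S AS ST] := h _ d0'; exists S; split=> //; apply: dB.
by rewrite -ball_normE/= bop_normE dR ltcR.
Qed.

(** With [e <= 1] an approximant of [S] has norm at most [opnorm S + 1], so in product estimates the
    constant [C] can be fixed before [e]. *)
Lemma closure_bop_le (V : normedModType R[i]) (A : set (bop V)) (T : bop V) (C : R) :
  (forall e : R, 0 < e <= 1 -> exists2 S, A S & opnorm (T - S : bop V) <= C * e) ->
  closure A T.
Proof.
move=> h; apply/closure_bopP => e e0; have C0 : 0 < `|C| + 1 by rewrite ltr_wpDl.
have [|S AS TS] := h (Num.min 1 (e / (`|C| + 1))).
  by rewrite lt_min ltr01 divr_gt0//= ge_min lexx.
exists S => //; apply: le_lt_trans TS _; set d := Num.min _ _.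
have d0 : 0 < d by rewrite lt_min ltr01 divr_gt0.
apply: (@lt_le_trans _ _ ((`|C| + 1) * d)).
  by rewrite ltr_pM2r//; apply: le_lt_trans (ler_norm _) _; rewrite ltrDl.
by rewrite -ler_pdivlMl// mulrC ge_min lexx orbT.
Qed.

Lemma esumZ I (u : I -> R) (a : R) : 0 <= a -> (forall i, 0 <= u i) ->
  (\esum_(i in setT) (a * u i)%:E = a%:E * \esum_(i in setT) (u i)%:E)%E.
Proof.
move=> a0 u0; apply/eqP; rewrite eq_le esumZ_le//=.
have [->|an0] := eqVneq a 0.
  by rewrite mul0e esum_ge0// => i _; rewrite mul0r.
have ap : 0 < a by rewrite lt_neqAle eq_sym an0.
rewrite -lee_pdivlMl//; apply: le_trans (esumZ_le _ _); rewrite ?invr_ge0//.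
  by apply: le_esum => i _; rewrite lee_fin mulKf.
by move=> i; rewrite mulr_ge0.
Qed.

Lemma esum_le_fsets I (u : I -> R) (C : \bar R) :
  (forall s : seq I, uniq s -> (\sum_(i <- s) (u i)%:E <= C)%E) ->
  (\esum_(i in setT) (u i)%:E <= C)%E.
Proof.
move=> h; apply: ge_ereal_sup => _ [X [finX _] <-].
by rewrite fsbig_finite//=; exact: h.
Qed.

Lemma le_esum_fset I (u : I -> R) (s : seq I) : (forall i, 0 <= u i) -> uniq s ->
  (\sum_(i <- s) (u i)%:E <= \esum_(i in setT) (u i)%:E)%E.
Proof.
move=> u0 us; apply: esum_ge; exists [set` s] => //.
by rewrite fsbig_seq.
Qed.

(** Grouping the indices by their image under [h], each [u j] is counted at most [N] times. *)
Lemma sum_le_preim I J (s : seq I) (h : I -> J) (P : pred I) (u : J -> R) (N : nat) :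
  (forall j, 0 <= u j) -> uniq s ->
  (forall j (t : seq I), uniq t -> (forall i, i \in t -> P i && (h i == j)) ->
     (size t <= N)%N) ->
  (\sum_(i <- s | P i) u (h i) <=
     N%:R * \sum_(j <- undup (map h s)) u j)%R.
Proof.
move=> u0 us hN.
have -> : \sum_(i <- s | P i) u (h i) =
    \sum_(i <- s | P i) \sum_(j <- undup (map h s) | h i == j) u j.
  rewrite big_seq_cond [RHS]big_seq_cond.
  apply: eq_bigr => i /andP[si _]; rewrite (big_rem (h i))/=; last first.
    by rewrite mem_undup map_f.
  rewrite eqxx big_seq_cond big_pred0 ?addr0// => j.
  apply/negbTE/negP => /andP[]; rewrite mem_rem_uniq ?undup_uniq// inE.
  by case/andP => /negbTE; rewrite eq_sym => ->.
rewrite (exchange_big_dep xpredT)//= mulr_sumr; apply: ler_sum => j _.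
rewrite -big_filter big_const_seq/= iter_addr_0 count_predT -[leLHS]mulr_natl.
rewrite ler_wpM2r// ler_nat; apply: (hN j); first by rewrite filter_uniq.
by move=> i; rewrite mem_filter => /andP[->].
Qed.

End lp_estimates.

(** * Weighted composition operators and density of finitely supported vectors *)

Section weighted_composition.
Context {R : realType}.
Implicit Types (p : exponent R) (I J K : choiceType).

Lemma lp_eqP p I (xi eta : lp p I) : (forall i, xi i = eta i) -> xi = eta.
Proof. by move=> h; apply/val_inj/funext. Qed.

Lemma lpDE p I (xi eta : lp p I) i : (xi + eta) i = xi i + eta i.
Proof. by []. Qed.

Lemma lpNE p I (xi : lp p I) i : (- xi) i = - xi i.
Proof. by []. Qed.

Lemma lpZE p I z (xi : lp p I) i : (z *: xi) i = z * xi i.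
Proof. by []. Qed.

Lemma lp_sumE p I (T : Type) (s : seq T) (P : pred T) (F : T -> lp p I) i :
  (\sum_(t <- s | P t) F t) i = \sum_(t <- s | P t) F t i.
Proof. by elim/big_rec2: _ => // t x xi _ <-. Qed.

(** Boundedness data for xi |-> a * (xi o h): weights of modulus at most [M], and at most [N] points
    of the support of [a] over each [j]. Diagonal operators, restrictions, matrix units, partial
    translations and permutations are all of this kind. *)
Definition wc_bound I J (a : I -> R[i]) (h : I -> J) (M : R) (N : nat) : Prop :=
  [/\ 0 <= M, forall i, normc (a i) <= M &
     forall j (t : seq I), uniq t ->
       (forall i, i \in t -> (a i != 0) && (h i == j)) -> (size t <= N)%N].

Lemma powR_natN p (N : nat) : N%:R <= N%:R `^ p :> R.
Proof.
case: N => [|N]; first by rewrite powR_ge0.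
rewrite -[leLHS]powRr1 ?ler0n// ler_powR ?exponent_ge1//.
by rewrite ler1n.
Qed.

(** The counting argument gives the factor M N^(1/p); as N <= N^p, the cruder M N bounds it. Both
    agree for N = 1, the case in which exact norms matter. *)
Lemma lpsum_wcomp p I J a h M N (xi : J -> R[i]) : @wc_bound I J a h M N ->
  (lpsum p (fun i => a i * xi (h i))%R <= ((M * N%:R) `^ p)%:E * lpsum p xi)%E.
Proof.
move=> [M0 aM hN]; apply: esum_le_fsets => s us.
pose u j := normc (xi j) `^ p.
have u0 j : 0 <= u j by rewrite powR_ge0.
apply: (@le_trans _ _ ((M `^ p) * (N%:R * \sum_(j <- undup (map h s)) u j))%:E).
  rewrite sumEFin lee_fin.
  apply: le_trans (ler_wpM2l (powR_ge0 _ _)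
    (@sum_le_preim R I J s h (fun i => a i != 0) u N u0 us hN)).
  rewrite [leRHS]mulr_sumr (bigID (fun i => a i != 0))/=.
  rewrite [X in _ + X]big1 ?addr0 => [|i /negbNE/eqP ->]; last first.
    by rewrite mul0r Normc.normc0 powR0// gt_eqF// exponent_gt0.
  apply: ler_sum => i _; rewrite Normc.normcM powRM ?normc_ge0// ler_wpM2r ?powR_ge0//.
  by rewrite ge0_ler_powR ?nnegrE ?normc_ge0// ltW// exponent_gt0.
rewrite mulrA EFinM powRM ?ler0n//; apply: lee_pmul.
- by rewrite lee_fin mulr_ge0// powR_ge0.
- by rewrite lee_fin sumr_ge0.
- by rewrite lee_fin ler_wpM2l ?powR_ge0// powR_natN.
- by rewrite -sumEFin; apply: le_esum_fset => //; rewrite undup_uniq.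
Qed.

Lemma wcomp_subproof p I J a h M N (xi : lp p J) : @wc_bound I J a h M N ->
  (fun i => a i * xi (h i)) \in @lp_finite R p I.
Proof.
move=> H; apply/asboolP; apply: le_lt_trans (lpsum_wcomp p xi H) _.
by rewrite lpsumE -EFinM ltry.
Qed.

Definition wcomp p I J a h M N (H : @wc_bound I J a h M N) (xi : lp p J) : lp p I :=
  Lp (wcomp_subproof xi H).

Lemma lpnorm_wcomp p I J a h M N (H : @wc_bound I J a h M N) (xi : lp p J) :
  lpnorm p (wcomp H xi) <= M * N%:R * lpnorm p xi.
Proof.
have MN : 0 <= M * N%:R by case: H => M0 _ _; rewrite mulr_ge0.
apply: lpnorm_le; first by rewrite mulr_ge0 ?lpnorm_ge0.
by apply: le_trans (lpsum_wcomp p xi H) _; rewrite lpsumE -EFinM -powRM ?lpnorm_ge0.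
Qed.

Lemma wcomp_linear p I J a h M N (H : @wc_bound I J a h M N) :
  linear (@wcomp p I J a h M N H).
Proof.
move=> z xi eta; apply/val_inj/funext => i /=.
by rewrite mulrDr; congr (_ + _); exact: mulrCA.
Qed.

Lemma wcop_subproof p I a h M N (H : @wc_bound I I a h M N) :
  (@wcomp p I I a h M N H) \in bounded_op (lp p I).
Proof.
apply/asboolP; split; first exact: wcomp_linear.
by exists (M * N%:R) => xi; rewrite !lp_normE -rmorphM/= lecR lpnorm_wcomp.
Qed.

Definition wcop p I a h M N (H : @wc_bound I I a h M N) : bop (lp p I) :=
  Bop (wcop_subproof p H).

Arguments wcop : simpl never.

Lemma opnorm_wcop p I a h M N (H : @wc_bound I I a h M N) :
  opnorm (wcop p H) <= M * N%:R.
Proof.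
apply: opnorm_le_lp; first by case: H => M0 _ _; rewrite mulr_ge0.
exact: lpnorm_wcomp.
Qed.

Lemma wcopE p I a h M N (H : @wc_bound I I a h M N) (xi : lp p I) i :
  wcop p H xi i = a i * xi (h i).
Proof. by []. Qed.

Lemma scalar_entry_wcop p I a h M N (H : @wc_bound I I a h M N) x y :
  scalar_entry (wcop p H) x y = a x * (h x == y)%:R.
Proof. by []. Qed.

Lemma diag_bound I (a : I -> R[i]) M : 0 <= M -> (forall i, normc (a i) <= M) ->
  wc_bound a id M 1.
Proof.
move=> M0 aM; split=> // j t ut tj.
have /uniq_leq_size : {subset t <= [:: j]}.
  by move=> i /tj/andP[_ /eqP ->]; rewrite inE.
by move=> /(_ ut).
Qed.

Lemma ind_bound I J (D : pred I) (h : I -> J) N :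
  (forall j (t : seq I), uniq t ->
       (forall i, i \in t -> D i && (h i == j)) -> (size t <= N)%N) ->
  wc_bound (fun i => (D i)%:R) h 1 N.
Proof.
move=> hN; split=> // [i|j t ut tj].
  by case: (D i); rewrite ?Normc.normc1 ?Normc.normc0.
by apply: (hN j) => // i /tj; rewrite pnatr_eq0 eqb0 negbK.
Qed.

Lemma inj_bound I J (D : pred I) (h : I -> J) : {in D &, injective h} ->
  wc_bound (fun i => (D i)%:R) h 1 1.
Proof.
move=> hI; apply: ind_bound => j [|i [|k t]]//= /and3P[].
rewrite inE negb_or => /andP[ik _] _ _ H.
have /andP[Di /eqP hi] := H i (mem_head _ _).
have /andP[Dk /eqP hk] : D k && (h k == j) by apply: H; rewrite !inE eqxx orbT.
by case/eqP: ik; apply: hI; rewrite ?hi.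
Qed.

Definition restr p I (D : pred I) : bop (lp p I) :=
  wcop p (inj_bound (D := D) (h := @id I) (fun i j _ _ e => e)).

Arguments restr : simpl never.

Lemma restrE p I (D : pred I) (xi : lp p I) i : restr p D xi i = (D i)%:R * xi i.
Proof. by []. Qed.

Lemma lpsum_restrD p I (D : pred I) (xi : lp p I) :
  lpsum p xi = (lpsum p (restr p D xi) + lpsum p (restr p (predC D) xi))%E.
Proof.
rewrite /lpsum -esumD; last 2 first.
- by move=> i _; rewrite lee_fin powR_ge0.
- by move=> i _; rewrite lee_fin powR_ge0.
apply: eq_esum => i _; rewrite !restrE/= -EFinD; congr EFin.
have p0 : 0 `^ p = 0 :> R by rewrite powR0// gt_eqF// exponent_gt0.
by case: (D i); rewrite /= ?mul1r ?mul0r Normc.normc0 p0 ?addr0 ?add0r.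
Qed.

Lemma lpsum_restr_seq p I (s : seq I) (xi : lp p I) : uniq s ->
  lpsum p (restr p (mem s) xi) = (\sum_(i <- s) (normc (xi i) `^ p)%:E)%E.
Proof.
move=> us; have p0 : 0 `^ p = 0 :> R by rewrite powR0// gt_eqF// exponent_gt0.
have -> : (\sum_(i <- s) (normc (xi i) `^ p)%:E =
    \esum_(i in [set` s]) (normc (restr p (mem s) xi i) `^ p)%:E)%E.
  rewrite esum_fset; last 2 first.
  - exact: finite_seq.
  - by move=> i _; rewrite lee_fin powR_ge0.
  rewrite -fsbig_seq//; apply: eq_big_seq => i si.
  by rewrite restrE /= si mul1r.
rewrite esum_mkcond; apply: eq_esum => i _.
rewrite restrE /=; have [si|si] := boolP (i \in s).
  by rewrite mem_set// mul1r.
by rewrite memNset; [rewrite mul0r Normc.normc0 p0 | exact/negP].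
Qed.

Lemma lp_tail p I (xi : lp p I) (e : R) : 0 < e ->
  exists2 s : seq I, uniq s & lpnorm p (restr p (predC (mem s)) xi) < e.
Proof.
move=> e0; have p0 := exponent_gt0 p.
have ep : 0 < (e / 2) `^ p by rewrite powR_gt0// divr_gt0.
have fx := lpsum_fin xi.
have [_ [X [finX _] <-]] := ub_ereal_sup_adherent ep fx.
rewrite fsbig_finite// => h0; move: h0.
set s := finmap.enum_fset (fset_set X); have us : uniq s by exact: finmap.fset_uniq.
move=> h0; have {h0} : (lpsum p xi - ((e / 2) `^ p)%:E <
  \sum_(i <- s) (normc (xi i) `^ p)%:E)%E by exact: h0.
rewrite -(lpsum_restr_seq xi us) (lpsum_restrD (mem s) xi).
rewrite !lpsumE -!EFinD lte_fin => h; exists s => //.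
have {}h : lpnorm p (restr p (predC (mem s)) xi) `^ p < (e / 2) `^ p by lra.
apply: (@le_lt_trans _ _ (e / 2)); last by lra.
rewrite leNgt; apply/negP => h'.
by move: h; rewrite ltNge ge0_ler_powR ?nnegrE ?lpnorm_ge0 ?ltW// divr_gt0.
Qed.

Lemma lpdeltaE p I (y x : I) : lpdelta p y x = (x == y)%:R.
Proof. by []. Qed.

Lemma lp_sum_delta p I (s : seq I) (xi : lp p I) : uniq s ->
  restr p (mem s) xi = \sum_(i <- s) xi i *: lpdelta p i.
Proof.
move=> us; apply: lp_eqP => k; rewrite restrE lp_sumE.
under eq_bigr do rewrite lpZE /=.
have [ks|ks] := boolP (k \in s).
  rewrite /= ks mul1r (big_rem k)//= eqxx mulr1 big_seq big1 ?addr0// => i.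
  by rewrite mem_rem_uniq// inE => /andP[/negbTE]; rewrite eq_sym => ->; rewrite mulr0.
rewrite /= (negbTE ks) mul0r big_seq big1// => i si.
by case: eqP => [ki|]; rewrite ?mulr0//; case/negP: ks; rewrite ki.
Qed.

Lemma restrC_sub p I (t : seq I) (x : lp p I) :
  x - restr p (mem t) x = restr p (predC (mem t)) x.
Proof.
apply: lp_eqP => i; rewrite lpDE lpNE !restrE /=.
by case: (i \in t); rewrite ?mul1r ?mul0r ?subr0 ?subrr.
Qed.

(** Finitely supported vectors are dense because p is finite: the difference kills the head of [xi],
    and its value on the tail is arbitrarily small. *)
Lemma bop_eq_delta p I (S T : bop (lp p I)) :
  (forall i, S (lpdelta p i) = T (lpdelta p i)) -> S = T.
Proof.
move=> ST; apply/eqP; rewrite -subr_eq0; apply/eqP/bopP => xi.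
apply: lpnorm_eq0; apply/eqP; rewrite eq_le lpnorm_ge0 andbT.
apply/ler_addgt0Pl => e e0; rewrite addr0.
have nT : 0 < opnorm (S - T : bop (lp p I)) + 1.
  by apply: ltr_wpDl; rewrite ?opnorm_ge0.
have [s us hs] := @lp_tail p I xi (e / (opnorm (S - T : bop _) + 1)) (divr_gt0 e0 nT).
have -> : (S - T) xi = (S - T : bop (lp p I)) (restr p (predC (mem s)) xi).
  rewrite -restrC_sub bop_B lp_sum_delta// bop_sum big1 ?subr0// => i _.
  by rewrite bop_Z bopDE bopNE ST subrr scaler0.
apply: le_trans (le_opnorm_lp _ _) _.
apply: (@le_trans _ _ ((opnorm (S - T : bop _) + 1) *
    lpnorm p (restr p (predC (mem s)) xi))).
  by rewrite ler_wpM2r ?lpnorm_ge0// lerDl.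
by rewrite mulrC -ler_pdivlMr// ltW.
Qed.

Lemma bop_eq_entry p I (S T : bop (lp p I)) :
  (forall i j, scalar_entry S i j = scalar_entry T i j) -> S = T.
Proof. by move=> ST; apply: bop_eq_delta => j; apply/val_inj/funext => i; exact: ST. Qed.

Lemma lpnorm_delta p I (i : I) : lpnorm p (lpdelta p i) = 1.
Proof. by rewrite unlock lpsum_delta powR1. Qed.

Lemma normc_scalar_entry_le p I (T : bop (lp p I)) i j :
  normc (scalar_entry T i j) <= opnorm T.
Proof.
apply: le_trans (le_lpnorm _ _) _; apply: le_trans (le_opnorm_lp _ _) _.
by rewrite lpnorm_delta mulr1.
Qed.

End weighted_composition.

(** * Hermitian idempotents and rigidity *)

Section matrix_units.
Context {R : realType} (p : exponent R) (I : choiceType).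
Implicit Types (i j k l m : I) (S T : bop (lp p I)).

Lemma munit_bound k l : wc_bound (fun i : I => (i == k)%:R : R[i]) (fun=> l) 1 1.
Proof.
by apply: (@inj_bound R I I (pred1 k) (fun=> l)) => i j /eqP -> /eqP ->.
Qed.

Definition munit k l : bop (lp p I) := wcop p (munit_bound k l).
Arguments munit : simpl never.

Lemma munitE k l (xi : lp p I) : munit k l xi = xi l *: lpdelta p k.
Proof. by apply: lp_eqP => i; rewrite lpZE mulrC. Qed.

Lemma munit_delta k l : munit k l (lpdelta p l) = lpdelta p k.
Proof. by rewrite munitE /= eqxx scale1r. Qed.

Lemma scalar_entryD S T k l :
  scalar_entry (S + T : bop _) k l = scalar_entry S k l + scalar_entry T k l.
Proof. by []. Qed.

Lemma scalar_entryB S T k l :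
  scalar_entry (S - T : bop _) k l = scalar_entry S k l - scalar_entry T k l.
Proof. by []. Qed.

Lemma scalar_entryZ z T k l :
  scalar_entry (z *: T : bop _) k l = z * scalar_entry T k l.
Proof. by rewrite /scalar_entry bopZE lpZE. Qed.

Lemma scalar_entry_munit k l i j :
  scalar_entry (munit k l) i j = (i == k)%:R * (l == j)%:R.
Proof. by []. Qed.

Lemma munit_mul k l T : munit k k * T * munit l l = scalar_entry T k l *: munit k l.
Proof.
apply: bopP => xi; rewrite !bopM bopZE !munitE bop_Z lpZE scalerA.
by rewrite [X in X *: _]mulrC.
Qed.

Lemma opnorm_mul_munit T m : opnorm (T * munit m m : bop _) = lpnorm p (T (lpdelta p m)).
Proof.
apply/eqP; rewrite eq_le; apply/andP; split.
  apply: opnorm_le_lp => [|xi]; first exact: lpnorm_ge0.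
  by rewrite bopM munitE bop_Z lpnormZ mulrC ler_wpM2l ?lpnorm_ge0 ?le_lpnorm.
have := le_opnorm_lp (T * munit m m) (lpdelta p m).
by rewrite lpnorm_delta mulr1 bopM munit_delta.
Qed.

Lemma opnorm_munit k l : opnorm (munit k l) = 1.
Proof.
have -> : munit k l = munit k l * munit l l :> bop _.
  by apply: bopP => xi; rewrite bopM !munitE lpZE /= eqxx mulr1.
by rewrite opnorm_mul_munit munit_delta lpnorm_delta.
Qed.

Lemma opnorm_munit_mul k l T :
  opnorm (munit k k * T * munit l l : bop _) = normc (scalar_entry T k l).
Proof. by rewrite munit_mul opnormZ opnorm_munit mulr1. Qed.

Definition diagonal_op T := forall i j, i != j -> scalar_entry T i j = 0.

Lemma diagonal_delta T m : diagonal_op T ->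
  T (lpdelta p m) = scalar_entry T m m *: lpdelta p m.
Proof.
move=> dT; apply: lp_eqP => i; rewrite lpZE /=.
have [->|im] := eqVneq i m; first by rewrite mulr1.
by rewrite mulr0; exact: dT.
Qed.

End matrix_units.
Arguments munit : simpl never.

Section hermitian_idempotents.
Context {R : realType}.
(** Let r tend to 0, so that r^q x does too. *)
Lemma powR_below (q y x : R) : 0 < q -> 0 <= x ->
  (forall r, 0 < r <= 1 -> y <= r `^ q * x) -> y <= 0.
Proof.
move=> q0 x0 h; apply/ler_addgt0Pl => e e0; rewrite addr0.
(* The value of r^q to be used: r is then d^(1/q), and d x stays below e. *)
pose d := Num.min 1 (e / (x + 1)).
have x1 : 0 < x + 1 by lra.
have d0 : 0 < d by rewrite /d lt_min ltr01 divr_gt0.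
have dr : (d `^ q^-1) `^ q = d.
  by rewrite -powRrM mulVf ?gt_eqF// powRr1// ltW.
have rl : 0 < d `^ q^-1 <= 1.
  have e1 : 1 = 1 `^ q^-1 :> R by rewrite powR1.
  rewrite powR_gt0//= [leRHS]e1 ge0_ler_powR ?nnegrE ?invr_ge0 ?(ltW q0) ?(ltW d0)//.
  by rewrite /d ge_min lexx.
apply: le_trans (h _ rl) _; rewrite dr.
apply: (@le_trans _ _ (e / (x + 1) * (x + 1))); last by rewrite divfK ?gt_eqF.
by apply: ler_pM; rewrite ?(ltW d0)// ?lerDl// /d ge_min lexx orbT.
Qed.

(** Compare orders at s = 0: 1 - (1 - s b)^q is linear, while s^q w is not, as q <> 1. For q < 1 the
    power dominates and forces w = 0; for q > 1 the linear term dominates, which forces b = 0 and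
    then w = 0. The interval [0, 4] is the range of |z - 1|^2 on the unit circle; below, s = 4 r and
    y = 4^q w. *)
Lemma powR_identity_trivial (q w b : R) : 0 < q -> q != 1 -> 0 <= w ->
  (forall s, 0 <= s <= 4 -> 0 <= 1 - s * b /\ (1 - s * b) `^ q + s `^ q * w = 1) ->
  w = 0.
Proof.
move=> q0 q1 w0 h.
have h4 : 0 <= 1 - 4 * b /\ (1 - 4 * b) `^ q + 4 `^ q * w = 1 by apply: h; lra.
have q4 : 0 < (4 : R) `^ q by rewrite powR_gt0.
set y := 4 `^ q * w in h4.
have y0 : 0 <= y by rewrite mulr_ge0// ltW.
have b0 : 0 <= b.
  rewrite leNgt; apply/negP => bn.
  have : 1 < (1 - 4 * b) `^ q.
    have e1 : 1 = 1 `^ q :> R by rewrite powR1.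
    by rewrite [ltLHS]e1 gt0_ltr_powR ?nnegrE//; lra.
  by case: h4 => _; lra.
suff : y = 0 by move=> /eqP; rewrite /y mulf_eq0 gt_eqF//= => /eqP.
have hr r : 0 < r <= 1 -> (1 - r * (4 * b)) `^ q + r `^ q * y = 1.
  move=> r01; have [|_ hr4] := h (r * 4); first lra.
  by rewrite -[RHS]hr4 powRM ?ler0n ?(ltW (proj1 (andP r01))) // /y !mulrA.
have base r : 0 < r <= 1 -> 0 <= r * (4 * b) <= 1.
  move=> /andP[r0 r1]; have b4 : 0 <= 4 * b by lra.
  have b41 : 4 * b <= 1 by case: h4; lra.
  by apply/andP; split; nra.
have [ql|ql] : q < 1 \/ 1 < q by case: (ltgtP q 1) q1; [left|right|].
  have : y <= 0.
    apply: (@powR_below (1 - q) y (4 * b)); [lra|lra|] => r r01.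
    have rp : 0 < r by case/andP: r01.
    have rq : 0 < r `^ q by rewrite powR_gt0.
    rewrite -(ler_pM2l rq) [leRHS]mulrA -powRD; last by apply/implyP => _; rewrite gt_eqF.
    rewrite (_ : q + (1 - q) = 1) ?powRr1 ?(ltW rp)//; last by lra.
    have := hr _ r01; have /andP[? ?] := base _ r01.
    suff : 1 - r * (4 * b) <= (1 - r * (4 * b)) `^ q by lra.
    have [->|nz] := eqVneq (1 - r * (4 * b)) 0; first by rewrite powR_ge0.
    by apply: ger1_powR; rewrite ?lt_neqAle ?[0 == _]eq_sym ?nz /=; lra.
  lra.
have : 4 * b <= 0.
  apply: (@powR_below (q - 1) (4 * b) y); [lra|lra|] => r r01.
  have rp : 0 < r by case/andP: r01.
  rewrite -(ler_pM2l rp) [leRHS]mulrA -[X in X * _ * y]powRr1 ?(ltW rp)//.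
  rewrite -powRD; last by apply/implyP => _; rewrite gt_eqF.
  rewrite (_ : 1 + (q - 1) = q); last by lra.
  have := hr _ r01; have /andP[? ?] := base _ r01.
  suff : (1 - r * (4 * b)) `^ q <= 1 - r * (4 * b) by lra.
  have [->|nz] := eqVneq (1 - r * (4 * b)) 0; first by rewrite powR0 ?gt_eqF.
  by apply: ge1r_powR; rewrite ?lt_neqAle ?[0 == _]eq_sym ?nz /=; lra.
move=> bl; have b00 : 4 * b = 0 by lra.
by case: h4; rewrite b00 subr0 powR1 => _; lra.
Qed.


Lemma normc_sqr (x y : R) : normc (x +i* y) = Num.sqrt (x ^+ 2 + y ^+ 2).
Proof. by []. Qed.

(* For a Hermitian idempotent f of l^p with f_mm = c and column tail of
   p-th power norm w, the column of 1 + (z - 1) f has p-th power norm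
   |1 + (z - 1) c|^p + |z - 1|^p w. *)
Lemma hermitian_column (p : exponent R) (c : R[i]) (w : R) : (p : R) != 2 -> 0 <= w ->
  (forall z, normc z = 1 ->
     normc (1 + (z - 1) * c) `^ p + normc (z - 1) `^ p * w = 1) -> w = 0.
Proof.
move=> p2 w0 h; have p0 := exponent_gt0 p; case: c h => a b h.
have q0 : 0 < (p : R) / 2 by rewrite divr_gt0.
have sqrtp (x : R) : 0 <= x -> Num.sqrt x `^ p = x `^ ((p : R) / 2).
  by move=> x0; rewrite -powR12_sqrt// -powRrM mulrC.
(* For z = (1 - x) + iy, the relation x^2 + y^2 = 2 x says |z| = 1 and gives |z - 1|^2 = 2 x, while
   [u x y] is |1 + (z - 1) c|^2. *)
pose u (x y : R) := (1 - x * a - y * b) ^+ 2 + (y * a - x * b) ^+ 2.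
have u0 x y : 0 <= u x y by rewrite addr_ge0// sqr_ge0.
have hu (x y : R) : x ^+ 2 + y ^+ 2 = 2 * x ->
    u x y `^ ((p : R) / 2) + (2 * x) `^ ((p : R) / 2) * w = 1.
  move=> xy; have := h ((1 - x) +i* y).
  rewrite normc_sqr => /(_ _)/wrap[].
    rewrite (_ : _ + _ = 1) ?sqrtr1//; lra.
  have -> : ((1 - x) +i* y) - 1 = (- x) +i* y.
    by apply/eqP; rewrite eq_complex /=; apply/andP; split; apply/eqP; lra.
  have -> : 1 + ((- x) +i* y) * (a +i* b) =
      (1 - x * a - y * b) +i* (y * a - x * b).
    by apply/eqP; rewrite eq_complex /=; apply/andP; split; apply/eqP; lra.
  rewrite !normc_sqr !sqrtp ?addr_ge0 ?sqr_ge0//.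
  by rewrite sqrrN xy.
(* The points z = i and z = -i are equally far from 1, so |1 + (z - 1) c| is the same at both, which
   makes c real. *)
have b0 : b = 0.
  have h1 := hu 1 1 ltac:(lra); have h2 := hu 1 (-1) ltac:(lra).
  have : u 1 1 = u 1 (-1).
    by apply: (powR_injective q0); rewrite ?nnegrE//; lra.
  have -> : u 1 (-1) = u 1 1 + b * 4 by rewrite /u; ring.
  lra.
(* With c = a real and s = |z - 1|^2 one has |1 + (z - 1) a|^2 = 1 - s (a - a^2). The exponent p / 2
   differs from 1 exactly because p differs from 2. *)
apply: (@powR_identity_trivial ((p : R) / 2) w (a - a ^+ 2)) => //.
  by apply: contra p2 => /eqP p2; apply/eqP; lra.
move=> s s04; pose y := Num.sqrt (s - s ^+ 2 / 4).
have y2 : y ^+ 2 = s - s ^+ 2 / 4 by rewrite sqr_sqrtr//; nra.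
have uE : u (s / 2) y = 1 - s * (a - a ^+ 2).
  rewrite /u b0; have -> : (1 - s / 2 * a - y * 0) ^+ 2 + (y * a - s / 2 * 0) ^+ 2 =
    (1 - s / 2 * a) ^+ 2 + y ^+ 2 * a ^+ 2 by ring.
  by rewrite y2; field.
rewrite -uE; split=> //; have := hu (s / 2) y.
by rewrite (_ : 2 * (s / 2) = s); [apply; rewrite y2|]; field.
Qed.

End hermitian_idempotents.

Section isometric_isomorphisms.
Context {R : realType}.
Implicit Types U V W : normedModType R[i].

Lemma subalgebraD V (A : set (bop V)) S T : subalgebra A -> A S -> A T -> A (S + T).
Proof. by case=> _ AL _ AS AT; rewrite -[S]scale1r; exact: AL. Qed.

Lemma subalgebraZ V (A : set (bop V)) z T : subalgebra A -> A T -> A (z *: T).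
Proof. by case=> A0 AL _ AT; rewrite -[z *: T]addr0; exact: AL. Qed.

Lemma subalgebra_closure V (A : set (bop V)) : subalgebra A -> subalgebra (closure A).
Proof.
move=> [A0 AL AM]; split; first exact: subset_closure.
- move=> z S T /closure_bopP cS /closure_bopP cT.
  apply: (closure_bop_le (C := normc z + 1)) => e /andP[e0 _].
  have [S' AS' SS'] := cS e e0; have [T' AT' TT'] := cT e e0.
  exists (z *: S' + T'); first exact: AL.
  rewrite opprD addrACA -scalerBr [leRHS]mulrDl mul1r.
  apply: le_trans (opnormD _ _) _; apply: lerD (ltW TT').
  by rewrite opnormZ ler_wpM2l ?normc_ge0// ltW.
- move=> S T /closure_bopP cS /closure_bopP cT.
  apply: (closure_bop_le (C := opnorm T + (opnorm S + 1))) => e /andP[e0 e1].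
  have [S' AS' SS'] := cS e e0; have [T' AT' TT'] := cT e e0.
  exists (S' * T'); first exact: AM.
  have S'le : opnorm S' <= opnorm S + 1.
    rewrite -[S'](subKr S); apply: le_trans (opnormD _ _) _; rewrite opnormN.
    by rewrite lerD2l; apply: le_trans (ltW SS') e1.
  have -> : S * T - S' * T' = (S - S') * T + S' * (T - T').
    by rewrite mulrBl mulrBr addrA subrK.
  rewrite [leRHS]mulrDl; apply: le_trans (opnormD _ _) _; apply: lerD.
    apply: le_trans (opnormM _ _) _.
    by rewrite mulrC ler_wpM2l ?opnorm_ge0// ltW.
  apply: le_trans (opnormM _ _) _.
  by rewrite ler_pM ?opnorm_ge0// ltW.
Qed.

Section properties.
Context V W (A : set (bop V)) (B : set (bop W)) (phi : bop V -> bop W).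
Hypotheses (iphi : isometric_iso A B phi) (sA : subalgebra A).

Lemma isoL z S T : A S -> A T -> phi (z *: S + T) = z *: phi S + phi T.
Proof. by case: iphi => _ h _ _; exact: h. Qed.

Lemma isoM S T : A S -> A T -> phi (S * T) = phi S * phi T.
Proof. by case: iphi => _ _ h _; exact: h. Qed.

Lemma iso_opnorm T : A T -> opnorm (phi T) = opnorm T.
Proof. by case: iphi => _ _ _ h /h /complexI. Qed.

Lemma iso_im T : A T -> B (phi T).
Proof. by case: iphi => -[h _ _] _ _ _ AT; apply: h. Qed.

Lemma iso_onto T : B T -> exists2 S, A S & phi S = T.
Proof. by case: iphi => -[_ _ h] _ _ _ /h[S AS <-]; exists S. Qed.

Lemma iso0 : phi 0 = 0.
Proof.
have A0 : A 0 by case: sA.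
by have := isoL (-1) A0 A0; rewrite scaler0 addr0 scaleN1r addNr.
Qed.

Lemma isoZ z T : A T -> phi (z *: T) = z *: phi T.
Proof.
have A0 : A 0 by case: sA.
by move=> AT; rewrite -[z *: T]addr0 isoL// iso0 addr0.
Qed.

(** [isometric_iso] constrains [phi] on [A] only, so the inverse is a choice of preimages on [B],
    with default value 0 elsewhere. *)
Lemma isometric_iso_inv : exists psi, [/\ isometric_iso B A psi,
  forall T, A T -> psi (phi T) = T & forall T, B T -> phi (psi T) = T].
Proof.
have /choice[psi psiP] : forall T, exists S, B T -> A S /\ phi S = T.
  move=> T; have [BT|nBT] := pselect (B T); last by exists 0.
  by have [S AS <-] := iso_onto BT; exists S.
have phiK T : A T -> psi (phi T) = T.
  move=> AT; have [AS ST] := psiP _ (iso_im AT).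
  case: iphi => -[_ inj _] _ _ _.
  by apply: inj => //; rewrite inE.
have psiK T : B T -> phi (psi T) = T by move=> /psiP[].
exists psi; split=> //; split.
- split=> [T /psiP[]//|S T|T AT].
    by rewrite !inE => BS BT ST; rewrite -(psiK S)// -(psiK T)// ST.
  by exists (phi T); [exact: iso_im | exact: phiK].
- move=> z _ _ /iso_onto[S AS <-] /iso_onto[T AT <-].
  by rewrite -isoL// !phiK//; case: sA => _ AL _; exact: AL.
- move=> _ _ /iso_onto[S AS <-] /iso_onto[T AT <-].
  by rewrite -isoM// !phiK//; case: sA => _ _ AM; exact: AM.
- by move=> _ /iso_onto[T AT <-]; rewrite phiK// !bop_normE iso_opnorm.
Qed.

End properties.

Lemma isometric_iso_comp U V W (A : set (bop U)) (B : set (bop V)) (C : set (bop W))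
    phi psi :
  isometric_iso A B phi -> isometric_iso B C psi -> isometric_iso A C (psi \o phi).
Proof.
move=> iphi ipsi; have im := iso_im iphi; split.
- by case: iphi => h1 _ _ _; case: ipsi => h2 _ _ _; exact: set_bij_comp h1 h2.
- by move=> z S T AS AT; rewrite /= (isoL iphi)// (isoL ipsi)//; exact: im.
- by move=> S T AS AT; rewrite /= (isoM iphi)// (isoM ipsi)//; exact: im.
- move=> T AT; rewrite !bop_normE (iso_opnorm ipsi) ?(iso_opnorm iphi)//.
  exact: im.
Qed.

End isometric_isomorphisms.

Section rigidity.
Context {R : realType} (p : exponent R).
Implicit Types (I J : choiceType).

Definition has_munits I (A : set (bop (lp p I))) := forall k l, A (munit p k l).

Section one_way.
Context I J (A : set (bop (lp p I))) (B : set (bop (lp p J))).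
Context (phi : bop (lp p I) -> bop (lp p J)).
Hypotheses (sA : subalgebra A) (mA : has_munits A) (mB : has_munits B).
Hypothesis iphi : isometric_iso A B phi.

(** Left multiplication by the diagonal operator with z at k and 1 elsewhere is contractive.
    Expanding it around the identity leaves an expression that lies in [A] even when the identity
    does not. *)
Lemma phase_munit_contraction k z (T : bop (lp p I)) : normc z = 1 ->
  opnorm (T + (z - 1) *: (munit p k k * T) : bop (lp p I)) <= opnorm T.
Proof.
move=> z1; have aM i : normc (1 + (z - 1) * (i == k)%:R) <= 1.
  case: eqP => _; last by rewrite mulr0 addr0 Normc.normc1.
  by rewrite mulr1 subrKC z1.
have -> : T + (z - 1) *: (munit p k k * T) = wcop p (diag_bound ler01 aM) * T.
  apply: bopP => xi; apply: lp_eqP => i; rewrite bopDE bopZE !bopM munitE.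
  rewrite wcopE lpDE !lpZE /= [RHS]mulrDl mul1r -mulrA; congr (_ + _ * _).
  by case: eqP => [->|_]; rewrite ?mulr0 ?mul0r ?mulr1 ?mul1r.
apply: le_trans (opnormM _ _) _; rewrite -[leRHS]mul1r ler_wpM2r ?opnorm_ge0//.
by apply: le_trans (opnorm_wcop _ _) _; rewrite mulr1.
Qed.

Lemma phase_image_contraction k z (T : bop (lp p J)) : normc z = 1 -> B T ->
  opnorm (T + (z - 1) *: (phi (munit p k k) * T) : bop (lp p J)) <= opnorm T.
Proof.
move=> z1 /(iso_onto iphi)[S AS <-]; have [_ AL AM] := sA.
have Ae := mA k k; rewrite -(isoM iphi)// addrC -(isoL iphi)//; last exact: AM.
rewrite !(iso_opnorm iphi)//; last by apply: AL => //; exact: AM.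
by rewrite addrC; exact: phase_munit_contraction.
Qed.

Lemma munit_image_idem k : phi (munit p k k) * phi (munit p k k) = phi (munit p k k).
Proof.
rewrite -(isoM iphi)//; congr phi; apply: bopP => xi.
by rewrite bopM !munitE lpZE /= eqxx mulr1.
Qed.

(** For an idempotent f the operators 1 + (z - 1) f and 1 + (z^-1 - 1) f are mutually inverse. Both
    contract the relevant elements of [B], so going from e_mm to its image and back forces equality
    of norms. *)
Lemma lpnorm_phase_image_delta k m z : normc z = 1 ->
  lpnorm p (lpdelta p m + (z - 1) *: phi (munit p k k) (lpdelta p m)) = 1.
Proof.
move=> z1; set f := phi (munit p k k); have [_ AL AM] := sA.
have BL S T c : B S -> B T -> B (c *: S + T).
  move=> /(iso_onto iphi)[S' AS <-] /(iso_onto iphi)[T' AT <-].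
  by rewrite -(isoL iphi)//; apply: (iso_im iphi); exact: AL.
have BM S T : B S -> B T -> B (S * T).
  move=> /(iso_onto iphi)[S' AS <-] /(iso_onto iphi)[T' AT <-].
  by rewrite -(isoM iphi)//; apply: (iso_im iphi); exact: AM.
have Bf : B f by apply: (iso_im iphi).
set e := munit p m m; set T := e + (z - 1) *: (f * e).
have BT : B T by rewrite /T addrC; apply: BL (mB m m); exact: BM Bf (mB m m).
have -> : lpdelta p m + (z - 1) *: f (lpdelta p m) =
    (1 + (z - 1) *: f : bop _) (lpdelta p m) by [].
have TE : T = (1 + (z - 1) *: f) * e.
  by apply: bopP => xi; rewrite bopM !bopDE !bopZE bopM.
rewrite -opnorm_mul_munit -/e -TE -[RHS](opnorm_munit p m m).
apply/eqP; rewrite eq_le phase_image_contraction //=; last exact: mB.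
have z0 : z != 0.
  by apply/eqP => z0; move: z1 => /eqP; rewrite z0 Normc.normc0 eq_sym oner_eq0.
have zV1 : normc z^-1 = 1 by rewrite Normc.normcV z1 invr1.
have := @phase_image_contraction k _ T zV1 BT.
suff -> : T + (z^-1 - 1) *: (phi (munit p k k) * T) = e by [].
apply: bopP => xi; rewrite -/f; have ff v : f (f v) = f v by rewrite -bopM munit_image_idem.
rewrite bopDE bopZE bopM /T !bopDE !bopZE !bopM bop_D bop_Z ff.
have -> : f (e xi) + (z - 1) *: f (e xi) = z *: f (e xi).
  by rewrite -{1}[f (e xi)]scale1r -scalerDl subrKC.
rewrite scalerA -addrA -scalerDl.
rewrite (_ : z - 1 + (z^-1 - 1) * z = 0) ?scale0r ?addr0//.
  by rewrite mulrBl mulVf// mul1r subrKA subrr.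
Qed.

Lemma lpsum_restr1 (xi : lp p J) m :
  lpsum p xi = (normc (xi m) `^ p)%:E + lpsum p (restr p (predC (mem [:: m])) xi).
Proof.
by rewrite (lpsum_restrD (mem [:: m]) xi) lpsum_restr_seq//= big_seq1.
Qed.

Lemma munit_image_diagonal k : (p : R) != 2 -> diagonal_op (phi (munit p k k)).
Proof.
move=> p2 n m nm; set f := phi (munit p k k).
(* Away from m the vector delta_m + (z - 1) f delta_m is (z - 1) times [tail], so the norm identity
   is the hypothesis of [hermitian_column] with w the p-th power norm of [tail]. *)
set tail := restr p (predC (mem [:: m])) (f (lpdelta p m)).
have w0 : lpnorm p tail `^ p = 0.
  apply: (@hermitian_column R p (scalar_entry f m m)) => //; first exact: powR_ge0.
  move=> z z1.
  have := lpnorm_phase_image_delta k m z1; rewrite -/f; set xi := _ + _ => xi1.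
  have : lpsum p xi = 1%:E by rewrite lpsumE xi1 powR1.
  rewrite (lpsum_restr1 xi m).
  have -> : restr p (predC (mem [:: m])) xi = (z - 1) *: tail.
    rewrite /xi bop_D bop_Z (_ : restr _ _ (lpdelta p m) = 0) ?add0r//.
    by apply: lp_eqP => i; rewrite restrE /= inE; case: eqP; rewrite ?mul0r ?mulr0.
  rewrite (_ : xi m = 1 + (z - 1) * scalar_entry f m m); last first.
    by rewrite lpDE lpZE /= eqxx.
  by rewrite lpsumE lpnormZ powRM ?normc_ge0 ?lpnorm_ge0// -EFinD => -[].
have /lpnorm_eq0/(congr1 (fun xi : lp p J => xi n)) : lpnorm p tail = 0.
  exact: powR_eq0_eq0 w0.
by rewrite restrE /= inE nm mul1r.
Qed.

Lemma munit_image k : diagonal_op (phi (munit p k k)) ->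
  exists m, phi (munit p k k) = munit p m m.
Proof.
set f := phi (munit p k k) => df.
have fd m : f (lpdelta p m) = scalar_entry f m m *: lpdelta p m.
  exact: diagonal_delta.
have ff : f * f = f by exact: munit_image_idem.
have f01 m : scalar_entry f m m != 0 -> scalar_entry f m m = 1.
  move=> fm; apply: (mulfI fm); rewrite mulr1.
  rewrite -[in RHS]ff /scalar_entry bopM fd bop_Z fd !lpZE /=.
  by rewrite -/(scalar_entry f m m) eqxx !mulr1.
have [[m fm]|f0] := pselect (exists m, scalar_entry f m m != 0); last first.
  have : opnorm f = 1 by rewrite /f (iso_opnorm iphi)// opnorm_munit.
  have -> : f = 0.
    apply: bop_eq_delta => m; rewrite fd; have [->|fm] := eqVneq (scalar_entry f m m) 0.
      by rewrite scale0r.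
    by case: f0; exists m.
  by rewrite opnorm0 => /eqP; rewrite eq_sym oner_eq0.
exists m; have fm1 := f01 m fm.
have [S AS SE] := iso_onto iphi (mB m m).
have fef : f * munit p m m * f = munit p m m.
  apply: bop_eq_delta => j; rewrite !bopM fd bop_Z !munitE /= !bop_Z fd fm1 scale1r.
  by case: eqP => [<-|_]; rewrite ?fm1 ?scale1r// ?mulr0n !scale0r ?scaler0.
(* Minimality of e_kk: with S the preimage of e_mm, e_mm = f e_mm f is the image of e_kk S e_kk =
   S_kk e_kk. Hence e_mm is a multiple of f, and f has no second nonzero diagonal entry. *)
have eS : munit p m m = scalar_entry S k k *: f.
  rewrite -[LHS]fef -SE -/f /f -(isoZ iphi)// -munit_mul !(isoM iphi)//.
  by case: sA => _ _; apply.
apply: bop_eq_delta => n; rewrite fd munitE /=.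
have [->|nm] := eqVneq n m; first by rewrite fm1.
have [->|fn] := eqVneq (scalar_entry f n n) 0; first by rewrite mulr0n !scale0r.
have := congr1 (fun T => scalar_entry T n n) eS; rewrite scalar_entryZ (f01 _ fn) mulr1.
rewrite scalar_entry_munit (negbTE nm) mul0r => S0.
by have := opnorm_munit p m m; rewrite eS -S0 scale0r opnorm0 => /eqP; rewrite eq_sym oner_eq0.
Qed.

End one_way.

(** The second alternative is what an isomorphism preserving the diagonal subalgebras supplies, and
    it includes exponent 2. Its two halves give diagonality for [phi] and for the inverse of
    [phi]. *)
Lemma rigid_entries I J (A : set (bop (lp p I))) (B : set (bop (lp p J))) phi :
  subalgebra A -> subalgebra B -> has_munits A -> has_munits B ->
  isometric_iso A B phi ->
  (p : R) != 2 \/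
    ((forall k, diagonal_op (phi (munit p k k))) /\
     (forall T k, A T -> phi T = munit p k k -> diagonal_op T)) ->
  exists (s : I -> J) (t : J -> I), [/\ cancel s t, cancel t s,
    forall T, A T -> exists2 S, B S & forall k l,
      normc (scalar_entry S (s k) (s l)) = normc (scalar_entry T k l) &
    forall S, B S -> exists2 T, A T & forall k l,
      normc (scalar_entry S (s k) (s l)) = normc (scalar_entry T k l)].
Proof.
move=> sA sB mA mB iphi hyp.
have [psi [ipsi phiK psiK]] := isometric_iso_inv iphi sA.
have dphi k : diagonal_op (phi (munit p k k)).
  by case: hyp => [p2|[]//]; exact: (munit_image_diagonal sA mA mB iphi).
have dpsi k : diagonal_op (psi (munit p k k)).
  case: hyp => [p2|[_ h]]; first exact: (munit_image_diagonal sB mB mA ipsi).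
  by apply: (h _ k); [exact: (iso_im ipsi) | rewrite psiK].
have /choice[s sE] : forall k, exists m, phi (munit p k k) = munit p m m.
  by move=> k; exact: (munit_image sA mA mB iphi).
have /choice[t tE] : forall k, exists m, psi (munit p k k) = munit p m m.
  by move=> k; exact: (munit_image sB mB mA ipsi).
have munitI (K : choiceType) (k l : K) : munit p k k = munit p l l -> k = l.
  move=> /(congr1 (fun T => scalar_entry T k k)); rewrite !scalar_entry_munit eqxx.
  by case: eqP => // _ /eqP; rewrite mul0r mulr1 oner_eq0.
have st : cancel s t by move=> k; apply: munitI; rewrite -tE -sE phiK.
have ts : cancel t s by move=> k; apply: munitI; rewrite -sE -tE psiK.
have main T k l : A T ->
    normc (scalar_entry (phi T) (s k) (s l)) = normc (scalar_entry T k l).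
  move=> AT; rewrite -!opnorm_munit_mul -!sE; case: (sA) => _ _ AM.
  have AeT : A (munit p k k * T) by exact: AM.
  by rewrite -!(isoM iphi)// (iso_opnorm iphi)//; exact: AM.
exists s, t; split=> // [T AT|S /(iso_onto iphi)[T AT <-]].
  by exists (phi T); [exact: (iso_im iphi) | move=> k l; exact: main].
by exists T => // k l; exact: main.
Qed.

End rigidity.

(** * Coarse maps read off from entries of modulus one *)

Section coarse_from_entries.
Context {R : realType} (p : exponent R).
Implicit Types (X Y : metricType R) (I J : choiceType).

Lemma finite_argmax (T : choiceType) (S : set T) (f : T -> R) : finite_set S ->
  S !=set0 -> exists2 m, S m & forall x, S x -> f x <= f m.
Proof.
move=> finS [x0 Sx0]; pose s := finmap.enum_fset (fset_set S).
have sS x : S x -> x \in s by move=> Sx; rewrite in_fset_set// inE.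
have [m _ hm] := @arg_maxP _ _ (seq_sub s) (SeqSub (sS _ Sx0)) xpredT (fun z => f (ssval z)) isT.
exists (ssval m); first by have := ssvalP m; rewrite in_fset_set// inE.
by move=> x Sx; exact: (hm (SeqSub (sS _ Sx))).
Qed.

Lemma ball_finite X : bounded_geometry X -> forall (x : X) (r : R),
  finite_set [set y | mdist x y <= r].
Proof.
move=> bX x r; have r0 : 0 <= `|r| by [].
have [N hN] := bX _ r0; apply: (@sub_finite_set _ _ [set y | mdist x y <= `|r|]).
  by move=> y /= h; exact: le_trans h (ler_norm r).
by apply/finite_set_leP; exists N.
Qed.

(* What rigidity uses of an algebra of operators indexed by a space I fibred over X,
   with base points io; the last clause is the only trace of local compactness. *)
Definition coarse_alg X I (pi : I -> X) (io : X -> I) (A : set (bop (lp p I))) :=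
  [/\ forall T, A T -> forall e : R, 0 < e -> exists r : R, forall k l,
        e <= normc (scalar_entry T k l) -> mdist (pi k) (pi l) <= r,
      forall (h : X -> X) (r : R), (forall x, mdist x (h x) <= r) ->
        exists2 T, A T & forall x, scalar_entry T (io x) (io (h x)) = 1 &
      forall (T : bop (lp p I)) (S : set I), A T ->
        (forall k, S k -> normc (scalar_entry T k k) = 1) ->
        (forall x, finite_set (S `&` [set k | pi k = x])) /\
        (forall j : X -> I, (forall x, pi (j x) = x /\ (S (j x) \/ j x = io x)) ->
          exists2 U, A U & forall x, scalar_entry U (io x) (j x) = 1)].

(** Both claims bound a supremum over all points by the propagation of one operator: an extremal
    partner is chosen for each point, an operator with entries 1 at these pairs is moved to the
    other algebra, and its entries of modulus 1 are confined there. Exchanging the roles of X and Y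
    gives the other half of a coarse equivalence. *)
Lemma coarse_alg_half X Y I J (pi : I -> X) (io : X -> I) (pj : J -> Y) (jo : Y -> J)
    (A : set (bop (lp p I))) (B : set (bop (lp p J))) (s : I -> J) (t : J -> I) :
  bounded_geometry X -> cancel io pi -> cancel jo pj -> coarse_alg pi io A -> coarse_alg pj jo B ->
  cancel s t -> cancel t s ->
  (forall T, A T -> exists2 S, B S & forall k l,
    normc (scalar_entry S (s k) (s l)) = normc (scalar_entry T k l)) ->
  (forall S, B S -> exists2 T, A T & forall k l,
    normc (scalar_entry S (s k) (s l)) = normc (scalar_entry T k l)) ->
  let f x := pj (s (io x)) in let g y := pi (t (jo y)) in
  uniformly_expansive f /\ Defs.close (f \o g) idfun.
Proof.
move=> bX iK jK [A1 A2 A3] [B1 B2 B3] st ts AB BA f g; split.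
  move=> r r0.
  (* [h x] is a point of the r-ball around x whose image is farthest from [f x], so bounding the
     pairs (x, h x) bounds all pairs at distance at most r. *)
  have /choice[h hP] : forall x, exists y, mdist x y <= r /\
      forall z, mdist x z <= r -> mdist (f x) (f z) <= mdist (f x) (f y).
    move=> x; have [||y xy ym] :=
        @finite_argmax _ [set y | mdist x y <= r] (fun z => mdist (f x) (f z)).
    - exact: ball_finite.
    - by exists x; rewrite /= mdistxx ltW.
    - by exists y.
  have [T AT hT] := A2 h r (fun x => (hP x).1).
  have [S BS hS] := AB T AT.
  have [r' hr'] := B1 S BS 1 ltr01.
  exists (Num.max r' 1); first by rewrite lt_max ltr01 orbT.
  move=> x1 x2 x12; apply: le_trans ((hP x1).2 _ x12) _.
  rewrite le_max; apply/orP; left; apply: hr'.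
  by rewrite hS hT Normc.normc1.
(* An operator with entries 1 at all diagonal positions [jo y], pulled back to [A], has diagonal
   entries of modulus 1 at all [t (jo y)]. Local compactness then makes the fibres of g finite. *)
have [|E BE hE] := B2 id 0; first by move=> y; rewrite mdistxx.
have [T AT hT] := BA E BE.
have [|finS selS] := A3 T (range (t \o jo)) AT.
  by move=> _ [y _ <-]; rewrite -hT /= ts hE Normc.normc1.
have finG x : finite_set [set y | g y = x].
  apply: (@sub_finite_set _ _ ((pj \o s) @` (range (t \o jo) `&` [set k | pi k = x]))).
    by move=> y gy; exists (t (jo y)); [split=> //; exists y | rewrite /= ts jK].
  by apply: finite_image; exact: finS.
(* [j x] is [t (jo z)] for the point z of the g-fibre over x farthest from [f x], and the base point
   if the fibre is empty. An entry at (io x, j x) is moved by s to (s (io x), jo z), and so controls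
   d(f x, z). *)
have /choice[j jP] : forall x, exists k, [/\ pi k = x,
    range (t \o jo) k \/ k = io x &
    forall y, g y = x -> mdist (f x) y <= mdist (f x) (pj (s k))].
  move=> x; have [[y gy]|ng] := pselect (exists y, g y = x).
    have [||z gz zm] := @finite_argmax _ [set y | g y = x] (fun z => mdist (f x) z).
    - exact: finG.
    - by exists y.
    exists (t (jo z)); split=> //; first by left; exists z.
    by move=> u gu; rewrite ts jK; exact: zm.
  by exists (io x); split; [exact: iK | by right | move=> y gy; case: ng; exists y].
have [U AU hU] := selS j (fun x => let: And3 h1 h2 _ := jP x in conj h1 h2).
have [S BS hS] := AB U AU; have [C hC] := B1 S BS 1 ltr01.
exists C => y /=; have [_ _ /(_ y erefl)] := jP (g y).
rewrite metric_sym [leRHS]metric_sym metric_sym => /le_trans; apply.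
by rewrite metric_sym; apply: hC; rewrite hS hU Normc.normc1.
Qed.

Lemma coarse_alg_rigid X Y I J (pi : I -> X) (io : X -> I) (pj : J -> Y) (jo : Y -> J)
    (A : set (bop (lp p I))) (B : set (bop (lp p J))) phi :
  bounded_geometry X -> bounded_geometry Y -> cancel io pi -> cancel jo pj ->
  coarse_alg pi io A -> coarse_alg pj jo B ->
  subalgebra A -> subalgebra B -> has_munits A -> has_munits B ->
  isometric_iso A B phi ->
  (p : R) != 2 \/
    ((forall k, diagonal_op (phi (munit p k k))) /\
     (forall T k, A T -> phi T = munit p k k -> diagonal_op T)) ->
  coarsely_equivalent X Y.
Proof.
move=> bX bY iK jK cA cB sA sB mA mB iphi hyp.
have [s [t [st ts AB BA]]] := rigid_entries sA sB mA mB iphi hyp.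
have [f1 f2] := coarse_alg_half bX iK jK cA cB st ts AB BA.
have [||g1 g2] := coarse_alg_half bY jK iK cB cA ts st.
- move=> S /BA[T AT h]; exists T => // k l; by rewrite -h !ts.
- move=> T /AB[S BS h]; exists S => // k l; by rewrite -h !ts.
by exists (fun x => pj (s (io x))), (fun y => pi (t (jo y))).
Qed.

End coarse_from_entries.

(** * Finite propagation and Roe-type algebras *)

Section propagation.
Context {R : realType} (p : exponent R).
Implicit Types (X : metricType R) (I J : choiceType).

Lemma propagationP X (nz : X -> X -> Prop) :
  (propagation nz < +oo)%E <-> exists r : R, forall x y, nz x y -> mdist x y <= r.
Proof.
split=> [h|[r hr]].
  have ub x y : nz x y -> ((mdist x y)%:E <= propagation nz)%E.
    by move=> nxy; apply: ereal_sup_ubound; exists (x, y).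
  move: h ub; case: (propagation nz) => [r _ ub|//|_ ub].
    by exists r => x y /ub; rewrite lee_fin.
  by exists 0 => x y /ub; rewrite leNgt ltNyr.
apply: (@le_lt_trans _ _ r%:E); last by rewrite ltry.
by apply: ge_ereal_sup => _ [[x y] /= /hr h <-]; rewrite lee_fin.
Qed.

Lemma lptensor_delta I J (i : I) (j : J) :
  lptensor (lpdelta p i) (lpdelta p j) = lpdelta p (i, j).
Proof.
apply: lp_eqP => -[k l] /=; rewrite xpair_eqE.
by case: eqP => _; rewrite ?mul1r ?mul0r.
Qed.

Lemma scalar_entry_entry I J (T : bop (lp p (I * J)%type)) x y i j :
  scalar_entry (entry T x y) i j = scalar_entry T (x, i) (y, j).
Proof. by rewrite /scalar_entry /entry /= -lptensor_delta. Qed.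

Lemma fin_propP X J (T : bop (lp p (X * J)%type)) : fin_prop T <->
  exists r : R, forall k l, scalar_entry T k l != 0 -> mdist k.1 l.1 <= r.
Proof.
apply: iff_trans (propagationP _) _; split=> -[r hr]; exists r.
  move=> [x i] [y j] Tn; apply: hr; apply: contra Tn => /eqP T0.
  by rewrite -scalar_entry_entry T0 /scalar_entry bop0E.
move=> x y; have [//|nr] := boolP (mdist x y <= r); case/eqP.
apply: bop_eq_entry => i j; rewrite scalar_entry_entry.
apply/eqP; apply: contraNT nr; exact: hr.
Qed.

Lemma fin_prop_uP X (T : bop (lp p X)) : fin_prop_u T <->
  exists r : R, forall k l, scalar_entry T k l != 0 -> mdist k l <= r.
Proof. exact: propagationP. Qed.

(* Row k of S vanishes off the support of xi only through its entries, since the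
   operator e_k S e_D has zero entries. *)
Lemma row_eq0 I (S : bop (lp p I)) k (xi : lp p I) :
  (forall m, scalar_entry S k m * xi m = 0) -> S xi k = 0.
Proof.
move=> h; pose D : pred I := fun m => scalar_entry S k m == 0.
have -> : xi = restr p D xi.
  apply: lp_eqP => m; rewrite restrE /D; case: eqP => [_|/eqP Sm]; first by rewrite mul1r.
  by rewrite mul0r; have /eqP := h m; rewrite mulf_eq0 (negbTE Sm) => /eqP.
have : munit p k k * S * restr p D = 0.
  apply: bop_eq_delta => m; apply: lp_eqP => i; rewrite !bopM bop0E munitE lpZE.
  have -> : restr p D (lpdelta p m) = (D m)%:R *: lpdelta p m.
    apply: lp_eqP => l; rewrite restrE lpZE /=.
    by case: eqP => [->|_]; rewrite ?mulr0.
  rewrite bop_Z lpZE -/(scalar_entry S k m).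
  rewrite -/(D m) /D; case: eqP => [->|_]; rewrite ?mulr0 ?mul0r//.
by move=> /(congr1 (fun T : bop _ => T xi k)); rewrite !bopM munitE lpZE /= eqxx mulr1.
Qed.

(** A substitute for the infinite sum in the matrix product formula: support questions only ask
    where a product may be nonzero. *)
Lemma scalar_entryM_neq0 I (S T : bop (lp p I)) k l : scalar_entry (S * T) k l != 0 ->
  exists m, scalar_entry S k m != 0 /\ scalar_entry T m l != 0.
Proof.
move=> ST; apply: contrapT => /forallNP h; move: ST => /eqP; apply.
rewrite /scalar_entry bopM; apply: row_eq0 => m; apply/eqP; rewrite mulf_eq0.
by apply/negPn/negP; rewrite negb_or => /andP; exact: h.
Qed.

(** A limit may have infinite propagation, but an entry of modulus at least e is still nonzero in an
    approximant at distance less than e. *)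
Lemma closure_propagation X I (pi : I -> X) (A : set (bop (lp p I))) :
  (forall T, A T -> exists r : R, forall k l,
     scalar_entry T k l != 0 -> mdist (pi k) (pi l) <= r) ->
  forall T, closure A T -> forall e : R, 0 < e -> exists r : R, forall k l,
     e <= normc (scalar_entry T k l) -> mdist (pi k) (pi l) <= r.
Proof.
move=> hA T /closure_bopP cT e e0; have [S /hA[r hr] TS] := cT e e0.
exists r => k l hT; apply: hr; apply/eqP => S0.
have := normc_scalar_entry_le (T - S : bop _) k l.
by rewrite scalar_entryB S0 subr0 leNgt (lt_le_trans TS hT).
Qed.

Definition propagates X I (pi : I -> X) (T : bop (lp p I)) : Prop :=
  exists r : R, forall k l, scalar_entry T k l != 0 -> mdist (pi k) (pi l) <= r.

Lemma propagatesL X I (pi : I -> X) z S T :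
  propagates pi S -> propagates pi T -> propagates pi (z *: S + T).
Proof.
move=> [r hr] [s hs]; exists (Num.max r s) => k l ST; rewrite le_max.
have [S0|/hr -> //] := eqVneq (scalar_entry S k l) 0.
rewrite hs ?orbT//; apply: contra ST => /eqP T0.
by rewrite scalar_entryD scalar_entryZ S0 T0 mulr0 addr0.
Qed.

Lemma propagatesM X I (pi : I -> X) S T :
  propagates pi S -> propagates pi T -> propagates pi (S * T).
Proof.
move=> [r hr] [s hs]; exists (r + s) => k l /scalar_entryM_neq0[m [/hr h1 /hs h2]].
exact: le_trans (metric_triangle _ (pi m) _) (lerD h1 h2).
Qed.

End propagation.

Section roe_algebras.
Context {R : realType} (p : exponent R).
Implicit Types (X : metricType R) (I J : choiceType).

Lemma card_le_size (T : choiceType) (A : set T) (N : nat) (t : seq T) :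
  (A #<= `I_N)%card -> uniq t -> (forall x, x \in t -> A x) -> (size t <= N)%N.
Proof.
move=> AN ut tA; apply: leq_trans (geq_card_fset_set AN).
have finA : finite_set A by apply/finite_set_leP; exists N.
by apply: uniq_leq_size => // x /tA Ax; rewrite in_fset_set// inE.
Qed.

Lemma selector_bound X J (H : X -> X * J) (j0 : J) (r : R) : bounded_geometry X ->
  (forall x, mdist x (H x).1 <= r) ->
  exists N, wc_bound (fun k : X * J => (k.2 == j0)%:R : R[i]) (fun k => H k.1) 1 N.
Proof.
move=> bX hr; have [N hN] := bX `|r| (normr_ge0 _); exists N.
apply: (@ind_bound R _ _ (fun k : X * J => k.2 == j0) (fun k => H k.1)) => l t ut tl.
have -> : size t = size (map fst t) by rewrite size_map.
have := hN l.1; move=> /card_le_size; apply.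
  rewrite map_inj_in_uniq// => -[x i] [y j] /tl/andP[/= /eqP -> _].
  by move=> /tl/andP[/= /eqP -> _] /= ->.
move=> _ /mapP[k /tl/andP[_ /eqP <-] ->] /=.
by rewrite metric_sym; apply: le_trans (hr _) (ler_norm _).
Qed.

(** A partial translation realising the pairs ((x, j0), H x). Bounded geometry bounds the fibres of
    [H]; since all output sits in the slot [j0], every block has rank at most one, so the operator
    lies in every algebraic Roe-type algebra. *)
Lemma selector X J (H : X -> X * J) (j0 : J) (r : R) : bounded_geometry X ->
  (forall x, mdist x (H x).1 <= r) ->
  exists U : bop (lp p (X * J)%type),
    [/\ forall x, scalar_entry U (x, j0) (H x) = 1, fin_prop U,
        forall k l, scalar_entry U k l != 0 -> k.2 = j0 /\ l = H k.1 &
        forall xi k, k.2 != j0 -> U xi k = 0].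
Proof.
move=> bX hr; have [N HN] := selector_bound j0 bX hr.
have hU k l : scalar_entry (wcop p HN) k l != 0 -> k.2 = j0 /\ l = H k.1.
  rewrite scalar_entry_wcop; case: (k.2 =P j0) => [->|_]; last by rewrite mul0r eqxx.
  by case: (H k.1 =P l) => [->|_]; rewrite ?mulr0 ?eqxx.
exists (wcop p HN); split=> //.
- by move=> x; rewrite scalar_entry_wcop /= !eqxx mulr1.
- by apply/fin_propP; exists r => k l /hU[_ ->]; exact: hr.
- by move=> xi k /negbTE k0; rewrite wcopE k0 mul0r.
Qed.

Lemma bounded_rank_row X J (j0 : J) (U : bop (lp p (X * J)%type)) :
  (forall xi k, k.2 != j0 -> U xi k = 0) -> bounded_rank U.
Proof.
move=> hU; exists 1%N => x y; exists (fun=> lpdelta p j0) => _ [eta _ <-].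
exists 1%N, (fun=> entry U x y eta j0), (fun=> lpdelta p j0); split; first by exists ord0.
rewrite big_ord1; apply: lp_eqP => j; rewrite lpZE /=.
have [->|jj0] := eqVneq j j0; first by rewrite mulr1.
by rewrite mulr0; exact: hU.
Qed.

Lemma finite_large I (xi : lp p I) (e : R) : 0 < e ->
  finite_set [set i | e <= normc (xi i)].
Proof.
move=> e0; have [s us hs] := lp_tail xi e0.
apply: (@sub_finite_set _ _ [set` s]); last exact: finite_seq.
move=> i /= ei; apply: contraT => si.
have := le_lpnorm (restr p (predC (mem s)) xi) i.
by rewrite restrE /= si mul1r leNgt (lt_le_trans hs).
Qed.

Lemma precompact_net I (A : set (lp p I)) (e : R) : 0 < e -> precompact A ->
  exists s : seq (lp p I), forall v, A v -> exists2 w, w \in s & lpnorm p (v - w) < e.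
Proof.
move=> e0 [C AC [cC _]]; have e0' : 0 < e%:C by rewrite (ltcR 0 e).
move: cC; rewrite compact_cover => /(_ _ C (fun w => ball w e%:C))[].
- by move=> w _; exact: ball_open.
- by move=> w Cw; exists w => //; exact: ballxx.
move=> D DC CD; exists (finmap.enum_fset D) => v /AC/CD[w /= wD].
by rewrite -ball_normE/= distrC lp_normE ltcR; exists w.
Qed.

(** Each T delta_k is within e/2 of a member w of a finite net, so a diagonal entry of modulus at
    least e gives |w_k| >= e/2; a vector w of l^p allows this for finitely many k only. *)
Lemma compact_diag (K : choiceType) (T : bop (lp p K)) (e : R) : 0 < e ->
  compact_op T -> finite_set [set k | e <= normc (scalar_entry T k k)].
Proof.
move=> e0 cT; have e2 : 0 < e / 2 by rewrite divr_gt0.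
have [s hs] := precompact_net e2 cT.
apply: (@sub_finite_set _ _ (\bigcup_(w in [set` s]) [set i | e / 2 <= normc (w i)])).
  move=> k /= ek; have [|w ws hw] := hs (T (lpdelta p k)).
    by exists (lpdelta p k) => //; rewrite /= lp_normE lpnorm_delta.
  exists w => //=; rewrite leNgt; apply/negP => wk.
  have := le_lpnorm (T (lpdelta p k) - w) k; rewrite lpDE lpNE.
  rewrite -/(scalar_entry T k k) => hk.
  have := normcD_le (scalar_entry T k k - w k) (w k); rewrite subrK => h1.
  have := lt_le_trans hw (lexx _); lra.
by apply: bigcup_finite => [|w _]; [exact: finite_seq | exact: finite_large].
Qed.

Lemma scalar_entry_near (I : choiceType) (S T : bop (lp p I)) (e : R) k l :
  opnorm (T - S : bop _) < e ->
  normc (scalar_entry T k l) < normc (scalar_entry S k l) + e.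
Proof.
move=> TS; have := normc_scalar_entry_le (T - S : bop _) k l.
rewrite scalar_entryB; have := normcD_le (scalar_entry T k l - scalar_entry S k l) (scalar_entry S k l).
by rewrite subrK; lra.
Qed.

Lemma munit_fin_prop X J k l : fin_prop (munit p k l : bop (lp p (X * J)%type)).
Proof.
apply/fin_propP; exists (mdist k.1 l.1) => i j; rewrite scalar_entry_munit.
case: (i =P k) => [->|_]; last by rewrite mul0r eqxx.
by case: (l =P j) => [->|_]; rewrite ?mulr0 ?eqxx.
Qed.

Lemma roe_coarse_alg X s (A : set (bop (lp p (X * fiber s)%type))) (j0 : fiber s) :
  bounded_geometry X -> roe_type A ->
  [/\ coarse_alg fst (fun x : X => (x, j0)) A, subalgebra A & has_munits A].
Proof.
move=> bX [A0 [sA0 locA0 rkA0] ->].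
have rowA0 U : fin_prop U -> (forall xi k, k.2 != j0 -> U xi k = 0) -> closure A0 U.
  by move=> fU rU; apply: subset_closure; apply: rkA0 => //; exact: bounded_rank_row rU.
split; last 2 first.
- exact: subalgebra_closure.
- move=> k l; apply: subset_closure; apply: rkA0; first exact: munit_fin_prop.
  apply: (@bounded_rank_row _ _ k.2) => xi m mk; rewrite munitE lpZE /=.
  by case: (m =P k) mk => [->|_ _]; rewrite ?eqxx// mulr0.
split.
- by apply: closure_propagation => T /locA0[/fin_propP].
- move=> h r hr; have [U [U1 fU _ rU]] := selector (H := fun x => (h x, j0)) j0 bX hr.
  by exists U => //; exact: rowA0.
move=> T S cT ST; split=> [x|j jP].
  (* Where [T] has diagonal entries of modulus 1, a locally compact approximant within 1/2 has
     entries of modulus above 1/2. *)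
  move: cT => /closure_bopP/(_ (1 / 2))[|T0 /locA0[_ /(_ x x) comp] TT0].
    by rewrite divr_gt0.
  have h2 : 0 < 1 / 2 :> R by rewrite divr_gt0.
  apply: (@sub_finite_set _ _ ((pair x) @`
      [set i | 1 / 2 <= normc (scalar_entry (entry T0 x x) i i)])).
    move=> [y i] [/= Syi yx]; subst y; exists i => //=.
    have := scalar_entry_near (x, i) (x, i) TT0.
    by rewrite (ST _ Syi) scalar_entry_entry; lra.
  by apply: finite_image; exact: compact_diag.
have [x|U [U1 fU _ rU]] := @selector X (fiber s) j j0 0 bX.
  by rewrite (jP x).1 mdistxx.
by exists U => //; exact: rowA0.
Qed.

End roe_algebras.

(** * Finite-rank idempotents and stabilisation *)

Section echelon.
Context {F : fieldType} {V : lmodType F} {K : Type} (ev : V -> K -> F).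
Hypothesis evP : forall z x y k, ev (z *: x + y) k = z * ev x k + ev y k.
Hypothesis ev_inj : forall x, (forall k, ev x k = 0) -> x = 0.

Lemma ev0 k : ev 0 k = 0.
Proof.
by have := evP (-1) 0 0 k; rewrite scaler0 addr0 mulN1r addNr.
Qed.

Lemma evD x y k : ev (x + y) k = ev x k + ev y k.
Proof. by rewrite -[x]scale1r evP mul1r scale1r. Qed.

Lemma evZ z x k : ev (z *: x) k = z * ev x k.
Proof. by rewrite -[z *: x]addr0 evP ev0 addr0. Qed.

Lemma ev_sum (T : Type) (s : seq T) (f : T -> V) k :
  ev (\sum_(t <- s) f t) k = \sum_(t <- s) ev (f t) k.
Proof. by elim/big_rec2: _ => [|t a b _ <-]; rewrite ?ev0 ?evD. Qed.

(* Gauss-Jordan elimination: the pivots of a finite family are points where it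
   becomes biorthogonal, so coordinates are evaluations. *)
Lemma echelon (s : seq V) : exists (r : nat) (u : 'I_r -> V) (m : 'I_r -> K),
  [/\ forall i j, ev (u i) (m j) = (i == j)%:R,
      forall P : V -> Prop, (forall z x y, P x -> P y -> P (z *: x + y)) -> P 0 ->
        (forall v, v \in s -> P v) -> forall i, P (u i) &
      forall v, v \in s -> v = \sum_i ev v (m i) *: u i].
Proof.
have [k0|noK] := pselect (inhabited K); last first.
  have V0 (x : V) : x = 0 by apply: ev_inj => k; case: noK.
  exists 0%N, (fun=> 0), (fun i : 'I_0 => match i with Ordinal _ h => False_rect K (Bool.diff_false_true h) end).
  by split=> [[]|P _ P0 _ []|v _] //; rewrite [v]V0 big_ord0.
case: k0 => k0.
elim: s => [|e s [r [u [m [bi Pu su]]]]].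
  by exists 0%N, (fun=> 0), (fun=> k0); split=> [[]|P _ P0 _ []|v].
(* The remainder of [e] modulo the previous family vanishes at the old pivots. If it is nonzero at
   some k, it is normalised there to [w'], and the old vectors are cleared at k to [u']. *)
pose w := e - \sum_i ev e (m i) *: u i.
have evw k : ev w k = ev e k - \sum_i ev e (m i) * ev (u i) k.
  rewrite /w -scaleN1r addrC evP ev_sum mulN1r addrC; congr (_ - _).
  by apply: eq_bigr => i _; rewrite evZ.
have Pw (P : V -> Prop) : (forall z x y, P x -> P y -> P (z *: x + y)) -> P 0 ->
    (forall v, v \in e :: s -> P v) -> P w.
  move=> PL P0 Ps; rewrite /w -scaleN1r addrC; apply: (PL).
    apply: (big_ind P) => // [x y Px Py|i _]; first by rewrite -[x]scale1r; exact: PL.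
    rewrite -[_ *: _]addr0; apply: (PL) => //; apply: (Pu P) => // v vs.
    by apply: Ps; rewrite inE vs orbT.
  by apply: Ps; rewrite inE eqxx.
have [w0|wn0] := eqVneq w 0.
  exists r, u, m; split=> // [P PL P0 Ps i|v].
    by apply: Pu => // v vs; apply: Ps; rewrite inE vs orbT.
  by rewrite inE => /predU1P[->|/su//]; apply/eqP; rewrite -subr_eq0 -/w w0.
have [k wk] : exists k, ev w k != 0.
  apply: contrapT => /forallNP h; case/eqP: wn0; apply: ev_inj => k.
  by apply/eqP/negPn/negP; exact: h.
have wm j : ev w (m j) = 0.
  rewrite evw (bigD1 j)//= bi eqxx mulr1 big1 ?addr0 ?subrr// => i ij.
  by rewrite bi (negbTE ij) mulr0.
pose w' := (ev w k)^-1 *: w.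
have w'k : ev w' k = 1 by rewrite evZ mulVf.
have w'm j : ev w' (m j) = 0 by rewrite evZ wm mulr0.
pose u' i := u i - ev (u i) k *: w'.
have evu' i l : ev (u' i) l = ev (u i) l - ev (u i) k * ev w' l.
  by rewrite /u' -scaleN1r addrC evP evZ mulN1r addrC.
have expand v : v = \sum_i ev v (m i) *: u i + (ev v k - \sum_i ev v (m i) * ev (u i) k) *: w' ->
    v = ev v k *: w' + \sum_i ev v (m i) *: u' i.
  move=> {1}->; rewrite scalerBl scaler_suml /u'.
  under [in RHS]eq_bigr do rewrite scalerBr scalerA.
  by rewrite sumrB addrCA.
exists r.+1, (fun i => if unlift ord0 i is Some j then u' j else w'),
  (fun i => if unlift ord0 i is Some j then m j else k); split.
- move=> i j; case: unliftP => [i' ->|->]; case: unliftP => [j' ->|->].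
  + by rewrite evu' w'm mulr0 subr0 bi (inj_eq (@lift_inj _ _)).
  + by rewrite evu' w'k mulr1 subrr.
  + by rewrite w'm.
  + by rewrite w'k eqxx.
- move=> P PL P0 Ps i; have Pw' : P w'.
    by rewrite /w' -[_ *: _]addr0; apply: (PL) => //; exact: Pw.
  case: unliftP => [j _|_] //; rewrite /u' addrC -scaleNr; apply: (PL) => //.
  by apply: Pu => // v vs; apply: Ps; rewrite inE vs orbT.
- move=> v vs; rewrite big_ord_recl unlift_none.
  under eq_bigr do rewrite liftK.
  apply: expand; move: vs; rewrite inE => /predU1P[->|/su vE].
    by rewrite -evw scalerA mulfV// scale1r /w subrKC.
  rewrite {1}vE; suff -> : ev v k = \sum_i ev v (m i) * ev (u i) k.
    by rewrite subrr scale0r addr0.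
  by rewrite {1}vE ev_sum; apply: eq_bigr => i _; rewrite evZ.
Qed.

End echelon.

Section finite_rank.
Context {R : realType} (p : exponent R) (K : choiceType).
Implicit Types (P Q S T F : bop (lp p K)).

(** A predicate on plain functions, so that [echelon] applies to functionals too, with vectors as
    evaluation points. *)
Definition bfunctional (f : lp p K -> R[i]) : Prop :=
  (forall z x y, f (z *: x + y) = z * f x + f y) /\
  exists2 M : R, 0 <= M & forall x : lp p K, normc (f x) <= M * lpnorm p x.

Lemma bfunctional0 : bfunctional (0 : lp p K -> R[i]^o).
Proof.
split=> [z x y|]; first by rewrite /= mulr0 addr0.
by exists 0 => // x; rewrite mul0r Normc.normc0.
Qed.

Lemma bfunctionalL (f g : lp p K -> R[i]^o) z :
  bfunctional f -> bfunctional g -> bfunctional (z *: f + g).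
Proof.
move=> [fL [M M0 fM]] [gL [N N0 gN]]; split=> [c x y|].
  by rewrite !fctE fL gL /GRing.scale/=; ring.
exists (normc z * M + N); first by rewrite addr_ge0 ?mulr_ge0 ?normc_ge0.
move=> x; rewrite mulrDl; apply: le_trans (normcD_le _ _) _.
by apply: lerD => //; rewrite Normc.normcM -mulrA ler_wpM2l ?normc_ge0.
Qed.

Lemma bfunctional_coord T k : bfunctional (fun x => T x k).
Proof.
split=> [z x y|]; first by rewrite bop_D bop_Z.
exists (opnorm T); first exact: opnorm_ge0.
by move=> x; apply: le_trans (le_lpnorm _ _) (le_opnorm_lp _ _).
Qed.

Lemma rank1_subproof (u : lp p K) f : bfunctional f ->
  (fun x => f x *: u) \in bounded_op (lp p K).
Proof.
move=> [fL [M M0 fM]]; apply/asboolP; split=> [z x y|].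
  by rewrite fL scalerDl scalerA.
exists (M * lpnorm p u) => x; rewrite !lp_normE lpnormZ -rmorphM/= lecR.
by rewrite mulrAC ler_wpM2r ?lpnorm_ge0.
Qed.

Definition rank1 (u : lp p K) f (bf : bfunctional f) : bop (lp p K) :=
  Bop (rank1_subproof u bf).

Lemma rank1E u f (bf : bfunctional f) x : rank1 u bf x = f x *: u.
Proof. by []. Qed.
Arguments rank1 : simpl never.

Definition fin_rank F : Prop :=
  exists s : seq (lp p K), range F `<=` lin_span [set` s].

Lemma bop_sumE (T : Type) (s : seq T) (f : T -> bop (lp p K)) x :
  (\sum_(t <- s) f t) x = \sum_(t <- s) f t x.
Proof. by elim/big_rec2: _ => // t y S _ <-. Qed.

(** Elimination on a spanning list turns the coordinates of [F x] into evaluations of [F x] at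
    finitely many points, so the coordinate functionals are automatically bounded. *)
Lemma fin_rank_coord F : fin_rank F ->
  exists r (u : 'I_r -> lp p K) (m : 'I_r -> K),
    forall x, F x = \sum_i F x (m i) *: u i.
Proof.
move=> [s hs]; have [|r [u [m [bi _ su]]]] :=
  @echelon _ _ K (fun x : lp p K => lp_fun x) (fun _ _ _ _ => erefl) _ s.
  by move=> x x0; exact: lp_eqP.
exists r, u, m => x; have [|n [c [a [sa ->]]]] := hs (F x); first by exists x.
under [RHS]eq_bigr do rewrite lp_sumE scaler_suml.
rewrite exchange_big/=; apply: eq_bigr => i _; rewrite {1}(su _ (sa i)) scaler_sumr.
by apply: eq_bigr => j _; rewrite scalerA.
Qed.

Lemma fin_rank_idem_range Q : Q * Q = Q -> fin_rank Q ->
  exists n (e : 'I_n -> lp p K), range Q = lin_span (range e).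
Proof.
move=> QQ /fin_rank_coord[r [u [m Qm]]]; exists r, (Q \o u).
apply/seteqP; split=> [_ [x _ <-]|_ [n [c [a [ha ->]]]]].
  exists r, (fun i => Q x (m i)), (Q \o u); split=> [i|]; first by exists i.
  rewrite -[in LHS]QQ bopM {1}(Qm x) bop_sum; apply: eq_bigr => i _.
  by rewrite bop_Z.
have /choice[b hb] : forall i, exists j, Q (u j) = a i.
  by move=> i; have [j _ <-] := ha i; exists j.
exists (\sum_i c i *: u (b i)) => //; rewrite bop_sum; apply: eq_bigr => i _.
by rewrite bop_Z hb.
Qed.

Lemma bfunctional_L f z x y : bfunctional f -> f (z *: x + y) = z * f x + f y.
Proof. by case=> fL _; exact: fL. Qed.

Lemma biorthogonal_proj r (u : 'I_r -> lp p K) (f : 'I_r -> lp p K -> R[i]) :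
  (forall i, bfunctional (f i)) -> (forall i j, f i (u j) = (i == j)%:R) ->
  exists Q : bop (lp p K), [/\ forall x, Q x = \sum_i f i x *: u i,
    forall i, Q (u i) = u i & forall x, Q (Q x) = Q x].
Proof.
move=> bf fu; pose Q : bop (lp p K) := \sum_i rank1 (u i) (bf i).
have QE x : Q x = \sum_i f i x *: u i.
  by rewrite bop_sumE; apply: eq_bigr => i _; rewrite rank1E.
have Qu j : Q (u j) = u j.
  rewrite QE (bigD1 j)//= fu eqxx scale1r big1 ?addr0// => i ij.
  by rewrite fu (negbTE ij) scale0r.
exists Q; split=> // x.
by rewrite {1}(QE x) bop_sum [RHS]QE; apply: eq_bigr => i _; rewrite bop_Z Qu.
Qed.

(** [Q1] projects onto the span of [s]. The functionals f - f o Q1 vanish on its range; a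
    biorthogonal system for them, corrected to lie in the kernel of [Q1], gives a second idempotent
    [Q2] with Q1 Q2 = Q2 Q1 = 0. The sum fixes [s] and preserves every functional of [g]. *)
Lemma idempotent_fixing (s : seq (lp p K)) (g : seq (lp p K -> R[i]^o)) :
  (forall f, f \in g -> bfunctional f) ->
  exists Q, [/\ Q * Q = Q, fin_rank Q, forall x, x \in s -> Q x = x &
    forall f, f \in g -> forall x, f (Q x) = f x].
Proof.
move=> bg.
have [|r1 [u [m [biu _ su]]]] :=
  @echelon _ _ K (fun x : lp p K => lp_fun x) (fun _ _ _ _ => erefl) _ s.
  by move=> x x0; exact: lp_eqP.
have [|Q1 [/= Q1E _ Q11]] :=
    @biorthogonal_proj _ u (fun i x => x (m i)) (fun i => bfunctional_coord 1 (m i)).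
  by move=> i j; rewrite biu eq_sym.
pose g' := [seq (fun x => f x - f (Q1 x)) : lp p K -> R[i]^o | f : lp p K -> R[i]^o <- g].
have [//||r2 [f [w [bif Pf sf]]]] :=
  @echelon _ (lp p K -> R[i]^o : lmodType R[i]) (lp p K) (fun f x => f x) _ _ g'.
  by move=> h h0; apply/funext.
have Pf' i : bfunctional (f i) /\ forall x, f i (Q1 x) = 0.
  apply: (Pf (fun h => bfunctional h /\ forall x, h (Q1 x) = 0)).
  - move=> z h1 h2 [b1 q1] [b2 q2]; split; first exact: bfunctionalL.
    by move=> x; rewrite !fctE q1 q2 scaler0 addr0.
  - by split=> //; exact: bfunctional0.
  - move=> _ /mapP[f0 /bg bf0 ->]; split; last by move=> x; rewrite Q11 subrr.
    have [fL [M M0 fM]] := bf0; split=> [z x y|].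
      by rewrite bop_D bop_Z !fL; ring.
    exists (M + M * opnorm Q1); first by rewrite addr_ge0// mulr_ge0// opnorm_ge0.
    move=> x; apply: le_trans (normcD_le _ _) _; rewrite normcN mulrDl.
    apply: lerD => //; apply: le_trans (fM _) _.
    by rewrite -mulrA ler_wpM2l// le_opnorm_lp.
(* Subtracting [Q1 (w j)] puts the vector in the kernel of [Q1] and keeps the duality, as the
   functionals [f i] vanish on the range of [Q1]. *)
pose w' j := w j - Q1 (w j).
have fw i j : f i (w' j) = (i == j)%:R.
  have [[fL _] fQ] := Pf' i; rewrite /w' -scaleN1r addrC fL fQ mulr0 add0r.
  exact: bif.
have Q1w j : Q1 (w' j) = 0 by rewrite bop_B Q11 subrr.
have [Q2 [Q2E Q2w Q22]] := biorthogonal_proj (fun i => (Pf' i).1) fw.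
have Q12 x : Q1 (Q2 x) = 0.
  by rewrite Q2E bop_sum big1// => i _; rewrite bop_Z Q1w scaler0.
have Q21 x : Q2 (Q1 x) = 0.
  by rewrite Q2E big1// => i _; rewrite (Pf' i).2 scale0r.
exists (Q1 + Q2); split.
- apply: bopP => x; rewrite bopM !bopDE [Q1 (_ + _)]bop_D [Q2 (_ + _)]bop_D.
  by rewrite Q11 Q12 Q21 Q22 addr0 add0r.
- exists (codom u ++ codom w') => _ [x _ <-]; rewrite bopDE Q1E Q2E.
  exists (r1 + r2)%N, (fun i : 'I_(r1 + r2) => match fintype.split i with inl a => x (m a) | inr b => (f b x : R[i]) end),
    (fun i : 'I_(r1 + r2) => match fintype.split i with inl a => u a | inr b => w' b end); split.
    by move=> i; rewrite /= mem_cat; case: (fintype.split i) => a; rewrite codom_f ?orbT.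
  rewrite big_split_ord/=; congr (_ + _); apply: eq_bigr => i _.
    by rewrite (unsplitK (inl i)).
  by rewrite (unsplitK (inr i)).
- move=> x /su xE; rewrite bopDE.
  have Q1x : Q1 x = x by rewrite Q1E -xE.
  by rewrite Q1x -{2}Q1x Q21 addr0.
- move=> h hg x; have bh := bg _ hg.
  have hE v : h v = h (Q1 v) + \sum_i (h (w i) - h (Q1 (w i))) * f i v.
    have := sf (fun x => h x - h (Q1 x)) (map_f _ hg).
    move=> /(congr1 (fun k : lp p K -> R[i]^o => k v)) /eqP.
    by rewrite subr_eq addrC fct_sumE => /eqP.
  rewrite bopDE hE bop_D Q11 Q12 addr0 [RHS]hE; congr (_ + _); apply: eq_bigr => i _.
  congr (_ * _); have [bfi fQ] := Pf' i.
  rewrite -[Q1 x]scale1r bfunctional_L// fQ mulr0 add0r Q2E.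
  transitivity (\sum_j f j x * f i (w' j)).
    elim/big_rec2: _ => [|j a b _ <-]; last by rewrite bfunctional_L.
    by have := bfunctional_L (-1) 0 0 bfi; rewrite scaler0 addr0 mulN1r addNr.
  rewrite (bigD1 i)//= fw eqxx mulr1 big1 ?addr0// => j ji.
  by rewrite fw eq_sym (negbTE ji) mulr0.
Qed.

(** Replaces the orthogonal projection onto a sum of corners. Q F = F asks Q to fix the vectors
    spanning the range of F, and F Q = F asks it to preserve the coordinate functionals of F. In the
    induction it suffices to absorb the new F and the previous [Q0], which absorbs all the
    others. *)
Lemma idempotent_absorbing (s : seq (bop (lp p K))) : (forall F, F \in s -> fin_rank F) ->
  exists Q, [/\ Q * Q = Q, fin_rank Q & forall F, F \in s -> Q * F = F /\ F * Q = F].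
Proof.
elim: s => [|F s IH] hs.
  exists 0; split=> //; first by rewrite mul0r.
  exists [::] => _ [x _ <-]; exists 0%N, (fun=> 0), (fun=> 0); split; first by case.
  by rewrite big_ord0.
have [|Q0 [_ rQ0 hQ0]] := IH; first by move=> G Gs; apply: hs; rewrite inE Gs orbT.
have rF : fin_rank F by apply: hs; rewrite inE eqxx.
have [r0 [u0 [m0 Q0E]]] := fin_rank_coord rQ0.
have [r1 [u1 [m1 FE]]] := fin_rank_coord rF.
have [|Q [QQ rQ Qs Qg]] := @idempotent_fixing (codom u0 ++ codom u1)
  ([seq (fun x => Q0 x (m0 i)) : lp p K -> R[i]^o | i <- enum 'I_r0] ++
   [seq (fun x => F x (m1 i)) : lp p K -> R[i]^o | i <- enum 'I_r1]).
  by move=> f; rewrite mem_cat => /orP[] /mapP[i _ ->]; exact: bfunctional_coord.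
have absorb r (u : 'I_r -> lp p K) m T : (forall x, T x = \sum_i T x (m i) *: u i) ->
    (forall i, Q (u i) = u i) -> (forall i x, T (Q x) (m i) = T x (m i)) ->
    Q * T = T /\ T * Q = T.
  move=> TE Qu Tm; split; apply: bopP => x; rewrite bopM.
    by rewrite TE bop_sum; apply: eq_bigr => i _; rewrite bop_Z Qu.
  by rewrite TE [RHS]TE; apply: eq_bigr => i _; rewrite Tm.
have [|i x|LQ0 RQ0] := absorb _ _ _ _ Q0E.
- by move=> i; rewrite Qs// mem_cat codom_f.
- apply: (Qg (fun x => Q0 x (m0 i))); rewrite mem_cat; apply/orP; left.
  by apply/mapP; exists i => //; rewrite mem_enum.
have [|i x|LF RF] := absorb _ _ _ _ FE.
- by move=> i; rewrite Qs// mem_cat codom_f orbT.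
- apply: (Qg (fun x => F x (m1 i))); rewrite mem_cat; apply/orP; right.
  by apply/mapP; exists i => //; rewrite mem_enum.
exists Q; split=> // G; rewrite inE => /predU1P[->//|/hQ0[h1 h2]].
by split; [rewrite -{1}h1 mulrA LQ0 h1 | rewrite -{1}h2 -mulrA RQ0 h2].
Qed.

Lemma idempotent_absorbing2 F T : fin_rank F -> fin_rank T ->
  exists Q, [/\ Q * Q = Q, fin_rank Q, Q * F = F /\ F * Q = F & Q * T = T /\ T * Q = T].
Proof.
move=> rF rT; have [|Q [QQ rQ hQ]] := @idempotent_absorbing [:: F; T].
  by move=> H; rewrite !inE => /orP[] /eqP ->.
by exists Q; split=> //; apply: hQ; rewrite !inE eqxx ?orbT.
Qed.

Lemma fin_rankM_l S F : fin_rank F -> fin_rank (S * F).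
Proof.
move=> [s hs]; exists (map S s) => _ [x _ <-].
have [|n [c [a [sa Fx]]]] := hs (F x); first by exists x.
exists n, c, (S \o a); split=> [i|]; first by rewrite /= map_f//; exact: sa.
by rewrite bopM Fx bop_sum; apply: eq_bigr => i _; rewrite bop_Z.
Qed.

Lemma fin_rankM_r S F : fin_rank F -> fin_rank (F * S).
Proof.
by move=> [s hs]; exists s => _ [x _ <-]; apply: hs; exists (S x).
Qed.

End finite_rank.

(** * Amplifications, transport of operator algebras and tensor products *)

Section amplification.
Context {R : realType} (p : exponent R).
Implicit Types (I J K : choiceType).

Lemma lpsum_slices I J (F : I * J -> R[i]) :
  lpsum p F = (\esum_(i in [set: I]) lpsum p (fun j : J => F (i, j)))%E.
Proof.
rewrite /lpsum (@esum_esum _ _ _ setT (fun=> setT)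
   (fun i j => (normc (F (i, j)) `^ p)%:E)); last first.
  by move=> i j _ _; rewrite lee_fin powR_ge0.
have -> : [set: I] `*`` (fun=> [set: J]) = [set: I * J] by apply/seteqP; split.
by apply: eq_esum => -[i j] _.
Qed.

Lemma lpsum_amp I J (S : bop (lp p J)) (F : lp p (I * J)%type) :
  (lpsum p (fun k : I * J => S (lpslice F k.1) k.2) <=
    (opnorm S `^ p)%:E * lpsum p F)%E.
Proof.
rewrite [leLHS]lpsum_slices [in leRHS]lpsum_slices.
have fin i : lpsum p (fun j : J => F (i, j)) = (lpnorm p (lpslice F i) `^ p)%:E.
  by rewrite -lpsumE.
under [X in (_ * X)%E]eq_esum do rewrite fin.
rewrite -esumZ ?powR_ge0//; last by move=> i; rewrite powR_ge0.
apply: le_esum.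
move=> i _ /=; rewrite -[lpsum _ _]/(lpsum p (S (lpslice F i))) lpsumE lee_fin.
rewrite -powRM ?opnorm_ge0 ?lpnorm_ge0// ge0_ler_powR ?nnegrE ?lpnorm_ge0//.
- exact: ltW (exponent_gt0 p).
- by rewrite mulr_ge0 ?opnorm_ge0 ?lpnorm_ge0.
- exact: le_opnorm_lp.
Qed.

Lemma amp_lp_subproof I J (S : bop (lp p J)) (F : lp p (I * J)%type) :
  (fun k : I * J => S (lpslice F k.1) k.2) \in @lp_finite R p (I * J)%type.
Proof.
apply/asboolP; apply: le_lt_trans (lpsum_amp _ _) _.
by rewrite lpsumE -EFinM ltry.
Qed.

Definition amp_fun I J (S : bop (lp p J)) (F : lp p (I * J)%type) : lp p (I * J)%type :=
  Lp (amp_lp_subproof S F).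

Lemma lpsliceE I J (F : lp p (I * J)%type) i j : lpslice F i j = F (i, j).
Proof. by []. Qed.

Lemma lpsliceL I J z (F G : lp p (I * J)%type) i :
  lpslice (z *: F + G) i = z *: lpslice F i + lpslice G i.
Proof. exact: lp_eqP. Qed.

Lemma amp_subproof I J (S : bop (lp p J)) : @amp_fun I J S \in bounded_op (lp p (I * J)%type).
Proof.
apply/asboolP; split.
  move=> z F G; apply: lp_eqP => k.
  by rewrite [LHS]/= lpsliceL bop_D bop_Z.
exists (opnorm S) => F; rewrite !lp_normE -rmorphM/= lecR; apply: lpnorm_le.
  by rewrite mulr_ge0 ?opnorm_ge0 ?lpnorm_ge0.
apply: le_trans (lpsum_amp _ _) _.
by rewrite lpsumE -EFinM powRM ?opnorm_ge0 ?lpnorm_ge0.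
Qed.

Definition amp I J (S : bop (lp p J)) : bop (lp p (I * J)%type) := Bop (amp_subproof I S).
Arguments amp : simpl never.

Lemma ampE I J (S : bop (lp p J)) F (k : I * J) : amp I S F k = S (lpslice F k.1) k.2.
Proof. by []. Qed.

Lemma lpslice_amp I J (S : bop (lp p J)) F (i : I) :
  lpslice (amp I S F) i = S (lpslice F i).
Proof. exact: lp_eqP. Qed.

Lemma lpslice_tensor I J (xi : lp p I) (eta : lp p J) i :
  lpslice (lptensor xi eta) i = xi i *: eta.
Proof. exact: lp_eqP. Qed.

Lemma amp_tensor I J (S : bop (lp p J)) (xi : lp p I) eta :
  amp I S (lptensor xi eta) = lptensor xi (S eta).
Proof. by apply: lp_eqP => k; rewrite ampE lpslice_tensor bop_Z. Qed.

Lemma lptensorLl I J z (xi xi' : lp p I) (eta : lp p J) :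
  lptensor (z *: xi + xi') eta = z *: lptensor xi eta + lptensor xi' eta.
Proof. by apply: lp_eqP => k; rewrite /= mulrDl; congr (_ + _); rewrite -[LHS]mulrA. Qed.

Lemma opnorm_amp_le I J (S : bop (lp p J)) : opnorm (amp I S) <= opnorm S.
Proof.
apply: opnorm_le_lp => [|F]; first exact: opnorm_ge0.
apply: lpnorm_le; first by rewrite mulr_ge0 ?opnorm_ge0 ?lpnorm_ge0.
apply: le_trans (lpsum_amp _ _) _.
by rewrite lpsumE -EFinM powRM ?opnorm_ge0 ?lpnorm_ge0.
Qed.

Lemma opnorm_entry_le I J (T : bop (lp p (I * J)%type)) x y :
  opnorm (entry T x y) <= opnorm T.
Proof.
apply: opnorm_le_lp => [|eta]; first exact: opnorm_ge0.
rewrite -lecR rmorphM /= -!lp_normE; apply: le_trans (lpnorm_slice _ _) _.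
apply: le_trans (le_opnorm _ _) _; rewrite ler_wpM2l ?ler0c ?opnorm_ge0//.
by apply: le_trans (lpnorm_tensor _ _) _; rewrite lp_normE lpnorm_delta mul1r.
Qed.

Lemma entryE I J (T : bop (lp p (I * J)%type)) x y eta :
  entry T x y eta = lpslice (T (lptensor (lpdelta p y) eta)) x.
Proof. by []. Qed.

Lemma entry_amp I J (S : bop (lp p J)) x y :
  entry (amp I S) x y = (x == y)%:R *: S.
Proof.
apply: bopP => eta; rewrite entryE amp_tensor lpslice_tensor.
by rewrite bopZE.
Qed.

Lemma entryL I J z (S T : bop (lp p (I * J)%type)) x y :
  entry (z *: S + T) x y = z *: entry S x y + entry T x y.
Proof.
by apply: bopP => eta; rewrite bopDE bopZE !entryE bopDE bopZE lpsliceL.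
Qed.

Lemma entry_ampM I J (S : bop (lp p J)) (T : bop (lp p (I * J)%type)) x y :
  entry (amp I S * T) x y = S * entry T x y.
Proof. by apply: bopP => eta; rewrite bopM !entryE bopM lpslice_amp. Qed.

Lemma entry_Mamp I J (S : bop (lp p J)) (T : bop (lp p (I * J)%type)) x y :
  entry (T * amp I S) x y = entry T x y * S.
Proof. by apply: bopP => eta; rewrite bopM !entryE bopM amp_tensor. Qed.

Lemma bop_eq_block I J (S T : bop (lp p (I * J)%type)) :
  (forall x y, entry S x y = entry T x y) -> S = T.
Proof.
move=> h; apply: bop_eq_entry => -[x i] [y j].
by rewrite -!scalar_entry_entry h.
Qed.

Lemma ampM I J (S T : bop (lp p J)) : amp I (S * T) = amp I S * amp I T.
Proof. by apply: bopP => F; apply: lp_eqP => k; rewrite bopM !ampE lpslice_amp. Qed.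

Lemma ampL I J z (S T : bop (lp p J)) : amp I (z *: S + T) = z *: amp I S + amp I T.
Proof.
apply: bopP => F; apply: lp_eqP => k.
by rewrite bopDE bopZE lpDE lpZE !ampE bopDE bopZE lpDE lpZE.
Qed.

End amplification.
Arguments amp {R p} I {J} S : simpl never.

Section transport.
Context {R : realType}.
Implicit Types (V W U : normedModType R[i]).

(** An isometric homomorphism with a contractive linear left inverse, which makes images of closed
    sets closed. Conjugation by a bijection and S |-> 1 (x) S are both of this kind; for the latter
    the left inverse takes a diagonal block and is not multiplicative on all operators. *)
Record retraction V W (phi : bop V -> bop W) (psi : bop W -> bop V) : Prop := Retraction {
  retr_lin : forall z S T, phi (z *: S + T) = z *: phi S + phi T ;
  retr_mul : forall S T, phi (S * T) = phi S * phi T ;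
  retr_norm : forall T, opnorm (phi T) <= opnorm T ;
  retr_linK : forall z S T, psi (z *: S + T) = z *: psi S + psi T ;
  retr_normK : forall T, opnorm (psi T) <= opnorm T ;
  retrK : forall T, psi (phi T) = T }.

Lemma retr_opnorm V W phi psi : @retraction V W phi psi ->
  forall T, opnorm (phi T) = opnorm T.
Proof.
move=> r T; apply/eqP; rewrite eq_le (retr_norm r)//=.
by rewrite -{1}(retrK r T) (retr_normK r).
Qed.

Lemma retrB V W phi psi : @retraction V W phi psi ->
  forall S T, phi (S - T) = phi S - phi T.
Proof. by move=> r S T; rewrite addrC -scaleN1r (retr_lin r) scaleN1r addrC. Qed.

Lemma retrBK V W phi psi : @retraction V W phi psi ->
  forall S T, psi (S - T) = psi S - psi T.
Proof. by move=> r S T; rewrite addrC -scaleN1r (retr_linK r) scaleN1r addrC. Qed.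

Lemma retraction_closure V W phi psi (A : set (bop V)) : @retraction V W phi psi ->
  phi @` closure A = closure (phi @` A).
Proof.
move=> r; apply/seteqP; split=> [_ [T /closure_bopP cT <-]|T cT].
  apply/closure_bopP => e /cT[S AS TS]; exists (phi S); first by exists S.
  by rewrite -(retrB r) (retr_opnorm r).
have /closure_bopP cT' := cT.
(* As phi psi fixes phi S, T - phi (psi T) is the same expression for T - phi S, whose norm is
   arbitrarily small. *)
have TE : T = phi (psi T).
  apply/eqP; rewrite -subr_eq0; apply/eqP/opnorm_eq0/eqP; rewrite eq_le opnorm_ge0 andbT.
  apply/ler_addgt0Pl => e e0; rewrite addr0.
  have [|_ [S AS <-] TS] := cT' (e / 2); first by rewrite divr_gt0.
  have -> : T - phi (psi T) = (T - phi S) - phi (psi (T - phi S)).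
    by rewrite (retrBK r) (retrB r) (retrK r) opprB addrA subrK.
  apply: le_trans (opnormD _ _) _; rewrite opnormN (retr_opnorm r).
  by have := retr_normK r (T - phi S); lra.
exists (psi T) => //; apply/closure_bopP => e /cT'[_ [S AS <-] TS]; exists S => //.
by rewrite -{1}(retrK r S) -(retrBK r); apply: le_lt_trans (retr_normK r _) TS.
Qed.

Lemma retraction_iso V W phi psi (A : set (bop V)) : @retraction V W phi psi ->
  isometric_iso A (phi @` A) phi.
Proof.
move=> r; split.
- split=> [T AT|S T _ _ ST|_ [T AT <-]]; [by exists T | | by exists T].
  by rewrite -(retrK r S) ST (retrK r).
- by move=> z S T _ _; rewrite (retr_lin r).
- by move=> S T _ _; rewrite (retr_mul r).
- by move=> T _; rewrite !bop_normE (retr_opnorm r).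
Qed.

Lemma retraction_iso_inv V W phi psi (A : set (bop V)) : @retraction V W phi psi ->
  isometric_iso (phi @` A) A psi.
Proof.
move=> r; split.
- split=> [_ [T AT <-]|_ _ /set_mem[S _ <-] /set_mem[T _ <-]|T AT].
  + by rewrite (retrK r).
  + by rewrite !(retrK r) => ->.
  + by exists (phi T); [exists T | rewrite (retrK r)].
- by move=> z S T _ _; rewrite (retr_linK r).
- by move=> _ _ [S _ <-] [T _ <-]; rewrite -(retr_mul r) !(retrK r).
- by move=> _ [T _ <-]; rewrite (retrK r) !bop_normE (retr_opnorm r).
Qed.

Lemma retraction_comp U V W phi1 psi1 phi2 psi2 :
  @retraction U V phi1 psi1 -> @retraction V W phi2 psi2 ->
  retraction (phi2 \o phi1) (psi1 \o psi2).
Proof.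
move=> r1 r2; split=> [z S T|S T|T|z S T|T|T] /=.
- by rewrite (retr_lin r1) (retr_lin r2).
- by rewrite (retr_mul r1) (retr_mul r2).
- exact: le_trans (retr_norm r2 _) (retr_norm r1 _).
- by rewrite (retr_linK r2) (retr_linK r1).
- exact: le_trans (retr_normK r1 _) (retr_normK r2 _).
- by rewrite (retrK r2) (retrK r1).
Qed.

Lemma retr_sum V W phi psi : @retraction V W phi psi ->
  forall (T : Type) (s : seq T) (c : T -> R[i]) (F : T -> bop V),
    phi (\sum_(t <- s) c t *: F t) = \sum_(t <- s) c t *: phi (F t).
Proof.
move=> r T s c F; elim/big_rec2: _ => [|t a b _ <-]; last by rewrite (retr_lin r).
by have := retrB r 0 0; rewrite !subrr.
Qed.

Lemma retr_span V W phi psi (A : set (bop V)) : @retraction V W phi psi ->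
  phi @` lin_span A = lin_span (phi @` A).
Proof.
move=> r; apply/seteqP; split=> [_ [_ [n [c [a [Aa ->]]]] <-]|_ [n [c [a [Aa ->]]]]].
  exists n, c, (phi \o a); split=> [i|]; first by exists (a i).
  exact: (retr_sum r).
have /choice[b hb] : forall i, exists T, A T /\ phi T = a i.
  by move=> i; have [T AT <-] := Aa i; exists T.
exists (\sum_i c i *: b i).
  by exists n, c, b; split=> // i; exact: (hb i).1.
by rewrite (retr_sum r); apply: eq_bigr => i _; rewrite (hb i).2.
Qed.

End transport.

Section reindexing.
Context {R : realType} (p : exponent R).
Implicit Types (I J K : choiceType).

Lemma reindex_bound I J (s : I -> J) : injective s ->
  wc_bound (fun=> 1 : R[i]) s 1 1.
Proof.
move=> sI; have := @inj_bound R I J predT s (fun i j _ _ => @sI i j).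
by rewrite /=.
Qed.

Definition lpreindex I J (s : I -> J) (sI : injective s) (xi : lp p J) : lp p I :=
  wcomp (reindex_bound sI) xi.

Lemma lpreindexE I J (s : I -> J) (sI : injective s) (xi : lp p J) i :
  lpreindex sI xi i = xi (s i).
Proof. exact: mul1r. Qed.

Lemma lpnorm_reindex_le I J (s : I -> J) (sI : injective s) (xi : lp p J) :
  lpnorm p (lpreindex sI xi) <= lpnorm p xi.
Proof. by apply: le_trans (lpnorm_wcomp _ _) _; rewrite mulr1 mul1r. Qed.

Lemma lpreindexL I J (s : I -> J) (sI : injective s) z (xi eta : lp p J) :
  lpreindex sI (z *: xi + eta) = z *: lpreindex sI xi + lpreindex sI eta.
Proof. exact: wcomp_linear. Qed.

Section conj.
Context I J (s : I -> J) (t : J -> I) (st : cancel s t) (ts : cancel t s).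

Let sI := can_inj st.
Let tI := can_inj ts.

Lemma conj_subproof (T : bop (lp p I)) :
  (fun xi => lpreindex tI (T (lpreindex sI xi))) \in bounded_op (lp p J).
Proof.
apply/asboolP; split=> [z x y|]; first by rewrite !(lpreindexL, bop_D, bop_Z).
exists (opnorm T) => x; rewrite !lp_normE -rmorphM/= lecR.
apply: le_trans (lpnorm_reindex_le tI _) _; apply: le_trans (le_opnorm_lp T _) _.
by rewrite ler_wpM2l ?opnorm_ge0// lpnorm_reindex_le.
Qed.

Definition conjop (T : bop (lp p I)) : bop (lp p J) := Bop (conj_subproof T).
Arguments conjop : simpl never.

Lemma conjopE T (xi : lp p J) j : conjop T xi j = T (lpreindex sI xi) (t j).
Proof. exact: lpreindexE. Qed.

Lemma opnorm_conjop_le T : opnorm (conjop T) <= opnorm T.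
Proof.
apply: opnorm_le_lp => [|x]; first exact: opnorm_ge0.
apply: le_trans (lpnorm_reindex_le tI _) _; apply: le_trans (le_opnorm_lp T _) _.
by rewrite ler_wpM2l ?opnorm_ge0// lpnorm_reindex_le.
Qed.

Lemma conjopL z S T : conjop (z *: S + T) = z *: conjop S + conjop T.
Proof.
apply: bopP => xi; apply: lp_eqP => j.
by rewrite bopDE bopZE lpDE lpZE !conjopE bopDE bopZE lpDE lpZE.
Qed.

Lemma conjopM S T : conjop (S * T) = conjop S * conjop T.
Proof.
apply: bopP => xi; apply: lp_eqP => j; rewrite bopM !conjopE bopM.
by congr (S _ _); apply: lp_eqP => i; rewrite lpreindexE conjopE st.
Qed.

Lemma lpreindex_delta i : lpreindex sI (lpdelta p (s i)) = lpdelta p i.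
Proof.
by apply: lp_eqP => k; rewrite lpreindexE /= (inj_eq sI).
Qed.

Lemma scalar_entry_conjop T k l :
  scalar_entry (conjop T) k l = scalar_entry T (t k) (t l).
Proof. by rewrite /scalar_entry conjopE -{1}(ts l) lpreindex_delta. Qed.

End conj.
Arguments conjop {I J s t} st ts T : simpl never.

Lemma conjop_retraction I J (s : I -> J) (t : J -> I) (st : cancel s t) (ts : cancel t s) :
  retraction (conjop st ts) (conjop ts st).
Proof.
split; [exact: conjopL | exact: conjopM | exact: opnorm_conjop_le | exact: conjopL |
  exact: opnorm_conjop_le |].
by move=> T; apply: bop_eq_entry => k l; rewrite !scalar_entry_conjop !st.
Qed.

Lemma amp_retraction I J (i : I) :
  retraction (@amp R p I J) (fun T : bop (lp p (I * J)%type) => entry T i i).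
Proof.
split=> [z S T|S T|T|z S T|T|T].
- exact: ampL.
- exact: ampM.
- exact: opnorm_amp_le.
- exact: entryL.
- exact: opnorm_entry_le.
- by rewrite entry_amp eqxx scale1r.
Qed.

End reindexing.
Arguments conjop {R p I J s t} st ts T : simpl never.

Section tensor_products.
Context {R : realType} (p : exponent R).
Implicit Types (I J K : choiceType).

Definition swap I J (k : I * J) : J * I := (k.2, k.1).

Lemma swapK I J : cancel (@swap I J) (@swap J I). Proof. by case. Qed.

(** Written as (a (x) 1)(1 (x) b), with a (x) 1 obtained from an amplification by exchanging the
    factors. This defines a bounded operator on the whole space at once. *)
Definition tens I J (a : bop (lp p I)) (b : bop (lp p J)) : bop (lp p (I * J)%type) :=
  conjop (@swapK J I) (@swapK I J) (amp J a) * amp I b.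

Lemma conj_swap_tensor I J (a : bop (lp p I)) (xi : lp p I) (eta : lp p J) :
  conjop (@swapK J I) (@swapK I J) (amp J a) (lptensor xi eta) = lptensor (a xi) eta.
Proof.
apply: lp_eqP => k; rewrite conjopE.
have -> : lpreindex (can_inj (@swapK J I)) (lptensor xi eta) = lptensor eta xi.
  by apply: lp_eqP => l; rewrite lpreindexE /= mulrC.
by rewrite amp_tensor /= mulrC.
Qed.

Lemma is_tensor_tens I J (a : bop (lp p I)) (b : bop (lp p J)) : is_tensor a b (tens a b).
Proof. by move=> xi eta; rewrite bopM amp_tensor conj_swap_tensor. Qed.

Lemma is_tensorE I J (a : bop (lp p I)) (b : bop (lp p J)) T :
  is_tensor a b T -> T = tens a b.
Proof.
move=> h; apply: bop_eq_delta => -[i j].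
by rewrite -lptensor_delta h is_tensor_tens.
Qed.

Lemma opnorm_tens_le I J (a : bop (lp p I)) (b : bop (lp p J)) :
  opnorm (tens a b) <= opnorm a * opnorm b.
Proof.
apply: le_trans (opnormM _ _) _; apply: ler_pM; rewrite ?opnorm_ge0//.
  by apply: le_trans (opnorm_conjop_le _ _ _) (opnorm_amp_le _ _).
exact: opnorm_amp_le.
Qed.

Lemma entry_tens I J (a : bop (lp p I)) (b : bop (lp p J)) x y :
  entry (tens a b) x y = scalar_entry a x y *: b.
Proof.
apply: bopP => eta; rewrite entryE is_tensor_tens lpslice_tensor bopZE.
by [].
Qed.

Lemma scalar_entry_tens I J (a : bop (lp p I)) (b : bop (lp p J)) k l :
  scalar_entry (tens a b) k l = scalar_entry a k.1 l.1 * scalar_entry b k.2 l.2.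
Proof.
by case: k l => [x i] [y j]; rewrite -scalar_entry_entry entry_tens scalar_entryZ.
Qed.

Lemma tensLl I J z (a a' : bop (lp p I)) (b : bop (lp p J)) :
  tens (z *: a + a') b = z *: tens a b + tens a' b.
Proof.
apply: bop_eq_entry => k l.
rewrite scalar_entryD scalar_entryZ !scalar_entry_tens scalar_entryD scalar_entryZ.
by rewrite mulrDl mulrA.
Qed.

Lemma tensLr I J z (a : bop (lp p I)) (b b' : bop (lp p J)) :
  tens a (z *: b + b') = z *: tens a b + tens a b'.
Proof.
apply: bop_eq_entry => k l.
rewrite scalar_entryD scalar_entryZ !scalar_entry_tens scalar_entryD scalar_entryZ.
by rewrite mulrDr mulrCA.
Qed.

Lemma tensor_algE I J (A : set (bop (lp p I))) (B : set (bop (lp p J))) :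
  tensor_alg A B = closure (lin_span [set tens ab.1 ab.2 | ab in A `*` B]).
Proof.
congr (closure (lin_span _)); apply/seteqP; split=> [T [a [b [Aa Bb]]]|_ [[a b] [/= Aa Bb] <-]].
  by move=> /is_tensorE ->; exists (a, b).
by exists a, b; split=> //; exact: is_tensor_tens.
Qed.

End tensor_products.

(** * Fixed finite corners *)

Section stabilised_uniform_roe.
Context {R : realType} (p : exponent R).
Implicit Types (X : metricType R) (I J K : choiceType).

Lemma lin_span0 (V : normedModType R[i]) (A : set V) : lin_span A 0.
Proof. by exists 0%N, (fun=> 0), (fun=> 0); split; [case | rewrite big_ord0]. Qed.

Lemma lin_spanD (V : normedModType R[i]) (A : set V) x y :
  lin_span A x -> lin_span A y -> lin_span A (x + y).
Proof.
move=> [n [c [a [Aa ->]]]] [m [d [b [Ab ->]]]].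
exists (n + m)%N, (fun i : 'I_(n + m) => match fintype.split i with inl j => c j | inr j => d j end),
  (fun i : 'I_(n + m) => match fintype.split i with inl j => a j | inr j => b j end); split.
  by move=> i; case: (fintype.split i).
rewrite big_split_ord/=; congr (_ + _); apply: eq_bigr => i _.
  by rewrite (unsplitK (inl i)).
by rewrite (unsplitK (inr i)).
Qed.

Lemma lin_spanZ (V : normedModType R[i]) (A : set V) z x :
  lin_span A x -> lin_span A (z *: x).
Proof.
move=> [n [c [a [Aa ->]]]]; exists n, (fun i => z * c i), a; split=> //.
by rewrite scaler_sumr; apply: eq_bigr => i _; rewrite scalerA.
Qed.

Lemma lin_span_sub (V : normedModType R[i]) (A : set V) x : A x -> lin_span A x.
Proof.
move=> Ax; exists 1%N, (fun=> 1), (fun=> x); split=> //.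
by rewrite big_ord1 scale1r.
Qed.

Lemma lin_spanS (V : normedModType R[i]) (A B : set V) :
  A `<=` lin_span B -> lin_span A `<=` lin_span B.
Proof.
move=> AB _ [n [c [a [Aa ->]]]].
apply: (big_ind (lin_span B)) => [||i _]; [exact: lin_span0 | exact: lin_spanD |].
by apply/lin_spanZ/AB.
Qed.

Lemma lin_span_sum (V : normedModType R[i]) (A : set V) (T : finType) (F : T -> V) :
  (forall t, lin_span A (F t)) -> lin_span A (\sum_t F t).
Proof.
move=> AF; apply: (big_ind (lin_span A)) => [||t _]; [exact: lin_span0 | exact: lin_spanD | exact: AF].
Qed.

Lemma restr_fin_rank (t : seq nat) : fin_rank (restr p (mem t)).
Proof.
have -> : restr p (mem t) = restr p (mem (undup t)).
  by apply: bopP => x; apply: lp_eqP => k; rewrite !restrE /= mem_undup.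
exists (map (@lpdelta R p nat) (undup t)) => _ [x _ <-]; rewrite lp_sum_delta ?undup_uniq//.
rewrite big_seq; apply: (big_ind (lin_span _)) => [||i it];
  [exact: lin_span0 | exact: lin_spanD |].
by apply/lin_spanZ/lin_span_sub; rewrite /= map_f.
Qed.

(** Uniformity of the idempotent in x and y means that 1 (x) Q acts as a two-sided unit on T, which
    turns corner conditions into algebra. *)
Lemma fixed_cornerP X (T : bop (lp p (X * nat)%type)) : in_fixed_corner T <->
  exists Q, [/\ Q * Q = Q, fin_rank Q, amp X Q * T = T & T * amp X Q = T].
Proof.
split=> [[n [e [P [PP rP TP]]]]|[Q [QQ rQ QT TQ]]].
  have PTP : T = amp X P * T * amp X P.
    by apply: bop_eq_block => x y; rewrite entry_Mamp entry_ampM.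
  exists P; split=> //.
  - exists (codom e); rewrite rP => _ [m [c [a [ea ->]]]]; exists m, c, a; split=> // i.
    by have [j _ <-] := ea i; rewrite /= codom_f.
  - by rewrite [in LHS]PTP !mulrA -ampM PP -PTP.
  - by rewrite [in LHS]PTP -!mulrA -ampM PP mulrA -PTP.
have [n [e he]] := fin_rank_idem_range QQ rQ.
exists n, e, Q; split=> // x y.
by rewrite -[in LHS]QT -[in LHS]TQ mulrA entry_Mamp entry_ampM.
Qed.

(** [F] and [G] may differ and need not be idempotent: one idempotent absorbing both serves as the
    corner. *)
Lemma absorbed_fixed_corner X (T : bop (lp p (X * nat)%type)) F G :
  fin_rank F -> fin_rank G -> amp X F * T = T -> T * amp X G = T -> in_fixed_corner T.
Proof.
move=> rF rG FT TG; have [Q [QQ rQ [QF _] [_ GQ]]] := idempotent_absorbing2 rF rG.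
apply/fixed_cornerP; exists Q; split=> //; first by rewrite -FT mulrA -ampM QF.
by rewrite -TG -mulrA -ampM GQ.
Qed.

Lemma Bs_dense_subalgebra X :
  subalgebra [set T : bop (lp p (X * nat)%type) | fin_prop T /\ in_fixed_corner T].
Proof.
split.
- split; first by apply/fin_propP; exists 0 => k l; rewrite /scalar_entry bop0E eqxx.
  have r0 : fin_rank (0 : bop (lp p nat)).
    by exists [::] => _ [x _ <-]; exact: lin_span0.
  by apply: (absorbed_fixed_corner r0 r0); rewrite ?mulr0 ?mul0r.
- move=> z S T [fS /fixed_cornerP[P [_ rP PS SP]]] [fT /fixed_cornerP[Q [_ rQ QT TQ]]].
  split; first by apply/fin_propP; apply: propagatesL; exact/fin_propP.
  have [E [EE rE [EP PE] [EQ QE]]] := idempotent_absorbing2 rP rQ.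
  have ES : amp X E * S = S by rewrite -PS mulrA -ampM EP.
  have SE : S * amp X E = S by rewrite -SP -mulrA -ampM PE.
  have ET : amp X E * T = T by rewrite -QT mulrA -ampM EQ.
  have TE : T * amp X E = T by rewrite -TQ -mulrA -ampM QE.
  apply: (absorbed_fixed_corner rE rE).
    by apply: bopP => x; rewrite bopM bopDE bopZE bop_D bop_Z -!bopM ES ET.
  by apply: bopP => x; rewrite bopM !bopDE !bopZE -!bopM SE TE.
- move=> S T [fS /fixed_cornerP[P [_ rP PS SP]]] [fT /fixed_cornerP[Q [_ rQ QT TQ]]].
  split; first by apply/fin_propP; apply: propagatesM; exact/fin_propP.
  by apply: (absorbed_fixed_corner rP rQ); rewrite ?mulrA ?PS// -mulrA TQ.
Qed.

Lemma matrix_fixed_corner X (T : bop (lp p (X * nat)%type)) (m : nat) :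
  (forall k l, scalar_entry T k l != 0 -> (k.2 < m)%N /\ (l.2 < m)%N) ->
  in_fixed_corner T.
Proof.
move=> hT; have rm := restr_fin_rank (iota 0 m).
have restr_entry i j : scalar_entry (restr p (mem (iota 0 m))) i j =
    ((i < m)%N && (i == j))%:R.
  by rewrite scalar_entry_wcop /= mem_iota add0n leq0n/= -natrM mulnb.
apply: (absorbed_fixed_corner rm rm); apply: bop_eq_entry => k l.
  have -> : scalar_entry (amp X (restr p (mem (iota 0 m))) * T) k l =
      ((k.2 < m)%N)%:R * scalar_entry T k l.
    by rewrite /scalar_entry bopM ampE restrE /= mem_iota add0n leq0n; case: k.
  have [->|/hT[-> _]] := eqVneq (scalar_entry T k l) 0; first by rewrite mulr0.
  by rewrite mul1r.
have -> : scalar_entry (T * amp X (restr p (mem (iota 0 m)))) k l =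
    ((l.2 < m)%N)%:R * scalar_entry T k l.
  case: l => y j; rewrite /scalar_entry bopM -lpZE -bop_Z; congr (T _ _).
  apply: lp_eqP => -[x i]; rewrite lpZE ampE restrE /= mem_iota add0n leq0n /=.
  by rewrite xpair_eqE; case: (i =P j) => [->//|_]; rewrite andbF !mulr0.
have [->|/hT[_ ->]] := eqVneq (scalar_entry T k l) 0; first by rewrite mulr0.
by rewrite mul1r.
Qed.

(** Vectors of the range are combinations of fixed vectors [u j] of l^p with bounded coefficients,
    and the coordinates of the [u j] are eventually small. For [Bs] this plays the part of local
    compactness, uniformly in the point of X. *)
Lemma fin_rank_coord_small (Q : bop (lp p nat)) (M e : R) : fin_rank Q -> 0 < e -> 0 <= M ->
  exists m, forall (v : lp p nat) i, lpnorm p v <= M -> (m <= i)%N -> normc (Q v i) < e.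
Proof.
move=> /fin_rank_coord[r [u [n QE]]] e0 M0.
(* Each of the r coefficients is at most [opnorm Q * M], so vectors [u j] with entries below e/L
   contribute less than e in total; the summand 1 keeps [L] positive. *)
pose L := opnorm Q * M * r%:R + 1.
have L0 : 0 < L by rewrite ltr_wpDl// !mulr_ge0 ?opnorm_ge0.
pose large := \bigcup_(j in [set: 'I_r]) [set i | e / L <= normc (u j i)].
have finS : finite_set large.
  by apply: bigcup_finite => // j _; apply: finite_large; rewrite divr_gt0.
have [m hm] : exists m, forall i, large i -> (i < m)%N.
  have /finite_seqP[s sE] := finS.
  exists (\max_(i <- s) i).+1 => i; rewrite sE /= => si.
  by rewrite ltnS; exact: leq_bigmax_seq.
exists m => v i vM mi.
have small j : normc (u j i) < e / L.
  rewrite ltNge; apply/negP => h; have : (i < m)%N by apply: hm; exists j.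
  by rewrite ltnNge mi.
rewrite QE lp_sumE.
apply: (@le_lt_trans _ _ (\sum_(j < r) opnorm Q * M * (e / L))).
  elim/big_ind2: _ => [|x1 x2 y1 y2 h1 h2|j _]; first by rewrite Normc.normc0.
    exact: le_trans (normcD_le _ _) (lerD h1 h2).
  rewrite lpZE Normc.normcM; apply: ler_pM; rewrite ?normc_ge0 ?(ltW (small j))//.
  apply: le_trans (le_lpnorm _ _) _; apply: le_trans (le_opnorm_lp _ _) _.
  by rewrite ler_wpM2l ?opnorm_ge0.
rewrite sumr_const card_ord -[_ *+ r]mulr_natr mulrAC.
apply: (@lt_le_trans _ _ (L * (e / L))); last by rewrite mulrC divfK// gt_eqF.
by rewrite ltr_pM2r ?divr_gt0// /L ltrDl.
Qed.

Lemma Bs_coarse_alg X : bounded_geometry X ->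
  [/\ coarse_alg fst (fun x : X => (x, 0%N)) (Bs p X), subalgebra (Bs p X) &
      has_munits (Bs p X)].
Proof.
move=> bX; have memB (T : bop (lp p (X * nat)%type)) m : fin_prop T ->
    (forall k l, scalar_entry T k l != 0 -> (k.2 < m)%N /\ (l.2 < m)%N) -> Bs p X T.
  by move=> fT hT; apply: subset_closure; split=> //; exact: matrix_fixed_corner hT.
split; last 2 first.
- exact/subalgebra_closure/Bs_dense_subalgebra.
- move=> k l; apply: (@memB _ (maxn k.2 l.2).+1); first exact: munit_fin_prop.
  move=> i j; rewrite scalar_entry_munit.
  case: (i =P k) => [->|_]; last by rewrite mul0r eqxx.
  case: (l =P j) => [->|_]; last by rewrite mulr0 eqxx.
  by rewrite !ltnS leq_maxl leq_maxr.
split.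
- by apply: closure_propagation => T [/fin_propP].
- move=> h r hr; have [U [U1 fU sU _]] := selector p (H := fun x => (h x, 0%N)) 0%N bX hr.
  by exists U => //; apply: (@memB _ 1%N) => // k l /sU[-> ->].
move=> T S /closure_bopP/(_ (1 / 2))[|T0 [_ /fixed_cornerP[Q [_ rQ QT _]]] TT0 ST].
  by rewrite divr_gt0.
have h2 : 0 < 1 / 2 :> R by rewrite divr_gt0.
have [m hm] := fin_rank_coord_small rQ h2 (opnorm_ge0 T0).
(* The approximant takes values in the range of 1 (x) Q, so its diagonal entries from height [m] on
   are below 1/2, too small to approximate an entry of modulus 1. *)
have Sm k : S k -> (k.2 < m)%N.
  move=> Sk; rewrite ltnNge; apply/negP => mk.
  have := scalar_entry_near k k TT0; rewrite (ST _ Sk) -QT /scalar_entry bopM ampE.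
  have : lpnorm p (lpslice (T0 (lpdelta p k)) k.1) <= opnorm T0.
    rewrite -lecR -lp_normE; apply: le_trans (lpnorm_slice _ _) _.
    rewrite lp_normE lecR; apply: le_trans (le_opnorm_lp _ _) _.
    by rewrite lpnorm_delta mulr1.
  by move=> /(hm _ k.2)/(_ mk); lra.
split=> [x|j jP].
  apply: (@sub_finite_set _ _ ((pair x) @` `I_m)).
    by move=> [y i] [/= /Sm /= im <-]; exists i.
  by apply: finite_image; exact: finite_II.
have [x|U [U1 fU sU _]] := @selector R p X nat j 0%N 0 bX.
  by rewrite (jP x).1 mdistxx.
(* The base points have height 0, and [m] may be 0; hence the corner of size [m.+1]. *)
exists U => //; apply: (@memB _ m.+1) => // k l /sU[-> ->]; split=> //.
by have [_ [/Sm/leqW|->]] := jP k.1.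
Qed.

End stabilised_uniform_roe.

Section compact_operators.
Context {R : realType} (p : exponent R) (K : choiceType).

Lemma opnorm_le_ball (T : bop (lp p K)) (M : R) :
  (forall x : lp p K, lpnorm p x <= 1 -> lpnorm p (T x) <= M) -> opnorm T <= M.
Proof.
move=> h; rewrite unlock; apply: ge_sup.
  by exists (complex.Re `|T 0|), 0 => //; rewrite /= normr0.
move=> _ [x xB <-]; have Tx : lpnorm p (T x) <= M; last exact: Tx.
by apply: h; rewrite -lecR -lp_normE.
Qed.

Lemma lpnorm_restr_le (D : pred K) (x : lp p K) : lpnorm p (restr p D x) <= lpnorm p x.
Proof. by apply: le_trans (lpnorm_wcomp _ _) _; rewrite mulr1 mul1r. Qed.

Lemma lpnorm_restr_mono (s t : seq K) (x : lp p K) : {subset s <= t} ->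
  lpnorm p (restr p (predC (mem t)) x) <= lpnorm p (restr p (predC (mem s)) x).
Proof.
move=> st; rewrite (_ : restr p (predC (mem t)) x =
  restr p (predC (mem t)) (restr p (predC (mem s)) x)); first exact: lpnorm_restr_le.
apply: lp_eqP => i; rewrite !restrE /= mulrA; congr (_ * _).
have [is_|] := boolP (i \in s); last by rewrite mulr1.
by rewrite (st _ is_) mul0r.
Qed.

(** Truncations converge to the identity pointwise and are contractive, hence converge uniformly on
    a precompact set: it suffices to treat a finite e/3-net. Compact operators thus become limits of
    finite-rank ones. *)
Lemma compact_truncation (T : bop (lp p K)) (e : R) : 0 < e -> compact_op T ->
  exists t : seq K, opnorm (T - restr p (mem t) * T : bop (lp p K)) < e.
Proof.
move=> e0 cT; have e3 : 0 < e / 3 by rewrite divr_gt0.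
have [s hs] := precompact_net e3 cT.
have [t ht] : exists t : seq K, forall w, w \in s ->
    lpnorm p (restr p (predC (mem t)) w) < e / 3.
  elim: {hs} s => [|w s [t ht]]; first by exists [::].
  have [t' _ ht'] := lp_tail w e3; exists (t' ++ t) => v.
  rewrite inE => /predU1P[->|/ht hv].
    by apply: le_lt_trans ht'; apply: lpnorm_restr_mono => i it; rewrite mem_cat it.
  apply: le_lt_trans hv; apply: lpnorm_restr_mono => i it.
  by rewrite mem_cat it orbT.
exists t; apply: (@le_lt_trans _ _ (e / 3 + e / 3)); last by lra.
apply: opnorm_le_ball => x x1.
have [|w ws hw] := hs (T x); first by exists x => //=; rewrite lp_normE (lecR _ 1).
rewrite bopDE bopNE bopM restrC_sub -[X in restr _ _ X](subrK w) bop_D.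
apply: le_trans (lpnormD _ _) _; apply: lerD; last exact: ltW (ht _ ws).
by apply: le_trans (lpnorm_restr_le _ _) (ltW hw).
Qed.

(** The image of the unit ball lies in the continuous image of the square of possible real and
    imaginary parts of [f x], which reduces compactness to that of real intervals. *)
Lemma rank1_compact (u : lp p K) f (bf : bfunctional f) : compact_op (rank1 u bf).
Proof.
have [_ [M M0 fM]] := bf.
pose g (z : R * R) : lp p K := (z.1 +i* z.2) *: u.
have gB a b : lpnorm p (g a - g b) <= (`|a.1 - b.1| + `|a.2 - b.2|) * lpnorm p u.
  rewrite /g -scalerBl lpnormZ ler_wpM2r ?lpnorm_ge0//.
  have -> : a.1 +i* a.2 - b.1 +i* b.2 = (a.1 - b.1)%:C + (0 +i* (a.2 - b.2)).
    by apply/eqP; rewrite eq_complex /= addr0 add0r !eqxx.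
  apply: le_trans (normcD_le _ _) _; rewrite /Normc.normc /=.
  by rewrite expr0n addr0 add0r !sqrtr_sqr.
have cg : continuous g.
  move=> a B /nbhs_ballP[d /= d0 dB].
  have dR : d = (complex.Re d)%:C by rewrite RRe_real// gtr0_real.
  have d0' : 0 < complex.Re d by rewrite -(ltcR 0) -dR.
  have u1 : 0 < lpnorm p u + 1 by rewrite ltr_wpDl ?lpnorm_ge0.
  have e0 : 0 < complex.Re d / 2 / (lpnorm p u + 1) by rewrite !divr_gt0.
  apply/nbhs_ballP; exists (complex.Re d / 2 / (lpnorm p u + 1)) => //= b [/= b1 b2].
  apply: dB; rewrite -ball_normE /= lp_normE dR ltcR.
  move: b1 b2; rewrite -!ball_normE /= => b1 b2.
  apply: le_lt_trans (gB _ _) _.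
  apply: (@le_lt_trans _ _ ((`|a.1 - b.1| + `|a.2 - b.2|) * (lpnorm p u + 1))).
    by rewrite ler_wpM2l ?addr_ge0// lerDl.
  by rewrite -ltr_pdivlMr// [complex.Re d]splitr mulrDl; exact: ltrD.
exists (g @` (`[- M, M] `*` `[- M, M])).
  move=> _ [x /= x1 <-]; exists (complex.Re (f x), complex.Im (f x)) => /=; last first.
    by rewrite /g /=; case: (f x).
  have fx : normc (f x) <= M.
    apply: le_trans (fM x) _; rewrite -[leRHS]mulr1 ler_wpM2l//.
    by rewrite -lecR -lp_normE.
  have : forall a b : R, normc (a +i* b) <= M -> `|a| <= M /\ `|b| <= M.
    move=> a b; rewrite /Normc.normc => h; split; apply: le_trans h;
      by rewrite -sqrtr_sqr ler_wsqrtr// ?lerDl ?lerDr sqr_ge0.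
  case: (f x) fx => a b /= /[swap] /[apply] -[].
  by rewrite !ler_norml !in_itv /= => -> ->.
have cC : compact (g @` (`[- M, M] `*` `[- M, M])).
  apply: continuous_compact; first exact: continuous_subspaceT.
  by apply: compact_setX; exact: segment_compact.
split=> //; exact: compact_closed.
Qed.

End compact_operators.

Section stabilisation.
Context {R : realType} (p : exponent R) (X : metricType R).

Lemma pairl_inj (m : nat) : injective (fun x : X => (x, m)).
Proof. by move=> x y []. Qed.

Lemma coord_subproof (T : bop (lp p (X * nat)%type)) (u : lp p nat) (m : nat) :
  (fun xi => lpreindex (@pairl_inj m) (T (lptensor xi u))) \in bounded_op (lp p X).
Proof.
apply/asboolP; split=> [z x y|]; first by rewrite lptensorLl bop_D bop_Z lpreindexL.
exists (opnorm T * lpnorm p u) => x; rewrite !lp_normE -rmorphM/= lecR.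
apply: le_trans (lpnorm_reindex_le (@pairl_inj m) _) _; apply: le_trans (le_opnorm_lp _ _) _.
rewrite -mulrA ler_wpM2l ?opnorm_ge0// mulrC -lecR rmorphM /= -!lp_normE.
exact: lpnorm_tensor.
Qed.

Definition coord_op (T : bop (lp p (X * nat)%type)) u m : bop (lp p X) :=
  Bop (coord_subproof T u m).

Lemma scalar_entry_coord T u m x y :
  scalar_entry (coord_op T u m) x y = entry T x y u m.
Proof. exact: lpreindexE. Qed.

Lemma coord_fin_prop T u m : fin_prop T -> fin_prop_u (coord_op T u m).
Proof.
move=> /propagationP[r hr]; apply/fin_prop_uP; exists r => x y.
rewrite scalar_entry_coord => h; apply: hr; apply/eqP => T0; move: h.
by rewrite T0 bop0E eqxx.
Qed.

Lemma closure_closureS (T : topologicalType) (A B : set T) :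
  A `<=` closure B -> closure A `<=` closure B.
Proof.
move=> /closureS AB; rewrite [in X in _ `<=` X](_ : closure B = closure (closure B))//.
by rewrite -(closure_id (closure B)).1//; exact: closed_closure.
Qed.

Lemma Bs_tensor : Bs p X = tensor_alg (Bu p X) (compact_ops p).
Proof.
have sB : subalgebra (Bs p X).
  exact/subalgebra_closure/Bs_dense_subalgebra.
apply/seteqP; split; rewrite tensor_algE.
  apply: closureS => T [fT /fixed_cornerP[P [PP rP PT TP]]].
  have [r [u [m hP]]] := fin_rank_coord rP.
  (* Expanding T = (1 (x) P) T (1 (x) P) in the coordinates of P on both sides leaves r^2 terms: the
     scalar matrix of coefficients of T from [u j] to position [m i], tensored with the rank one
     operator eta |-> (P eta)(m j) u_i. *)
  pose F (ij : 'I_r * 'I_r) :=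
    tens (coord_op T (u ij.2) (m ij.1)) (rank1 (u ij.1) (bfunctional_coord P (m ij.2))).
  have -> : T = \sum_ij F ij.
    apply: bop_eq_block => x y; apply: bopP => eta.
    have -> : entry (\sum_ij F ij) x y = \sum_ij entry (F ij) x y.
      elim/big_rec2: _ => [|ij S S' _ <-]; last by rewrite -[F ij]scale1r entryL !scale1r.
      by apply: bop_eq_entry => i j; rewrite scalar_entry_entry /scalar_entry bop0E.
    rewrite bop_sumE -(pair_bigA _ (fun i j => entry (F (i, j)) x y eta)).
    have PE v : P (entry T x y v) = entry T x y v.
      by rewrite -bopM -entry_ampM PT.
    have EP v : entry T x y (P v) = entry T x y v.
      by rewrite -bopM -entry_Mamp TP.
    rewrite -[LHS]PE hP; apply: eq_bigr => i _.
    rewrite PE -EP hP bop_sum lp_sumE scaler_suml; apply: eq_bigr => j _.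
    by rewrite entry_tens bopZE rank1E scalar_entry_coord bop_Z lpZE scalerA mulrC.
  apply: lin_span_sum => -[i j]; apply: lin_span_sub.
  exists (coord_op T (u j) (m i), rank1 (u i) (bfunctional_coord P (m j))) => //=.
  split=> /=; first by apply: subset_closure; exact: coord_fin_prop.
  exact: rank1_compact.
apply: closure_closureS => _ [n [c [T [hT ->]]]].
rewrite -/(Bs p X); apply: (big_ind (Bs p X)).
- by case: sB.
- by move=> S T'; exact: subalgebraD.
move=> i _; apply: (subalgebraZ (c i) sB).
have [[a b] /= [ca cb] <-] := hT i.
apply: (closure_bop_le (C := opnorm b + (opnorm a + 1))) => e /andP[e0 e1].
have [a0 fa0 aa0] := (closure_bopP _ _).1 ca _ e0.
have a0le : opnorm a0 <= opnorm a + 1.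
  rewrite -[a0](subKr a); apply: le_trans (opnormD _ _) _; rewrite opnormN.
  by rewrite lerD2l; apply: le_trans (ltW aa0) e1.
(* Conversely, a (x) b is approximated by [a0] of finite propagation tensored with the truncation of
   b to finitely many rows, whose finite rank yields the fixed corner. *)
have [t ht] := compact_truncation e0 cb.
set F := restr p (mem t) in ht; have rF : fin_rank F by exact: restr_fin_rank.
have FF : F * F = F.
  apply: bopP => x; apply: lp_eqP => k; rewrite bopM !restrE mulrA.
  by case: (mem t k); rewrite ?mul1r ?mul0r.
have rFb : fin_rank (F * b) by exact: fin_rankM_r.
exists (tens a0 (F * b)); first split.
- have [r hr] := (fin_prop_uP _).1 fa0; apply/fin_propP; exists r => k l.
  rewrite scalar_entry_tens => h; apply: hr; apply: contra h => /eqP ->.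
  by rewrite mul0r.
- have [Q [QQ rQ [h1 h2] _]] := idempotent_absorbing2 rFb rFb.
  apply: (absorbed_fixed_corner rQ rQ); apply: bop_eq_block => x y.
    by rewrite entry_ampM !entry_tens -{2}h1; apply: bopP => z; rewrite bopM !bopZE bop_Z.
  by rewrite entry_Mamp !entry_tens -{2}h2; apply: bopP => z; rewrite bopM !bopZE.
have -> : tens a b - tens a0 (F * b) = tens (a - a0) b + tens a0 (b - F * b).
  rewrite -[- (F * b)]scaleN1r [b + _]addrC tensLr -[- a0]scaleN1r [a + _]addrC tensLl.
  by rewrite !scaleN1r [RHS]addrC addrA addrK addrC.
rewrite mulrDl; apply: le_trans (opnormD _ _) _; apply: lerD.
  apply: le_trans (opnorm_tens_le _ _) _.
  by rewrite mulrC ler_wpM2l ?opnorm_ge0// ltW.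
apply: le_trans (opnorm_tens_le _ _) _.
by rewrite ler_pM ?opnorm_ge0// ltW.
Qed.

End stabilisation.

(** * Coarse equivalences as permutations of X x nat *)

Section fibre_enumeration.
Context (X Z : eqType).

Definition enumerates (u : X -> Z) (sX : Z -> seq X) : Prop :=
  forall z, uniq (sX z) /\ forall x, (x \in sX z) = (u x == z).

(* Numbers the points of (fibre of u over z) x nat by nat, for each z. *)
Definition fcode (u : X -> Z) (sX : Z -> seq X) (k : X * nat) : nat :=
  (size (sX (u k.1)) * k.2 + index k.1 (sX (u k.1)))%N.

Definition fdecode (sX : Z -> seq X) (d : X) (z : Z) (q : nat) : X * nat :=
  (nth d (sX z) (q %% size (sX z)), q %/ size (sX z))%N.

Context (u : X -> Z) (sX : Z -> seq X) (eX : enumerates u sX).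

Lemma index_fibre x : (index x (sX (u x)) < size (sX (u x)))%N.
Proof. by rewrite index_mem (eX _).2. Qed.

Lemma fcodeK d k : fdecode sX d (u k.1) (fcode u sX k) = k.
Proof.
case: k => x n; rewrite /fdecode /fcode /=; have i_lt := index_fibre x.
have k0 : (0 < size (sX (u x)))%N by apply: leq_trans i_lt.
rewrite mulnC modnMDl modn_small// divnMDl// divn_small// addn0 nth_index//.
by rewrite (eX _).2.
Qed.

Lemma fdecodeP d z q : (0 < size (sX z))%N ->
  u (fdecode sX d z q).1 = z /\ fcode u sX (fdecode sX d z q) = q.
Proof.
move=> k0; have uz : u (fdecode sX d z q).1 = z.
  by apply/eqP; rewrite -(eX _).2 mem_nth// ltn_pmod.
split=> //; rewrite /fcode uz /fdecode /= index_uniq ?ltn_pmod ?(eX _).1//.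
by rewrite mulnC -divn_eq.
Qed.

End fibre_enumeration.

Section matching.
Context {R : realType}.
Implicit Types X Y : metricType R.

(* Two spaces mapped onto the same subset of Z with uniformly finite fibres, so
   that points with the same image correspond coarsely. *)
Record matching X Y := Matching {
  mZ : eqType ;
  mu : X -> mZ ; mv : Y -> mZ ;
  ms : mZ -> seq X ; mt : mZ -> seq Y ;
  md : X -> Y ; me : Y -> X ;
  mK : nat ;
  msP : enumerates mu ms ; mtP : enumerates mv mt ;
  ms_gt0 : forall y, (0 < size (ms (mv y)))%N ;
  mt_gt0 : forall x, (0 < size (mt (mu x)))%N ;
  ms_le : forall z, (size (ms z) <= mK)%N ;
  mt_le : forall z, (size (mt z) <= mK)%N ;
  m_exp : forall r : R, exists r' : R, forall x x' y y', mu x = mv y -> mu x' = mv y' ->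
    mdist x x' <= r -> mdist y y' <= r' ;
  m_expV : forall r : R, exists r' : R, forall x x' y y', mu x = mv y -> mu x' = mv y' ->
    mdist y y' <= r -> mdist x x' <= r' }.

Arguments ms {X Y} m _ : rename.
Arguments mt {X Y} m _ : rename.
Arguments msP {X Y} m : rename.
Arguments mtP {X Y} m : rename.
Arguments ms_gt0 {X Y} m : rename.
Arguments mt_gt0 {X Y} m : rename.
Arguments ms_le {X Y} m : rename.
Arguments mt_le {X Y} m : rename.
Arguments m_exp {X Y} m : rename.
Arguments m_expV {X Y} m : rename.
Arguments md {X Y} m : rename.
Arguments me {X Y} m : rename.

Program Definition matching_sym X Y (M : matching X Y) : matching Y X :=
  @Matching Y X (mZ M) (mv M) (mu M) (mt M) (ms M) (me M) (md M) (mK M)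
    (mtP M) (msP M) (mt_gt0 M) (ms_gt0 M) (mt_le M) (ms_le M) _ _.
Next Obligation.
move=> X Y M r; have [r' h] := m_expV M r; exists r' => y y' x x' /esym e /esym e'.
exact: h.
Qed.
Next Obligation.
move=> X Y M r; have [r' h] := m_exp M r; exists r' => y y' x x' /esym e /esym e'.
exact: h.
Qed.

(** The fibres over a common z may have different sizes, but both are finite and nonempty, so after
    multiplication by nat each is numbered by nat; equal numbers are matched. *)
Definition msigma X Y (M : matching X Y) (k : X * nat) : Y * nat :=
  fdecode (mt M) (md M k.1) (mu M k.1) (fcode (mu M) (ms M) k).

Lemma msigmaP X Y (M : matching X Y) k :
  mv M (msigma M k).1 = mu M k.1 /\
  fcode (mv M) (mt M) (msigma M k) = fcode (mu M) (ms M) k.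
Proof. by apply: (fdecodeP (mtP M)); exact: mt_gt0. Qed.

Lemma msigmaK X Y (M : matching X Y) : cancel (msigma M) (msigma (matching_sym M)).
Proof.
move=> k; have [vu cc] := msigmaP M k.
by rewrite {1}/msigma /= cc vu (fcodeK (msP M)).
Qed.

Lemma msigmaKV X Y (M : matching X Y) : cancel (msigma (matching_sym M)) (msigma M).
Proof.
move=> k; have := msigmaP (matching_sym M) k.
set k' := msigma (matching_sym M) k => -[/= vu cc].
by rewrite /msigma cc vu (fcodeK (mtP M)).
Qed.

(** Fibres have between 1 and [mK M] points, so heights grow at most linearly. This keeps finite
    matrix corners and finitely many slices of nat finite under the permutation. *)
Lemma msigma_snd_le X Y (M : matching X Y) k : ((msigma M k).2 <= mK M * k.2.+1)%N.
Proof.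
have [vu cc] := msigmaP M k.
have k0 : (0 < size (mt M (mv M (msigma M k).1)))%N by rewrite vu mt_gt0.
apply: (@leq_trans (fcode (mv M) (mt M) (msigma M k))).
  by rewrite /fcode; apply: leq_trans (leq_addr _ _); rewrite leq_pmull.
rewrite cc /fcode mulnS addnC leq_add ?leq_mul ?ms_le//.
by apply: leq_trans (ltnW (index_fibre (msP M) _)) (ms_le _ _).
Qed.

Lemma finite_enum (T : choiceType) (A : set T) : finite_set A ->
  exists s : seq T, uniq s /\ forall x, (x \in s) = (x \in A).
Proof.
move=> finA; exists (finmap.enum_fset (fset_set A)); split; first exact: finmap.fset_uniq.
by move=> x; rewrite in_fset_set.
Qed.

Lemma ball_card X : bounded_geometry X -> forall r : R, exists N : nat,
  forall (s : seq X) x, uniq s -> (forall y, y \in s -> mdist x y <= r) -> (size s <= N)%N.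
Proof.
move=> bX r; have [N hN] := bX `|r| (normr_ge0 _); exists N => s x us hs.
apply: (card_le_size (hN x) us) => y ys; apply: le_trans (hs _ ys) (ler_norm _).
Qed.

Lemma enumerate_fibres X (Z : eqType) (f : X -> Z) (c : R) : bounded_geometry X ->
  (forall x x', f x = f x' -> mdist x x' <= c) ->
  exists (s : Z -> seq X) (K : nat), enumerates f s /\ forall z, (size (s z) <= K)%N.
Proof.
move=> bX fc; have [K hK] := ball_card bX c.
have /choice[s sP] : forall z, exists s : seq X, uniq s /\ forall x, (x \in s) = (f x == z).
  move=> z; have [|s [us hs]] := @finite_enum X [set x | f x = z].
    have [[x0 fx0]|no] := pselect (exists x0, f x0 = z).
      apply: (@sub_finite_set _ _ [set x | mdist x0 x <= c]); last exact: ball_finite.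
      by move=> x /= fx; apply: fc; rewrite fx0.
    by rewrite (_ : mkset _ = set0)//; apply/seteqP; split=> // x fx; case: no; exists x.
  by exists s; split=> // x; rewrite hs; apply/idP/eqP; rewrite inE.
exists s, K; split=> // z; case E : (s z) => [//|x0 s0]; rewrite -E.
apply: (hK _ x0 (sP z).1) => x; rewrite (sP z).2 => /eqP fx; apply: fc.
have x0s : x0 \in s z by rewrite E inE eqxx.
by move: x0s; rewrite (sP z).2 fx => /eqP ->.
Qed.

(** The common target is Y itself: X is mapped by f, and Y by the map v that is the identity on the
    range of f and f o g elsewhere. Both have range f(X), and v moves points by at most |C1|. *)
Lemma coarse_matching X Y : bounded_geometry X -> bounded_geometry Y ->
  coarsely_equivalent X Y -> inhabited (matching X Y).
Proof.
move=> bX bY [f [g [uf ug [C1 fg] [C2 gf]]]].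
have fg' y : mdist (f (g y)) y <= C1 by exact: fg.
have gf' x : mdist (g (f x)) x <= C2 by exact: gf.
pose v y := if pselect (range f y) then y else f (g y).
have v_im y : exists x, f x = v y.
  rewrite /v; case: pselect => /= [[x _ fx]|_]; first by exists x.
  by exists (g y).
have vf x : v (f x) = f x.
  by rewrite /v; case: pselect => //= nf; case: nf; exists x.
have vy y : mdist y (v y) <= `|C1|.
  rewrite /v; case: pselect => /= [_|_]; first by rewrite mdistxx.
  by rewrite metric_sym; apply: le_trans (fg' y) (ler_norm _).
have ball_of x x' : f x = f x' -> mdist x x' <= C2 + C2.
  move=> fx; apply: le_trans (metric_triangle _ (g (f x)) _) _; apply: lerD.
    by rewrite metric_sym.
  by rewrite fx.
have ball_v y y' : v y = v y' -> mdist y y' <= `|C1| + `|C1|.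
  move=> vyy; apply: le_trans (metric_triangle _ (v y) _) _; apply: lerD => //.
  by rewrite vyy metric_sym.
have [s [K1 [sP sK]]] := enumerate_fibres bX ball_of.
have [t [K2 [tP tK]]] := enumerate_fibres bY ball_v.
constructor.
apply: (@Matching X Y (Y : eqType) f v s t f g (maxn K1 K2) sP tP).
- move=> y; have [x fx] := v_im y; have : x \in s (v y) by rewrite (sP _).2 fx.
  by case: (s (v y)).
- move=> x; have : f x \in t (f x) by rewrite (tP _).2 vf.
  by case: (t (f x)).
- by move=> z; rewrite leq_max sK.
- by move=> z; rewrite leq_max tK orbT.
- move=> r; have r1 : 0 < Num.max r 1 by rewrite lt_max ltr01 orbT.
  have [S S0 hS] := uf _ r1; exists (`|C1| + (S + `|C1|)) => x x' y y' fx fx' xx'.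
  apply: le_trans (metric_triangle _ (v y) _) _; apply: lerD => //.
  apply: le_trans (metric_triangle _ (v y') _) _; apply: lerD; last by rewrite metric_sym.
  by rewrite -fx -fx'; apply: hS; rewrite le_max xx'.
- move=> r; have r1 : 0 < Num.max (`|C1| + (r + `|C1|)) 1 by rewrite lt_max ltr01 orbT.
  have [S S0 hS] := ug _ r1; exists (C2 + (S + C2)) => x x' y y' fx fx' yy'.
  apply: le_trans (metric_triangle _ (g (f x)) _) _; apply: lerD; first by rewrite metric_sym.
  apply: le_trans (metric_triangle _ (g (f x')) _) _; apply: lerD => //.
  apply: hS; rewrite le_max; apply/orP; left; rewrite fx fx'.
  apply: le_trans (metric_triangle _ y _) _; apply: lerD; first by rewrite metric_sym.
  by apply: le_trans (metric_triangle _ y' _) _; apply: lerD.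
Qed.

End matching.
Arguments ms {R X Y} m _ : rename.
Arguments mt {R X Y} m _ : rename.
Arguments msP {R X Y} m : rename.
Arguments mtP {R X Y} m : rename.
Arguments ms_gt0 {R X Y} m : rename.
Arguments mt_gt0 {R X Y} m : rename.
Arguments ms_le {R X Y} m : rename.
Arguments mt_le {R X Y} m : rename.
Arguments m_exp {R X Y} m : rename.
Arguments m_expV {R X Y} m : rename.
Arguments md {R X Y} m : rename.
Arguments me {R X Y} m : rename.

Section matched_blocks.
Context {R : realType} (p : exponent R).
Implicit Types X Y : metricType R.

Lemma msigma_eq X Y (M : matching X Y) x n y m :
  (msigma (matching_sym M) (y, m) == (x, n)) =
  (mu M x == mv M y) && (fcode (mu M) (ms M) (x, n) == fcode (mv M) (mt M) (y, m)).
Proof.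
apply/eqP/andP=> [h|[/eqP uv /eqP cc]].
  by have := msigmaP (matching_sym M) (y, m); rewrite h /= => -[-> ->].
by rewrite /msigma /= -uv -cc; exact: (fcodeK (msP M) _ (x, n)).
Qed.

Lemma mblock_bound X Y (M : matching X Y) (x : X) (y : Y) :
  wc_bound (fun m => ((msigma (matching_sym M) (y, m)).1 == x)%:R : R[i])
    (fun m => (msigma (matching_sym M) (y, m)).2) 1 1.
Proof.
apply: (@inj_bound R _ _ (fun m => (msigma (matching_sym M) (y, m)).1 == x)).
move=> m m' /eqP e /eqP e' e2.
have /(can_inj (msigmaKV M))[//] :
  msigma (matching_sym M) (y, m) = msigma (matching_sym M) (y, m').
by apply/eqP; rewrite [X in X == _]surjective_pairing [X in _ == X]surjective_pairing e e' e2.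
Qed.

(** The block at (y, x) of the permutation matrix of [msigma]: basis vector n goes to basis vector m
    when (x, n) is sent to (y, m), and to 0 when the image lies over another point. *)
Definition mblock X Y (M : matching X Y) x y : bop (lp p nat) :=
  wcop p (mblock_bound M x y).

Lemma scalar_entry_mblock X Y (M : matching X Y) x y m n :
  scalar_entry (mblock M x y) m n = (msigma (matching_sym M) (y, m) == (x, n))%:R.
Proof.
rewrite scalar_entry_wcop -natrM mulnb.
by case: (msigma (matching_sym M) (y, m)) => a b; rewrite xpair_eqE.
Qed.

Lemma scalar_entry_mblock_sym X Y (M : matching X Y) x y m n :
  scalar_entry (mblock (matching_sym M) y x) n m = scalar_entry (mblock M x y) m n.
Proof.
rewrite !scalar_entry_mblock; congr (_%:R); congr nat_of_bool.
by rewrite (can2_eq (msigmaK M) (msigmaKV M)) eq_sym.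
Qed.

Lemma mblock_delta X Y (M : matching X Y) x y n :
  mblock (matching_sym M) y x (lpdelta p n) =
    ((msigma (matching_sym M) (y, n)).1 == x)%:R *:
      lpdelta p (msigma (matching_sym M) (y, n)).2.
Proof.
apply: lp_eqP => m; rewrite -/(scalar_entry _ m n) scalar_entry_mblock_sym.
rewrite scalar_entry_mblock lpZE lpdeltaE -natrM mulnb.
by case: (msigma _ (y, n)) => a b; rewrite xpair_eqE [m == b]eq_sym.
Qed.

Definition mconj X Y (M : matching X Y) :
    bop (lp p (X * nat)%type) -> bop (lp p (Y * nat)%type) :=
  conjop (msigmaK M) (msigmaKV M).

(** Nonzero blocks of the permutation join points with the same image in [mZ], so each block of the
    conjugate is a sum over two finite fibres, of at most [mK M] squared terms. *)
Lemma entry_mconj X Y (M : matching X Y) T y y' :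
  entry (mconj M T) y y' = \sum_(x <- ms M (mv M y)) \sum_(x' <- ms M (mv M y'))
    mblock M x y * entry T x x' * mblock (matching_sym M) y' x'.
Proof.
have fib z m : (msigma (matching_sym M) (z, m)).1 \in ms M (mv M z).
  by rewrite (msP M _).2; have [/= -> _] := msigmaP (matching_sym M) (z, m).
apply: bop_eq_entry => m m'; rewrite scalar_entry_entry scalar_entry_conjop.
set k := msigma _ _; set l := msigma _ _.
rewrite [RHS]/scalar_entry bop_sumE lp_sumE.
transitivity (\sum_(x <- ms M (mv M y)) \sum_(x' <- ms M (mv M y'))
   (k.1 == x)%:R * ((l.1 == x')%:R * scalar_entry (entry T x x') k.2 l.2)).
  rewrite (bigD1_seq k.1) ?fib ?(msP M _).1//= [X in _ + X]big1 ?addr0; last first.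
    by move=> x /negbTE xk; rewrite big1// => x' _; rewrite eq_sym xk mul0r.
  rewrite (bigD1_seq l.1) ?fib ?(msP M _).1//= [X in _ + X]big1 ?addr0; last first.
    by move=> x' /negbTE xl; rewrite [l.1 == _]eq_sym xl mul0r mulr0.
  by rewrite !eqxx !mul1r scalar_entry_entry.
apply: eq_bigr => x _; rewrite bop_sumE lp_sumE; apply: eq_bigr => x' _.
by rewrite !bopM mblock_delta bop_Z bop_Z lpZE wcopE mulrCA.
Qed.

Lemma mconj_fin_prop X Y (M : matching X Y) T : fin_prop T -> fin_prop (mconj M T).
Proof.
move=> /fin_propP[r hr]; have [r' hr'] := m_exp M r; apply/fin_propP; exists r' => k l.
rewrite scalar_entry_conjop => /hr; apply: hr'.
  by have [/= -> _] := msigmaP (matching_sym M) k.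
by have [/= -> _] := msigmaP (matching_sym M) l.
Qed.

(** For matched points the block depends only on the sizes of the two fibres and the positions of
    the points in them, four numbers at most [mK M]. *)
Lemma mblock_finite X Y (M : matching X Y) : exists s : seq (bop (lp p nat)),
  forall x y, mu M x = mv M y -> mblock M x y \in s.
Proof.
pose K := mK M; pose T := ('I_K.+1 * 'I_K.+1 * 'I_K.+1 * 'I_K.+1)%type.
pose c (x : X) (y : Y) : T := (inord (size (ms M (mu M x))), inord (index x (ms M (mu M x))),
  inord (size (mt M (mv M y))), inord (index y (mt M (mv M y)))).
have /choice[F hF] : forall t : T, exists V, forall x y, mu M x = mv M y -> c x y = t ->
    mblock M x y = V.
  move=> t; have [[[x y] /= [uv cxy]]|no] :=
      pselect (exists xy : X * Y, mu M xy.1 = mv M xy.2 /\ c xy.1 xy.2 = t); last first.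
    by exists 0 => x y uv cxy; case: no; exists (x, y).
  exists (mblock M x y) => x' y' uv' cxy'; apply: bop_eq_entry => m n.
  rewrite !scalar_entry_mblock !msigma_eq uv uv' !eqxx /=.
  have inordK' a b : (a <= K)%N -> (b <= K)%N -> inord a = inord b :> 'I_K.+1 -> a = b.
    by move=> aK bK /(congr1 val); rewrite /= !inordK.
  have ixle z : (index z (ms M (mu M z)) <= K)%N.
    exact: leq_trans (ltnW (index_fibre (msP M) z)) (ms_le M _).
  have iyle z : (index z (mt M (mv M z)) <= K)%N.
    exact: leq_trans (ltnW (index_fibre (mtP M) z)) (mt_le M _).
  move: cxy'; rewrite -cxy /c => -[/inordK' e1 /inordK' e2 /inordK' e3 /inordK' e4].
  rewrite /fcode /= e1 ?ms_le// e2// e3 ?mt_le// e4//.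
exists (codom F) => x y uv; rewrite (hF (c x y) x y)//.
exact: codom_f.
Qed.

End matched_blocks.
Arguments mblock {R} p {X Y} M x y.
Arguments mconj {R} p {X Y} M T.

Section matched_algebras.
Context {R : realType} (p : exponent R).
Implicit Types X Y : metricType R.

Lemma rank_le_mono (V : normedModType R[i]) (T : bop V) (n m : nat) : (n <= m)%N ->
  rank_le T n -> rank_le T m.
Proof.
move=> nm [e he]; exists (fun i : 'I_m => if insub (val i) is Some j then e j else 0).
move=> x /he; apply: lin_spanS => _ [j _ <-]; apply: lin_span_sub.
by exists (widen_ord nm j); rewrite //= insubT// => jn; congr e; exact: val_inj.
Qed.

Lemma rank_leD (V : normedModType R[i]) (S T : bop V) n m :
  rank_le S n -> rank_le T m -> rank_le (S + T) (n + m).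
Proof.
move=> [e he] [f hf].
exists (fun i : 'I_(n + m) => match fintype.split i with inl j => e j | inr j => f j end).
move=> _ [x _ <-]; rewrite bopDE; apply: lin_spanD.
  have : lin_span (range e) (S x) by apply: he; exists x.
  apply: lin_spanS => _ [j _ <-]; apply: lin_span_sub.
  by exists (lshift m j) => //; rewrite (unsplitK (inl j)).
have : lin_span (range f) (T x) by apply: hf; exists x.
apply: lin_spanS => _ [j _ <-]; apply: lin_span_sub.
by exists (rshift n j) => //; rewrite (unsplitK (inr j)).
Qed.

Lemma rank_le_sum (V : normedModType R[i]) (T : Type) (s : seq T) (F : T -> bop V) N :
  (forall t, rank_le (F t) N) -> rank_le (\sum_(t <- s) F t) (size s * N).
Proof.
move=> hF; elim: s => [|t s IH]; last by rewrite big_cons mulSn; exact: rank_leD.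
rewrite big_nil; exists (fun=> 0) => _ [x _ <-]; exact: lin_span0.
Qed.

Lemma rank_le_sandwich (V : normedModType R[i]) (A T B : bop V) N :
  rank_le T N -> rank_le (A * T * B) N.
Proof.
move=> [e he]; exists (A \o e) => _ [x _ <-].
have [|k [c [a [ha Tx]]]] := he (T (B x)); first by exists (B x).
exists k, c, (A \o a); split.
  by move=> i; have [j _ je] := ha i; exists j => //=; rewrite je.
by rewrite !bopM Tx bop_sum; apply: eq_bigr => i _; rewrite bop_Z.
Qed.

Lemma mconj_bounded_rank X Y (M : matching X Y) T :
  bounded_rank T -> bounded_rank (mconj p M T).
Proof.
move=> [N hN]; exists (mK M * (mK M * N))%N => y y'; rewrite entry_mconj.
apply: (@rank_le_mono _ _ (size (ms M (mv M y)) * (size (ms M (mv M y')) * N))).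
  by rewrite !leq_mul ?ms_le.
by do 2?[apply: rank_le_sum => ?]; exact: rank_le_sandwich.
Qed.

Lemma Minf_dense_subalgebra : subalgebra (\bigcup_n @matrix_corner R p n).
Proof.
split.
- by exists 0%N => // i j _; rewrite /scalar_entry bop0E.
- move=> z S T [n _ hn] [m _ hm]; exists (maxn n m) => // i j; rewrite !leq_max => h.
  rewrite scalar_entryD scalar_entryZ hn ?hm ?mulr0 ?addr0//.
    by apply: contra h => /andP[-> ->]; rewrite !orbT.
  by apply: contra h => /andP[-> ->].
- move=> S T [n _ hn] [m _ hm]; exists (maxn n m) => // i j; rewrite !leq_max => h.
  apply/eqP; apply: contraNT h => /scalar_entryM_neq0[k [Sk Tk]].
  have /andP[-> _] : (i < n)%N && (k < n)%N.
    by apply: contraNT Sk => h; rewrite hn.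
  have /andP[_ ->] : (k < m)%N && (j < m)%N.
    by apply: contraNT Tk => h; rewrite hm.
  by rewrite orbT.
Qed.

(** The linear growth sends the corner of size n into that of size K n + 1: an index l < n reaches
    only indices up to K (l + 1) <= K n. *)
Lemma Minf_sandwich (A T B : bop (lp p nat)) (K : nat) :
  (forall m n, scalar_entry A m n != 0 -> (m <= K * n.+1)%N) ->
  (forall n m, scalar_entry B n m != 0 -> (m <= K * n.+1)%N) ->
  Minf p T -> Minf p (A * T * B).
Proof.
move=> hA hB /closure_bopP cT.
apply: (closure_bop_le (C := opnorm A * opnorm B)) => e /andP[e0 _].
have [S [n _ hS] TS] := cT e e0; exists (A * S * B).
  exists (K * n).+1 => // i j; apply: contraNeq => /scalar_entryM_neq0[k [+ Bk]].
  move=> /scalar_entryM_neq0[l [Al Sl]].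
  have /andP[ln kn] : (l < n)%N && (k < n)%N.
    by apply: contraNT Sl => h; rewrite hS.
  rewrite !ltnS (leq_trans (hA _ _ Al)) ?leq_mul//=.
  by rewrite (leq_trans (hB _ _ Bk)) ?leq_mul.
rewrite -mulrBl -mulrBr mulrAC; apply: le_trans (opnormM _ _) _.
rewrite ler_wpM2r ?opnorm_ge0//; apply: le_trans (opnormM _ _) _.
by rewrite ler_wpM2l ?opnorm_ge0// ltW.
Qed.

Lemma mblock_growth X Y (M : matching X Y) x y m n :
  scalar_entry (mblock p M x y) m n != 0 -> (m <= mK M * n.+1)%N.
Proof.
rewrite scalar_entry_mblock.
case: (msigma (matching_sym M) (y, m) =P (x, n)) => [h _|]; last by rewrite eqxx.
have E : msigma M (x, n) = (y, m) by rewrite -h msigmaKV.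
by have := msigma_snd_le M (x, n); rewrite E.
Qed.

Lemma mconj_Minf X Y (M : matching X Y) (T : bop (lp p (X * nat)%type)) :
  (forall x x', Minf p (entry T x x')) -> forall y y', Minf p (entry (mconj p M T) y y').
Proof.
move=> hT y y'; rewrite entry_mconj.
have sM : subalgebra (@Minf R p) by exact/subalgebra_closure/Minf_dense_subalgebra.
have MD S S' : Minf p S -> Minf p S' -> Minf p (S + S') by exact: subalgebraD.
have M0 : Minf p (0 : bop (lp p nat)) by case: sM.
apply: (big_ind (@Minf R p)) => // x _; apply: (big_ind (@Minf R p)) => // x' _.
apply: (@Minf_sandwich _ _ _ (mK M)) => // [m n|n m]; first exact: mblock_growth.
by rewrite scalar_entry_mblock_sym; exact: mblock_growth.
Qed.

(** Every term of a conjugate block has the form V P T_xx' P V' with finitely many V and V', so one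
    idempotent absorbing all V P and P V' is a corner for all blocks. *)
Lemma mconj_fixed_corner X Y (M : matching X Y) (T : bop (lp p (X * nat)%type)) :
  in_fixed_corner T -> in_fixed_corner (mconj p M T).
Proof.
move=> /fixed_cornerP[P [PP rP PT TP]].
have [s hs] := mblock_finite p M; have [s' hs'] := mblock_finite p (matching_sym M).
have [|Q [QQ rQ hQ]] := @idempotent_absorbing R p nat
    ([seq V * P | V <- s] ++ [seq P * V | V <- s']).
  move=> F; rewrite mem_cat => /orP[] /mapP[V _ ->]; first exact: fin_rankM_l.
  exact: fin_rankM_r.
have fib z x : x \in ms M (mv M z) -> mu M x = mv M z by rewrite (msP M _).2 => /eqP.
have PE x x' : entry T x x' = P * entry T x x' by rewrite -entry_ampM PT.
have EP x x' : entry T x x' = entry T x x' * P by rewrite -entry_Mamp TP.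
apply: (absorbed_fixed_corner rQ rQ); apply: bop_eq_block => y y'.
  rewrite entry_ampM entry_mconj mulr_sumr; apply: eq_big_seq => x /fib xy.
  rewrite mulr_sumr; apply: eq_big_seq => x' /fib xy'; rewrite PE !mulrA.
  have VPs : mblock p M x y * P \in [seq V * P | V <- s] ++ [seq P * V | V <- s'].
    by rewrite mem_cat; apply/orP; left; apply: map_f; exact: hs.
  by have [h _] := hQ _ VPs; rewrite mulrA in h; rewrite h.
rewrite entry_Mamp entry_mconj mulr_suml; apply: eq_big_seq => x /fib xy.
rewrite mulr_suml; apply: eq_big_seq => x' /fib xy'; rewrite EP -!mulrA.
have PVs : P * mblock p (matching_sym M) y' x' \in [seq V * P | V <- s] ++ [seq P * V | V <- s'].
  by rewrite mem_cat; apply/orP; right; apply: map_f; apply: hs'; rewrite /= xy'.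
by have [_ h] := hQ _ PVs; rewrite -mulrA in h; rewrite h.
Qed.

(** [P] is a property over all spaces, so one stability hypothesis applies to the matching and, for
    surjectivity, to its inverse. *)
Lemma mconj_image X Y (M : matching X Y)
    (P : forall Z : metricType R, set (bop (lp p (Z * nat)%type))) :
  (forall (Z W : metricType R) (N : matching Z W) T, P Z T -> P W (mconj p N T)) ->
  mconj p M @` closure (P X) = closure (P Y).
Proof.
move=> hP; rewrite (retraction_closure _ (conjop_retraction p (msigmaK M) (msigmaKV M))).
congr closure; apply/seteqP; split=> [_ [T PT <-]|T PT]; first exact: hP.
exists (mconj p (matching_sym M) T); first exact: hP.
apply: bop_eq_entry => k l; rewrite !scalar_entry_conjop.
by rewrite -![msigma (matching_sym (matching_sym M)) _]/(msigma M _) !msigmaKV.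
Qed.

Lemma mconj_iso X Y (M : matching X Y)
    (P : forall Z : metricType R, set (bop (lp p (Z * nat)%type))) :
  (forall (Z W : metricType R) (N : matching Z W) T, P Z T -> P W (mconj p N T)) ->
  isometric_iso (closure (P X)) (closure (P Y)) (mconj p M).
Proof.
move=> hP; rewrite -(mconj_image M hP).
exact: (retraction_iso _ (conjop_retraction p (msigmaK M) (msigmaKV M))).
Qed.

Lemma mconj_UB X Y (M : matching X Y) : isometric_iso (UB p X) (UB p Y) (mconj p M).
Proof.
apply: (@mconj_iso _ _ M (fun Z => [set T | fin_prop T /\ bounded_rank T])).
by move=> Z W N T [fT rT]; split; [exact: mconj_fin_prop | exact: mconj_bounded_rank].
Qed.

Lemma mconj_Broe X Y (M : matching X Y) : isometric_iso (Broe p X) (Broe p Y) (mconj p M).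
Proof.
apply: (@mconj_iso _ _ M
  (fun Z => [set T | fin_prop T /\ forall x y, @Minf R p (entry T x y)])).
by move=> Z W N T [fT mT]; split; [exact: mconj_fin_prop | exact: mconj_Minf].
Qed.

Lemma mconj_Bs X Y (M : matching X Y) : isometric_iso (Bs p X) (Bs p Y) (mconj p M).
Proof.
apply: (@mconj_iso _ _ M (fun Z => [set T | fin_prop T /\ in_fixed_corner T])).
by move=> Z W N T [fT cT]; split; [exact: mconj_fin_prop | exact: mconj_fixed_corner].
Qed.

End matched_algebras.

(** * The diagonal subalgebra *)

Section diagonal_subalgebra.
Context {R : realType} (p : exponent R).
Implicit Types (X Y : metricType R) (I : choiceType).

(** A dense part of the tensor product of the two diagonal algebras, described by matrix entries
    only, so that permutations act on it visibly. *)
Definition diag_corner I : set (bop (lp p (I * nat)%type)) :=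
  [set T | diagonal_op T /\ exists N, forall k, (N <= k.2)%N -> scalar_entry T k k = 0].

Lemma linf_opsP I (T : bop (lp p I)) : linf_ops p I T <-> diagonal_op T.
Proof.
split=> [[a _ ha] i j ij|dT].
  by rewrite /scalar_entry ha lpdeltaE (negbTE ij) mulr0.
exists (fun i => scalar_entry T i i).
  exists (opnorm T)%:C; split; first by rewrite ger0_real// ler0c opnorm_ge0.
  move=> M hM i _; apply: le_trans (ltW hM).
  by rewrite [X in X <= _]normc_norm lecR normc_scalar_entry_le.
move=> xi i; have aM k : normc (scalar_entry T k k) <= opnorm T.
  exact: normc_scalar_entry_le.
have -> : T = wcop p (diag_bound (opnorm_ge0 T) aM).
  apply: bop_eq_entry => k l; rewrite scalar_entry_wcop.
  by have [->|kl] := eqVneq k l; rewrite ?mulr1// mulr0; exact: dT.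
by rewrite !scalar_entry_wcop eqxx mulr1 wcopE.
Qed.

Lemma opnorm_diag_le I (T : bop (lp p I)) (b : I -> R[i]) (M : R) : 0 <= M ->
  (forall i, normc (b i) <= M) -> (forall (xi : lp p I) i, T xi i = b i * xi i) ->
  opnorm T <= M.
Proof.
move=> M0 bM hT; have -> : T = wcop p (diag_bound M0 bM).
  by apply: bopP => xi; apply: lp_eqP => i; rewrite hT wcopE.
by apply: le_trans (opnorm_wcop _ _) _; rewrite mulr1.
Qed.

Lemma diag_cornerL I z (S T : bop (lp p (I * nat)%type)) :
  diag_corner S -> diag_corner T -> diag_corner (z *: S + T).
Proof.
move=> [dS [N hS]] [dT [M hT]]; split.
  by move=> k l kl; rewrite scalar_entryD scalar_entryZ dS// dT// mulr0 addr0.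
exists (maxn N M) => k; rewrite geq_max => /andP[Nk Mk].
by rewrite scalar_entryD scalar_entryZ hS// hT// mulr0 addr0.
Qed.

Lemma closure_diagonal I (A : set (bop (lp p I))) : (forall T, A T -> diagonal_op T) ->
  forall T, closure A T -> diagonal_op T.
Proof.
move=> hA T /closure_bopP cT i j ij; apply: Normc.eq0_normc; apply/eqP.
rewrite eq_le normc_ge0 andbT; apply/ler_addgt0Pl => e e0; rewrite addr0.
have [S AS TS] := cT e e0.
by have := scalar_entry_near i j TS; rewrite (hA _ AS)// Normc.normc0 add0r => /ltW.
Qed.

(** A sequence tending to 0 is approximated by its truncation below N; conversely, a diagonal
    operator supported on heights below N is the finite sum of its slices a_n (x) e_nn. *)
Lemma tensor_diag I :
  tensor_alg (linf_ops p I) (C0_ops p) = closure (@diag_corner I).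
Proof.
rewrite tensor_algE; apply/seteqP; split.
  apply: closure_closureS => _ [n [c [T [hT ->]]]]; apply/closure_bopP.
  have sD : subalgebra (closure (@diag_corner I)).
    apply: subalgebra_closure; split.
    - by split=> [k l _|]; [|exists 0%N => k _]; rewrite /scalar_entry bop0E.
    - by move=> z S S'; exact: diag_cornerL.
    - move=> S S' [dS [N hS]] [dS' _].
      have SS' k l : scalar_entry (S * S') k l = scalar_entry S k l * scalar_entry S' l l.
        by rewrite [LHS]/scalar_entry bopM (diagonal_delta _ dS') bop_Z lpZE mulrC.
      split=> [k l kl|]; first by rewrite SS' dS// mul0r.
      by exists N => k Nk; rewrite SS' hS// mul0r.
  suff : closure (@diag_corner I) (\sum_i c i *: T i) by move/closure_bopP.
  apply: (big_ind (closure (@diag_corner I))).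
  - by case: sD.
  - by move=> S S'; exact: subalgebraD.
  move=> i _; apply: (subalgebraZ (c i) sD).
  have [[a b] /= [/linf_opsP da [cc cc0 hb]] <-] := hT i.
  apply: (closure_bop_le (C := opnorm a)) => d /andP[d0 _].
  have [N hN] : exists N, forall n, (N <= n)%N -> normc (cc n) <= d.
    have d0' : 0 < d%:C by rewrite (ltcR 0 d).
    have /cvgrPdist_le/(_ _ d0')[N _ hN] := cc0.
    exists N => m Nm; have := hN m Nm; rewrite /= sub0r normrN.
    by rewrite [X in X <= _]normc_norm lecR.
  exists (tens a (restr p (fun n => (n < N)%N) * b)).
    split=> [k l kl|].
      rewrite scalar_entry_tens /scalar_entry bopM restrE hb -/(scalar_entry a _ _) lpdeltaE.
      have [e1|n1] := eqVneq k.1 l.1; last by rewrite da// mul0r.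
      have [e2|n2] := eqVneq k.2 l.2; last by rewrite !mulr0.
      by case/eqP: kl; case: k l e1 e2 => [? ?] [? ?] /= -> ->.
    exists N => k; rewrite leqNgt => /negbTE Nk.
    by rewrite scalar_entry_tens {2}/scalar_entry bopM restrE Nk mul0r mulr0.
  have -> : tens a b - tens a (restr p (fun n => (n < N)%N) * b) =
      tens a (b - restr p (fun n => (n < N)%N) * b).
    by rewrite -[- (_ * b)]scaleN1r [b + _]addrC tensLr scaleN1r addrC.
  apply: le_trans (opnorm_tens_le _ _) _; rewrite ler_wpM2l ?opnorm_ge0//.
  apply: (@opnorm_diag_le nat _ (fun n => (~~ (n < N)%N)%:R * cc n)).
  - exact: ltW.
  - move=> m; have [mN|Nm] := ltnP m N; first by rewrite mul0r Normc.normc0 ltW.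
    by rewrite mul1r; exact: hN.
  - move=> xi m; rewrite bopDE bopNE bopM lpDE lpNE restrE hb.
    by case: (m < N)%N; rewrite /= ?mul1r ?mul0r ?subr0 ?subrr.
apply: closureS => T [dT [N hN]].
have aM n x : normc (scalar_entry T (x, n) (x, n)) <= opnorm T.
  exact: normc_scalar_entry_le.
pose a n : bop (lp p I) := wcop p (diag_bound (opnorm_ge0 T) (aM n)).
have -> : T = \sum_(n < N) tens (a n) (munit p (n : nat) (n : nat)).
  apply: bop_eq_entry => k l.
  rewrite [RHS]/scalar_entry bop_sumE lp_sumE.
  transitivity (\sum_(n < N) (k == l)%:R * ((k.2 == n)%:R * scalar_entry T k k)).
    have [<-|kl] := eqVneq k l; last first.
      by rewrite dT// big1// => n _; rewrite mul0r.
    have [kN|Nk] := ltnP k.2 N; last first.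
      by rewrite hN// big1// => n _; rewrite !mulr0.
    rewrite (bigD1 (Ordinal kN))//= eqxx !mul1r big1 ?addr0// => n nk.
    case: eqP => [kn|_]; last by rewrite mul0r mulr0.
    by case/eqP: nk; exact/val_inj.
  apply: eq_bigr => n _; rewrite -/(scalar_entry _ k l) scalar_entry_tens.
  rewrite scalar_entry_wcop scalar_entry_munit.
  case: k l => [x i] [y j] /=; rewrite xpair_eqE.
  have [->|xy] := eqVneq x y; last by rewrite !(mulr0, mul0r).
  have [->|ni] := eqVneq i n; last by rewrite !(mulr0, mul0r).
  by rewrite !mul1r mulr1 eq_sym mulrC.
apply: lin_span_sum => n; apply: lin_span_sub.
exists (a n, munit p (n : nat) (n : nat)) => //; split=> /=.
  apply/linf_opsP => i j ij.
  by rewrite scalar_entry_wcop /= (negbTE ij) mulr0.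
exists (fun m : nat => (m == n)%:R); last by move=> xi m; rewrite munitE lpZE lpdeltaE mulrC;
  case: eqP => [->|]; rewrite ?mul0r.
apply: cvg_near_cst; exists n.+1 => // m /= nm.
by rewrite gtn_eqF.
Qed.

Lemma diag_corner_munit I k : @diag_corner I (munit p k k).
Proof.
split=> [i j ij|].
  rewrite scalar_entry_munit; case: (i =P k) => [<-|_]; last by rewrite mul0r.
  by rewrite (negbTE ij) mulr0.
exists k.2.+1 => l; rewrite scalar_entry_munit; case: (l =P k) => [->|_].
  by rewrite ltnn.
by rewrite mul0r.
Qed.

Lemma tensor_diag_diagonal I (T : bop (lp p (I * nat)%type)) :
  tensor_alg (linf_ops p I) (C0_ops p) T -> diagonal_op T.
Proof. by rewrite tensor_diag; apply: closure_diagonal => S []. Qed.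

Lemma mconj_diag X Y (M : matching X Y) :
  mconj p M @` tensor_alg (linf_ops p X) (C0_ops p) = tensor_alg (linf_ops p Y) (C0_ops p).
Proof.
rewrite !tensor_diag; apply: (mconj_image M (P := fun Z => @diag_corner Z)).
move=> Z W N T [dT [n hn]]; split=> [k l kl|].
  rewrite scalar_entry_conjop; apply: dT.
  by rewrite (inj_eq (can_inj (msigmaKV N))).
(* By [msigma_snd_le], a point of height less than n is sent below this bound, so points above it
   come from heights at least n. *)
exists (mK N * n.+1).+1 => k nk; rewrite scalar_entry_conjop; apply: hn.
rewrite leqNgt; apply/negP => h; have := msigma_snd_le N (msigma (matching_sym N) k).
rewrite msigmaKV leqNgt => /negP; apply; apply: leq_trans nk.
by rewrite ltnS leq_mul// ltnW.
Qed.

End diagonal_subalgebra.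

Section metric_rigidity.
Context {R : realType}.
Implicit Types (p q : exponent R) (X Y : metricType R).

Definition stable_alg q X := tensor_alg (Bu q X) (compact_ops q).
Definition stable_diag q X := tensor_alg (linf_ops q X) (C0_ops q).
Arguments stable_alg q X _ : clear implicits.
Arguments stable_diag q X _ : clear implicits.

Lemma Bs_rigid q X Y : bounded_geometry X -> bounded_geometry Y -> (q : R) != 2 ->
  isometrically_isomorphic (Bs q X) (Bs q Y) -> coarsely_equivalent X Y.
Proof.
move=> bX bY q2 [phi iphi].
have [cX sX mX] := Bs_coarse_alg q bX; have [cY sY mY] := Bs_coarse_alg q bY.
by apply: (coarse_alg_rigid bX bY _ _ cX cY sX sY mX mY iphi) => //; left.
Qed.

(** The diagonal matrix units lie in the diagonal subalgebras, so their images are diagonal;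
    injectivity of [phi] on [Bs] identifies the preimages with diagonal elements as well. This is
    the second alternative of rigidity, valid at every exponent. *)
Lemma stable_rigid_diag q X Y phi : bounded_geometry X -> bounded_geometry Y ->
  isometric_iso (stable_alg q X) (stable_alg q Y) phi ->
  phi @` stable_diag q X = stable_diag q Y -> coarsely_equivalent X Y.
Proof.
rewrite /stable_alg -!Bs_tensor => bX bY iphi hphi.
have [cX sX mX] := Bs_coarse_alg q bX; have [cY sY mY] := Bs_coarse_alg q bY.
have dmem (Z : metricType R) k : stable_diag q Z (munit q k k).
  by rewrite /stable_diag tensor_diag; apply: subset_closure; exact: diag_corner_munit.
have diag_sub (Z : metricType R) : stable_diag q Z `<=` Bs q Z.
  rewrite /stable_diag tensor_diag; apply: closureS => T [dT [N hN]]; split.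
    apply/fin_propP; exists 0 => k l Tkl; have [->|kl] := eqVneq k l.
      by rewrite mdistxx.
    by move: Tkl; rewrite dT// eqxx.
  apply: (@matrix_fixed_corner _ _ _ _ N) => k l Tkl.
  have [kl|kl] := eqVneq k l; last by move: Tkl; rewrite dT// eqxx.
  rewrite -kl; suff kN : (k.2 < N)%N by [].
  by rewrite ltnNge; apply/negP => Nk; move: Tkl; rewrite -kl hN// eqxx.
apply: (coarse_alg_rigid bX bY _ _ cX cY sX sY mX mY iphi) => //; right; split.
  move=> k; apply: tensor_diag_diagonal; rewrite -/(stable_diag q Y) -hphi.
  by exists (munit q k k).
move=> T k BT phiT; have : stable_diag q Y (munit q k k) by [].
rewrite -hphi => -[S dS phiS]; apply: tensor_diag_diagonal.
suff -> : T = S by [].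
have [[_ inj _] _ _ _] := iphi; apply: inj; rewrite ?inE//; first exact: diag_sub.
by rewrite phiT phiS.
Qed.

Lemma stable_diag_iso q X Y : bounded_geometry X -> bounded_geometry Y ->
  coarsely_equivalent X Y ->
  exists2 phi, isometric_iso (stable_alg q X) (stable_alg q Y) phi &
    phi @` stable_diag q X = stable_diag q Y.
Proof.
move=> bX bY /(coarse_matching bX bY)[M]; exists (mconj q M); last exact: mconj_diag.
by rewrite /stable_alg -!Bs_tensor; exact: mconj_Bs.
Qed.

End metric_rigidity.
Arguments stable_alg {R} q X _.
Arguments stable_diag {R} q X _.

(** * Word metrics and crossed products *)

Section word_length_theory.
Context {R : realType} (G : groupType) (gens : seq G).
Hypothesis hg : generates gens.

Local Open Scope group_scope.

Local Notation wl := (word_length gens : G -> R).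

Lemma word_length_le (w : seq G) : is_word gens w ->
  (wl (\prod_(s <- w) s)%g <= (size w)%:R)%R.
Proof.
move=> hw; apply: ge_inf; last by exists w.
by exists 0%R => _ [v _ <-].
Qed.

Lemma word_length_attained (g : G) : exists w, [/\ is_word gens w, \prod_(s <- w) s = g &
  wl g = (size w)%:R%R].
Proof.
have ex : exists n, `[< exists w, [/\ is_word gens w, \prod_(s <- w) s = g & size w = n] >].
  by have [w ww wg] := hg g; exists (size w); apply/asboolP; exists w.
have [n /asboolP[w [ww wg sw]] nmin] := ex_minnP ex.
exists w; split=> //; apply/eqP; rewrite eq_le -{1}wg word_length_le//=.
apply: lb_le_inf; first by exists (size w)%:R%R, w.
move=> _ [v [vv vg] <-]; rewrite ler_nat sw; apply: nmin.
by apply/asboolP; exists v.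
Qed.

Lemma word_length_ge0 g : (0 <= wl g)%R.
Proof. by have [w [_ _ ->]] := word_length_attained g. Qed.

Lemma word_length1 : wl 1 = 0%R.
Proof.
apply/eqP; rewrite eq_le word_length_ge0 andbT.
by have := @word_length_le [::] isT; rewrite big_nil.
Qed.

Lemma word_length_eq0 g : wl g = 0%R -> g = 1.
Proof.
have [w [_ wg ->]] := word_length_attained g => /eqP; rewrite pnatr_eq0 size_eq0.
by move=> /eqP w0; rewrite -wg w0 big_nil.
Qed.

Lemma word_lengthM g h : (wl (g * h)%g <= wl g + wl h)%R.
Proof.
have [w [ww wg ->]] := word_length_attained g.
have [v [vv vh ->]] := word_length_attained h.
rewrite -wg -vh -big_cat -natrD -size_cat; apply: word_length_le.
by rewrite /is_word all_cat; apply/andP.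
Qed.

Lemma prod_rev_inv (w : seq G) :
  \prod_(s <- rev [seq s^-1 | s <- w]) s = (\prod_(s <- w) s)^-1.
Proof.
elim: w => [|s w IH]; first by rewrite !big_nil invg1.
by rewrite map_cons rev_cons big_rcons/= IH big_cons invgM.
Qed.

Lemma word_lengthV g : wl g^-1 = wl g.
Proof.
suff le h : (wl (h^-1)%g <= wl h)%R by apply/eqP; rewrite eq_le le -{1}[g]invgK le.
have [w [ww wh ->]] := word_length_attained h.
rewrite -wh -prod_rev_inv -(size_map (fun s => s^-1)) -size_rev; apply: word_length_le.
rewrite /is_word all_rev all_map; apply: sub_all ww => s /=.
by rewrite invgK orbC.
Qed.

Fixpoint words (n : nat) : seq (seq G) :=
  if n is n'.+1 then
    words n' ++ [seq s :: w | s <- gens ++ [seq s^-1 | s <- gens], w <- words n']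
  else [:: [::]].

Lemma mem_words (w : seq G) n : is_word gens w -> (size w <= n)%N -> w \in words n.
Proof.
elim: n w => [|n IH] [|s w] //=.
  by move=> _ _; rewrite mem_cat IH.
move=> /andP[sg ww] wn; rewrite mem_cat; apply/orP; right.
apply/allpairsP; exists (s, w); split=> //=; last exact: IH.
rewrite mem_cat; case/orP: sg => [->//|sg]; apply/orP; right.
by apply/mapP; exists s^-1; rewrite ?invgK.
Qed.

Lemma word_ball_finite (r : R) : exists L : seq G, forall g, (wl g <= r)%R -> g \in L.
Proof.
pose n := (Num.Def.trunc r).+1.
exists [seq \prod_(s <- w) s | w <- words n] => g gr.
have [w [ww wg wE]] := word_length_attained g.
apply/mapP; exists w => //; apply: mem_words => //.
by rewrite -(@ler_nat R) -wE; apply: le_trans gr (ltW (Num.Theory.truncnS_gt r)).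
Qed.

End word_length_theory.

(** A copy of G labelled by the proof of generation, so that each generating set carries its own
    metric structure. *)
Definition word_space (R : realType) (G : groupType) (gens : seq G)
  of generates gens : Type := G.

HB.instance Definition _ (R : realType) (G : groupType) (gens : seq G)
  (hg : generates gens) := Choice.on (word_space R hg).

Section word_space.
Context {R : realType} (G : groupType) (gens : seq G) (hg : generates gens).

Local Notation X := (word_space R hg).

Let dist : X -> X -> R := word_dist gens.

Let dist_xx (x : X) : dist x x = 0.
Proof. by rewrite /dist /word_dist mulVg (word_length1 hg). Qed.

Let dist_eq0 (x y : X) : dist x y = 0 -> x = y.
Proof.
by move=> /(word_length_eq0 hg) /mulg1_eq; rewrite invgK.
Qed.

Let dist_sym (x y : X) : dist x y = dist y x.
Proof.
by rewrite /dist /word_dist -(word_lengthV hg) invgM invgK.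
Qed.

Let dist_triangle (y x z : X) : dist x z <= dist x y + dist y z.
Proof.
rewrite /dist /word_dist -(mulVKg y z) mulgA; apply: le_trans (word_lengthM hg _ _) _.
by rewrite mulKg.
Qed.

HB.instance Definition _ := isMetric.Build R X dist_xx dist_eq0 dist_sym dist_triangle.

Lemma word_mdistE (x y : X) : mdist x y = word_dist gens (x : G) (y : G).
Proof. by []. Qed.

Lemma card_le_seq (T : choiceType) (A : set T) (s : seq T) :
  (forall x, A x -> x \in s) -> (A #<= `I_(size s))%card.
Proof.
move=> As; case: s As => [|x0 s] As.
  by rewrite (_ : A = set0) ?card_le0x//; apply/seteqP; split=> // x /As.
apply: card_le_trans (card_image_le (nth x0 (x0 :: s)) _).
apply: subset_card_le => x /As xs; exists (index x (x0 :: s)); last by rewrite nth_index.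
by move: xs; rewrite -index_mem.
Qed.

Lemma word_bounded_geometry : bounded_geometry X.
Proof.
move=> r _; have [L hL] := word_ball_finite hg r.
exists (size L) => x; rewrite -(size_map (fun g => x * g : G)%g); apply: card_le_seq.
move=> y; rewrite /= word_mdistE /word_dist => /hL xy.
by apply/mapP; exists (x^-1 * y : G)%g; rewrite ?mulVKg.
Qed.

(* Word metrics are geodesic, so a bound at distance 1 propagates linearly. *)
Lemma word_lipschitz (Y : metricType R) (f : X -> Y) : uniformly_expansive f ->
  exists2 S : R, 0 < S & forall x y : X, mdist (f x) (f y) <= S * mdist x y.
Proof.
move=> uf; have [S S0 hS] := uf 1 ltr01; exists S => // x y.
have [w [ww wg wE]] := word_length_attained (R := R) hg (x^-1 * y : G)%g.
rewrite word_mdistE /word_dist wE.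
have -> : y = (x * \prod_(s <- w) s : G)%g by rewrite wg mulVKg.
elim: w x {wg wE} ww => [|s w IH] x /= ww.
  by rewrite big_nil mulg1 mdistxx mulr0.
have /andP[hs hw] := ww.
apply: le_trans (metric_triangle _ (f (x * s : G)%g) _) _.
rewrite big_cons mulgA -natr1 mulrDr mulr1 [leRHS]addrC lerD//.
  apply: hS; rewrite word_mdistE /word_dist mulKg.
  by have := @word_length_le R G gens [:: s]; rewrite /= hs big_seq1; apply.
exact: IH.
Qed.

End word_space.

Section quasi_isometry.
Context {R : realType}.

Lemma quasi_isometric_coarse (X Y : metricType R) :
  quasi_isometric (@mdist R X) (@mdist R Y) -> coarsely_equivalent X Y.
Proof.
move=> [f [A [B [A1 B0 fqi /choice[g hg]]]]].
have A0 : 0 < A by apply: lt_le_trans ltr01 A1.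
have low s t : mdist s t <= A * (mdist (f s) (f t) + B).
  have /andP[h _] := fqi s t; rewrite -ler_pdivrMl//; lra.
exists f, g; split.
- move=> r r0; exists (A * r + B); first by rewrite ltr_pwDl// mulr_gt0.
  move=> x y xy; have /andP[_ h] := fqi x y; apply: le_trans h _.
  by rewrite lerD2r ler_pM2l.
- move=> r r0; exists (A * (r + B + B + B)); first by rewrite mulr_gt0//; lra.
  move=> x y xy; apply: le_trans (low _ _) _; rewrite ler_pM2l// lerD2r.
  apply: le_trans (metric_triangle _ x _) _; have h := hg x.
  have := metric_triangle x y (f (g y)); have := hg y; rewrite [mdist y (f _)]metric_sym; lra.
- by exists B => t; exact: hg.
- exists (A * (B + B)) => s; apply: le_trans (low _ _) _; rewrite ler_pM2l// lerD2r.
  exact: hg.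
Qed.

(** The upper bound is the Lipschitz bound for f; the lower one combines that for g with d(s, t) <=
    d(g (f s), g (f t)) + 2 C2. *)
Lemma coarse_quasi_isometric (G H : groupType) (gensG : seq G) (gensH : seq H)
    (hG : generates gensG) (hH : generates gensH) :
  coarsely_equivalent (word_space R hG) (word_space R hH) ->
  quasi_isometric (word_dist gensG : G -> G -> R) (word_dist gensH : H -> H -> R).
Proof.
move=> [f [g [uf ug [C1 fg] [C2 gf]]]].
have [S S0 hS] := word_lipschitz uf; have [T T0 hT] := word_lipschitz ug.
(* The 1 and the 0 meet the sign conditions, S and T are the Lipschitz constants, C1 gives coarse
   surjectivity and C2 + C2 the additive error of the lower bound. *)
exists f, (Num.max 1 (Num.max S T)), (Num.max 0 (Num.max C1 (C2 + C2))).
set A := Num.max _ _; set B := Num.max _ _.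
have A1 : 1 <= A by rewrite /A le_max lexx.
have SA : S <= A by rewrite /A !le_max lexx orbT.
have TA : T <= A by rewrite /A !le_max lexx !orbT.
have B0 : 0 <= B by rewrite /B le_max lexx.
have C1B : C1 <= B by rewrite /B !le_max lexx orbT.
have C2B : C2 + C2 <= B by rewrite /B !le_max lexx !orbT.
have A0 : 0 < A by apply: lt_le_trans ltr01 A1.
split=> //; last by move=> t; exists (g t); apply: le_trans (fg t) C1B.
move=> s t.
have d0 : 0 <= mdist (s : word_space R hG) t by exact: mdist_ge0.
have e0 : 0 <= mdist (f s) (f t) by exact: mdist_ge0.
have h1 := hS s t; have h2 := hT (f s) (f t).
have h3 := metric_triangle (s : word_space R hG) (g (f s)) t.
have h4 := metric_triangle (g (f s)) (g (f t)) t.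
have h5 := gf s; have h6 := gf t; rewrite /= in h5 h6.
rewrite metric_sym in h5.
rewrite -[word_dist gensG s t]/(mdist (s : word_space R hG) t).
rewrite -[word_dist gensH _ _]/(mdist (f s) (f t)).
apply/andP; split; last first.
  apply: le_trans h1 _; apply: (@le_trans _ _ (A * mdist (s : word_space R hG) t)).
    by rewrite ler_wpM2r.
  by rewrite lerDl.
rewrite lerBlDr ler_pdivrMl// mulrDr.
have TAd : T * mdist (f s) (f t) <= A * mdist (f s) (f t) by rewrite ler_wpM2r.
have BA : B <= A * B by rewrite ler_peMl.
lra.
Qed.

End quasi_isometry.

Section transport_tensor.
Context {R : realType} (p : exponent R).
Implicit Types (I J : choiceType).

Lemma retraction_tensor_alg I J (phi : bop (lp p I) -> bop (lp p J))
    (phi2 : bop (lp p (I * nat)%type) -> bop (lp p (J * nat)%type)) psi2 A B :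
  retraction phi2 psi2 -> (forall a b, phi2 (tens a b) = tens (phi a) b) ->
  tensor_alg (phi @` A) B = phi2 @` tensor_alg A B.
Proof.
move=> r ht; rewrite !tensor_algE (retraction_closure _ r) (retr_span _ r).
congr (closure (lin_span _)); apply/seteqP; split.
  move=> _ [[_ b] [/= [a Aa <-] Bb] <-]; exists (tens a b); last exact: ht.
  by exists (a, b).
by move=> _ [_ [[a b] [/= Aa Bb] <-] <-]; exists (phi a, b); [split=> //; exists a | rewrite ht].
Qed.

End transport_tensor.

Section crossed_products.
Context {R : realType} (p : exponent R) (G : groupType) (gens : seq G).
Hypothesis hg : generates gens.

Local Notation X := (word_space R hg).

(* The permutation (t, k) |-> (t, (tk)^-1) of G * G turns the crossed product into
   1 (x) Bu(G), since it carries pi(a) to 1 (x) a(k^-1) and 1 (x) lambda_s to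
   1 (x) the right translation by s, whose displacement for the left invariant
   metric is bounded. *)
Definition twist (k : G * X) : G * G := (k.1, (k.1 * k.2)^-1)%g.
Definition untwist (k : G * G) : G * X := (k.1, (k.2 * k.1)^-1)%g.

Lemma twistK : cancel twist untwist.
Proof. by move=> [t k]; rewrite /untwist /twist /= invgM invgK mulKg. Qed.

Lemma untwistK : cancel untwist twist.
Proof. by move=> [t g]; rewrite /untwist /twist /= invgM invgK mulgK. Qed.

Definition crossed (S : bop (lp p X)) : bop (lp p (G * G)%type) :=
  conjop twistK untwistK (amp G S).

(** [twist] with the coefficient index carried along and the factors regrouped, so that tensoring
    with the second factor commutes with the embedding. *)
Definition twist2 (k : G * (X * nat)) : (G * G) * nat := (twist (k.1, k.2.1), k.2.2).
Definition untwist2 (k : (G * G) * nat) : G * (X * nat) :=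
  ((untwist k.1).1, ((untwist k.1).2, k.2)).

Lemma twist2K : cancel twist2 untwist2.
Proof.
by move=> [t [k n]]; have [h] := twistK (t, k); rewrite /untwist2 /= h.
Qed.

Lemma untwist2K : cancel untwist2 twist2.
Proof.
by move=> [[t g] n]; have [h] := untwistK (t, g); rewrite /twist2 /twist /= h.
Qed.

Definition crossed2 (S : bop (lp p (X * nat)%type)) : bop (lp p ((G * G) * nat)%type) :=
  conjop twist2K untwist2K (amp G S).

Lemma crossed_retraction : retraction crossed
  ((fun T => entry T 1%g 1%g) \o conjop untwistK twistK).
Proof.
exact: (retraction_comp (amp_retraction p X (1%g : G)) (conjop_retraction p twistK untwistK)).
Qed.

Lemma crossed2_retraction : retraction crossed2
  ((fun T => entry T 1%g 1%g) \o conjop untwist2K twist2K).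
Proof.
exact: (retraction_comp (amp_retraction p (X * nat)%type (1%g : G))
  (conjop_retraction p twist2K untwist2K)).
Qed.

Lemma scalar_entry_amp (I J : choiceType) (S : bop (lp p J)) (k l : I * J) :
  scalar_entry (amp I S) k l = (k.1 == l.1)%:R * scalar_entry S k.2 l.2.
Proof.
by case: k l => [x i] [y j]; rewrite -scalar_entry_entry entry_amp scalar_entryZ.
Qed.

Lemma scalar_entry_crossed S k l : scalar_entry (crossed S) k l =
  (k.1 == l.1)%:R * scalar_entry S (k.2 * k.1)^-1%g (l.2 * l.1)^-1%g.
Proof. by rewrite scalar_entry_conjop scalar_entry_amp. Qed.

Lemma crossed2_tens a b : crossed2 (tens a b) = tens (crossed a) b.
Proof.
apply: bop_eq_entry => k l.
rewrite scalar_entry_conjop scalar_entry_amp !scalar_entry_tens scalar_entry_crossed /=.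
by rewrite mulrA.
Qed.

Lemma is_pi_entry (a : G -> R[i]) P : is_pi (p := p) a P ->
  forall k l, scalar_entry P k l = a (k.2 * k.1)%g * (k == l)%:R.
Proof.
move=> hP [t h] [t' g]; rewrite /scalar_entry -lptensor_delta hP /ltranslate invgK lpdeltaE.
rewrite xpair_eqE -mulrA lpdeltaE -natrM mulnb.
have [->|hgn] := eqVneq h g; first by rewrite andbT.
by rewrite andbF !mulr0.
Qed.

Lemma bounded_funP (I : choiceType) (a : I -> R[i]) :
  bounded_fun (a : I -> R[i]^o) <-> exists2 M : R, 0 <= M & forall i, normc (a i) <= M.
Proof.
split=> [[M0 [M0r hM]]|[M M0 hM]].
  have M1 : 0 <= `|complex.Re M0| + 1 by rewrite addr_ge0.
  exists (`|complex.Re M0| + 1) => // i.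
  have := hM (`|complex.Re M0| + 1)%:C _ i; rewrite -lecR -normc_norm; apply=> //.
  rewrite -[X in X < _](RRe_real M0r) ltcR.
  by apply: le_lt_trans (ler_norm _) _; rewrite ltrDl.
exists M%:C; split; first by rewrite ger0_real// ler0c.
move=> N hN i _; apply: le_trans (ltW hN).
by rewrite [X in X <= _]normc_norm lecR.
Qed.

Lemma crossed_linfE : crossed_linf p G = crossed @` linf_ops p X.
Proof.
apply/seteqP; split=> [P [a /bounded_funP[M M0 aM] hP]|_ [S [a /bounded_funP[M M0 aM] hS] <-]].
  have aM' (k : X) : normc (a (k^-1)%g) <= M by [].
  exists (wcop p (diag_bound M0 aM')).
    apply/linf_opsP => i j ij.
    by rewrite scalar_entry_wcop (negbTE ij) mulr0.
  apply: bop_eq_entry => k l.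
  rewrite scalar_entry_crossed (is_pi_entry hP) scalar_entry_wcop invgK.
  case: k l => [t h] [t' g] /=; rewrite xpair_eqE eqg_inv.
  have [->|] := eqVneq t t'; last by rewrite !mul0r mulr0.
  by rewrite mul1r (inj_eq (mulIg _)).
exists (fun g => a (g^-1)%g); first by apply/bounded_funP; exists M.
move=> xi g t h; rewrite /crossed conjopE ampE hS lpsliceE lpreindexE /ltranslate !invgK.
rewrite -surjective_pairing untwistK -[lptensor _ _ _]/(xi t * lpdelta p g h).
rewrite lpdeltaE mulrA.
have [->|hgn] := eqVneq h g; first by rewrite !mulr1.
by rewrite !mulr0.
Qed.

Lemma rtrans_inj (s : G) : injective (fun k : X => k * s : X)%g.
Proof. by move=> x y /mulIg. Qed.

Definition rtrans (s : G) : bop (lp p X) :=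
  wcop p (reindex_bound (@rtrans_inj s)).

Lemma ltrans_inj (s : G) : injective (fun k : G => s^-1 * k)%g.
Proof. by move=> x y /mulgI. Qed.

Definition ltrans (s : G) : bop (lp p G) :=
  wcop p (reindex_bound (@ltrans_inj s)).

Lemma crossed_rtrans s : crossed (rtrans s) = tens 1 (ltrans s).
Proof.
apply: bop_eq_entry => -[t h] [t' g]; rewrite scalar_entry_crossed scalar_entry_tens /=.
rewrite !scalar_entry_wcop !mul1r /scalar_entry bop1E lpdeltaE.
have [->|] := eqVneq t t'; last by rewrite !mul0r.
rewrite !mul1r -(inj_eq invg_inj) invgM !invgK mulgA (inj_eq (mulIg _)).
by [].
Qed.

Lemma crossed_translationE : @crossed_translation R p G = range (crossed \o rtrans).
Proof.
apply/seteqP; split=> [U [s [L [hL /is_tensorE ->]]]|_ [s _ <-]].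
  exists s => //=; rewrite crossed_rtrans; congr tens; apply: bop_eq_delta => g.
  rewrite hL; apply: lp_eqP => k; rewrite wcopE mul1r !lpdeltaE.
  by rewrite -(inj_eq (mulgI s)) mulVKg.
exists s, (ltrans s); split; last by rewrite /= crossed_rtrans; exact: is_tensor_tens.
move=> g; apply: lp_eqP => k; rewrite wcopE mul1r !lpdeltaE.
by rewrite -(inj_eq (mulgI s)) mulVKg.
Qed.

Lemma crossed_productE : crossed_product p G = crossed @` Bu p X.
Proof.
rewrite /Bu (retraction_closure _ crossed_retraction); congr closure.
have -> : [set T : bop (lp p X) | fin_prop_u T] =
    lin_span [set D * rtrans s | D in linf_ops p X & s in [set: G]].
  apply/seteqP; split=> [T /fin_prop_uP[r hr]|].
    (* A finite propagation operator is the sum, over s in a finite ball, of its part on the pairs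
       (x, x s), and that part is a diagonal operator times the right translation by s. *)
    have [L0 hL0] := word_ball_finite hg r.
    pose L := undup L0.
    have hL (x y : X) : scalar_entry T x y != 0 -> (x^-1 * y : G)%g \in L.
      by move=> /hr h; rewrite mem_undup; apply: hL0; exact: h.
    have aM s (x : X) : normc (scalar_entry T x (x * s : G)%g) <= opnorm T.
      exact: normc_scalar_entry_le.
    have -> : T = \sum_(s : seq_sub L) wcop p (diag_bound (opnorm_ge0 T) (aM (ssval s))) *
        rtrans (ssval s).
      apply: bop_eq_entry => x y; rewrite [RHS]/scalar_entry bop_sumE lp_sumE.
      transitivity (\sum_(s : seq_sub L) ((x * ssval s)%g == y)%:R * scalar_entry T x y).
        have [->|Txy] := eqVneq (scalar_entry T x y) 0.
          by rewrite big1// => s _; rewrite mulr0.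
        rewrite (bigD1 (SeqSub (hL _ _ Txy)))//= mulVKg eqxx mul1r big1 ?addr0// => s sn.
        case: eqP => [xsy|_]; last by rewrite mul0r.
        by case/eqP: sn; apply/val_inj; rewrite /= -xsy mulKg.
      apply: eq_bigr => s _; rewrite bopM !wcopE mul1r lpdeltaE mulrC.
      by case: eqP => [->|_]; rewrite ?mulr0.
    apply: lin_span_sum => s; apply: lin_span_sub.
    exists (wcop p (diag_bound (opnorm_ge0 T) (aM (ssval s)))).
      apply/linf_opsP => i j ij.
      by rewrite scalar_entry_wcop (negbTE ij) mulr0.
    by exists (ssval s).
  move=> _ [n [c [a [ha ->]]]]; apply/fin_prop_uP.
  elim/big_ind: _ => [|S T fS fT|i _].
  - by exists 0 => k l; rewrite /scalar_entry bop0E eqxx.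
  - by rewrite -[S]scale1r; exact: (@propagatesL _ _ _ _ id).
  have [D /linf_opsP dD [s _ <-]] := ha i.
  exists (word_length gens s) => k l; rewrite scalar_entryZ mulf_eq0 negb_or => /andP[_].
  move=> /scalar_entryM_neq0[m [Dkm]].
  have -> : k = m by apply/eqP; apply: contraNT Dkm => km; rewrite dD.
  rewrite scalar_entry_wcop mul1r; case: ((m * s)%g =P l) => [<- _|]; last by rewrite eqxx.
  by rewrite word_mdistE /word_dist mulKg.
rewrite (retr_span _ crossed_retraction); congr lin_span.
rewrite crossed_linfE crossed_translationE; apply/seteqP; split.
  move=> _ [_ [_ [[D lD <-] [s _ <-] ->]]]; exists (D * rtrans s).
    by exists D => //; exists s.
  by rewrite (retr_mul crossed_retraction).
move=> _ [_ [D lD [s _ <-]] <-]; exists (crossed D), (crossed (rtrans s)); split.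
- by exists D.
- by exists s.
- by rewrite (retr_mul crossed_retraction).
Qed.

Lemma crossed_stable_alg :
  tensor_alg (crossed_product p G) (compact_ops p) = crossed2 @` stable_alg p X.
Proof. by rewrite crossed_productE (retraction_tensor_alg _ _ crossed2_retraction crossed2_tens). Qed.

Lemma crossed_stable_diag :
  tensor_alg (crossed_linf p G) (C0_ops p) = crossed2 @` stable_diag p X.
Proof. by rewrite crossed_linfE (retraction_tensor_alg _ _ crossed2_retraction crossed2_tens). Qed.

End crossed_products.

(** * Nonamenable groups *)

Section hall.
Context (X Y : choiceType).
Implicit Types (N M : X -> {fset Y}) (A B : {fset X}).

Local Open Scope fset_scope.

Definition neighbours N A : {fset Y} := \bigcup_(x <- A) N x.

Definition hall_condition N := forall A, (#|` A| <= #|` neighbours N A|)%N.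

Lemma neighboursP N A y : reflect (exists2 x, x \in A & y \in N x) (y \in neighbours N A).
Proof.
apply: (iffP (bigfcupP _ _ _ _)) => [[x /andP[xA _] yx]|[x xA yx]]; first by exists x.
by exists x; rewrite ?xA.
Qed.

Lemma neighbours_sub N A (U : {fset Y}) : (forall x, x \in A -> N x `<=` U) ->
  neighbours N A `<=` U.
Proof. by move=> h; apply/fsubsetP => y /neighboursP[x xA]; apply/fsubsetP/h. Qed.

Definition below N M := forall x, N x `<=` M x.

(** Along a chain the finite set at x stabilises: a member of least cardinality there is contained
    in all the others. *)
Lemma chain_minimum (C : set (X -> {fset Y})) (P : (X -> {fset Y}) -> Prop) M0 :
  C M0 -> (forall N M, C N -> C M -> below N M \/ below M N) ->
  forall x, exists M, C M /\ forall M', C M' -> M x `<=` M' x.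
Proof.
move=> CM0 tot x.
have ex : exists n, `[< exists M, C M /\ #|` M x| = n >].
  by exists #|` M0 x|; apply/asboolP; exists M0.
have [n /asboolP[M [CM Mn]] nmin] := ex_minnP ex.
exists M; split=> // M' CM'; have [h|h] := tot M M' CM CM'; first exact: h.
have nM' : (n <= #|` M' x|)%N by apply: nmin; apply/asboolP; exists M'.
have e : #|` M' x| = #|` M x|.
  by apply/eqP; rewrite eqn_leq fsubset_leq_card ?Mn.
have /(fsubset_cardP e) E := h x.
by apply/fsubsetP => y; rewrite E.
Qed.

(** Zorn's lemma, with the pointwise intersection as lower bound of a chain. Finiteness of the sets
    [N x] is what lets Hall's condition pass to this intersection. *)
Lemma minimal_hall N : hall_condition N -> exists M, [/\ hall_condition M, below M N &
  forall M', hall_condition M' -> below M' M -> forall x, M' x = M x].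
Proof.
move=> hN; pose T := {M : X -> {fset Y} | hall_condition M /\ below M N}.
(* The order is reversed, so that a maximal element is a minimal relation. *)
pose R : rel T := fun a b : T => `[< below (sval b) (sval a) >].
have N0 : T by exists N; split=> // x; exact: fsubset_refl.
have [//|M x y|C totC|M Mmax] := @ZL_preorder T N0 R.
- by move=> M; apply/asboolP => x; exact: fsubset_refl.
- move=> /asboolP h1 /asboolP h2; apply/asboolP => z.
  exact: fsubset_trans (h2 z) (h1 z).
- have [[M0 CM0]|C0] := pselect (exists a, C a); last first.
    by exists N0 => s Cs; case: C0; exists s.
  pose C' := [set sval a | a in C].
  have tot N1 N2 : C' N1 -> C' N2 -> below N1 N2 \/ below N2 N1.
    move=> [M1 C1 <-] [M2 C2 <-].
    by case: (totC _ _ C1 C2) => /asboolP h; [right|left].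
  have C'0 : C' (sval M0) by exists M0.
  have /choice[m hm] := chain_minimum (fun=> True) C'0 tot.
  (* A single member of the chain attains the pointwise minimum on all of the finite set [A], so it
     transmits Hall's condition for [A]. *)
  have simult A : exists M, C' M /\ forall x, x \in A -> M x = m x x.
    have : forall s : seq X, exists M, C' M /\
        forall x, x \in s -> forall M', C' M' -> M x `<=` M' x.
      elim=> [|x s [M [CM hM]]]; first by exists (sval M0).
      have [Cx minx] := hm x.
      have [h|h] := tot _ _ CM Cx.
        exists M; split=> // y; rewrite finmap.inE => /predU1P[->|ys M' CM']; last exact: hM.
        by move=> M' CM'; exact: fsubset_trans (h x) (minx _ CM').
      exists (m x); split=> // y; rewrite finmap.inE => /predU1P[->//|ys M' CM'].
      exact: fsubset_trans (h y) (hM _ ys _ CM').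
    move=> /(_ (enum_fset A))[M [CM hM]]; exists M; split=> // x xA.
    have [Cx minx] := hm x.
    by apply/eqP; rewrite eqEfsubset hM// minx.
  have hm' : hall_condition (fun x => m x x).
    move=> A; have [M [[M1 _ M1E] hM]] := simult A.
    have -> : neighbours (fun x => m x x) A = neighbours M A.
      by apply: eq_big_seq => x xA; rewrite hM.
    by rewrite -M1E; case: (svalP M1).
  have mN : below (fun x => m x x) N.
    by move=> x; have [[M1 _ <-] _] := hm x; case: (svalP M1).
  exists (exist _ (fun x => m x x) (conj hm' mN)) => M CM; apply/asboolP => x /=.
  by have [_] := hm x; apply; exists M.
have [hM MN] := svalP M; exists (sval M); split=> // M' hM' M'M x.
have M'N : below M' N by move=> y; exact: fsubset_trans (M'M y) (MN y).
have /Mmax/asboolP h : R M (exist _ M' (conj hM' M'N)) by apply/asboolP.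
by apply/eqP; rewrite eqEfsubset M'M; exact: (h x).
Qed.

(* Rado: if two neighbours y1, y2 of x could neither be deleted, the witnesses
   A1, A2 would violate the condition on their union or intersection. *)
Lemma rado N x y1 y2 : hall_condition N -> y1 \in N x -> y2 \in N x -> y1 != y2 ->
  (forall M, hall_condition M -> below M N -> forall z, M z = N z) -> False.
Proof.
move=> hN y1x y2x y12 minN.
pose del y z := if z == x then N x `\ y else N z.
(* Deleting y breaks the condition on some B, necessarily containing x; removing x from B gives A,
   and the cardinality drops by one. *)
have viol y : y \in N x -> exists A, [/\ x \notin A &
    (#|` neighbours N A `|` (N x `\ y)| <= #|` A|)%N].
  move=> yx; have : ~ hall_condition (del y).
    move=> hd; have := minN _ hd _ x; rewrite /del eqxx => h.
    have : y \in N x `\ y.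
      by rewrite h// => z; rewrite /del; case: eqP => [->|_]; rewrite ?fsubD1set.
    by rewrite !finmap.inE eqxx.
  move=> /existsNP[B /negP]; rewrite -ltnNge => hB.
  have xB : x \in B.
    apply: contraLR hB => xB; rewrite -leqNgt; apply: leq_trans (hN B) _.
    rewrite (_ : neighbours N B = neighbours (del y) B)//.
    by apply: eq_big_seq => z zB; rewrite /del; case: eqP => // zx; rewrite -zx zB in xB.
  exists (B `\ x); split; first by rewrite !finmap.inE eqxx.
  have := hB; rewrite (cardfsD1 x B) xB add1n ltnS; apply: leq_trans.
  apply: fsubset_leq_card; rewrite fsubUset; apply/andP; split.
    apply: neighbours_sub => z; rewrite !finmap.inE => /andP[zx zB]; apply/fsubsetP => w wz.
    by apply/neighboursP; exists z => //; rewrite /del (negbTE zx).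
  by apply/fsubsetP => w wx; apply/neighboursP; exists x; rewrite // /del eqxx.
have [A1 [xA1 h1]] := viol y1 y1x; have [A2 [xA2 h2]] := viol y2 y2x.
set P := _ `|` _ in h1; set Q := _ `|` _ in h2.
(* As y1 <> y2, the union of P and Q contains all of N x, so the condition with x added to A1 and A2
   gains one. Adding the bound for the intersection contradicts |P| + |Q| <= |A1| + |A2|. *)
have U : (#|` A1 `|` A2|.+1 <= #|` P `|` Q|)%N.
  have := hN (x |` (A1 `|` A2)).
  rewrite cardfsU1 !finmap.inE (negbTE xA1) (negbTE xA2)/= add1n => /leq_trans; apply.
  apply: fsubset_leq_card; apply: neighbours_sub => z; rewrite !finmap.inE.
  move=> /or3P[/eqP ->|zA|zA]; apply/fsubsetP => w wz; rewrite !finmap.inE.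
  - rewrite wz !andbT; have [->|_] := eqVneq w y1; last by rewrite orbT.
    by rewrite y12 !orbT.
  - by rewrite (_ : w \in neighbours N A1)//; apply/neighboursP; exists z.
  - by rewrite (_ : w \in neighbours N A2) ?orbT//; apply/neighboursP; exists z.
have V : (#|` A1 `&` A2| <= #|` P `&` Q|)%N.
  apply: leq_trans (hN _) _; apply: fsubset_leq_card; apply: neighbours_sub => z.
  rewrite !finmap.inE => /andP[z1 z2]; apply/fsubsetP => w wz; rewrite !finmap.inE.
  by apply/andP; split; apply/orP; left; apply/neighboursP; exists z.
have := leq_add U V; rewrite addSn !cardfsUI => h.
by have := leq_trans h (leq_add h1 h2); rewrite ltnn.
Qed.

(** In a minimal relation every neighbourhood is a singleton; the condition on pairs makes the
    resulting map injective. *)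
Theorem hall N : hall_condition N -> exists2 h : X -> Y, injective h & forall x, h x \in N x.
Proof.
move=> /minimal_hall[M [hM MN minM]].
have /choice[h hE] : forall x, exists y, M x = [fset y].
  move=> x; apply/cardfs1P; rewrite eqn_leq; apply/andP; split.
    rewrite leqNgt; apply/negP => c1.
    have [y1 y1x] : exists y1, y1 \in M x.
      by apply/fset0Pn; rewrite -cardfs_gt0; apply: leq_trans c1.
    have [y2] : exists y2, y2 \in M x `\ y1.
      by apply/fset0Pn; rewrite -cardfs_gt0; move: c1; rewrite (cardfsD1 y1) y1x.
    rewrite !finmap.inE => /andP[y21 y2x].
    by apply: (rado hM y1x y2x _ minM); rewrite eq_sym.
  have := hM [fset x]; rewrite cardfs1 /neighbours big_seq_fset1.
  by [].
exists h => [x x' hxx|x]; last by apply: (fsubsetP (MN x)); rewrite hE finmap.inE.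
apply/eqP; apply: contraT => xx'; have := hM [fset x; x'].
rewrite cardfs2 xx' => /leq_trans/(_ (fsubset_leq_card (_ : _ `<=` [fset h x]))).
rewrite cardfs1; apply; apply: neighbours_sub => z; rewrite !finmap.inE => /orP[] /eqP ->.
  by rewrite hE fsubset_refl.
by rewrite hE hxx fsubset_refl.
Qed.

End hall.

(* The Cantor-Schroder-Bernstein bijection, remembering that it agrees pointwise
   with one of the two injections. *)
Lemma cantor_bernstein (X Y : Type) (f : X -> Y) (g : Y -> X) :
  injective f -> injective g -> exists (s : X -> Y) (t : Y -> X),
    [/\ cancel s t, cancel t s & forall x, s x = f x \/ x = g (s x)].
Proof.
(* C consists of the points whose backward orbit under g o f starts outside the range of g; s is f
   on C and the inverse of g off it. *)
move=> fI gI; pose C x := exists n x0, ~ range g x0 /\ x = iter n (g \o f) x0.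
have /choice[s hs] : forall x, exists y, (C x -> y = f x) /\ (~ C x -> x = g y).
  move=> x; have [Cx|nC] := pselect (C x); first by exists (f x).
  have [[y _ yx]|ng] := pselect (range g x); first by exists y; split=> // _; rewrite yx.
  by case: nC; exists 0%N, x.
have Cgf x : C x -> C (g (f x)).
  by move=> [n [x0 [h ->]]]; exists n.+1, x0.
have sI : injective s.
  move=> x x' xx'; have [[sx nsx] [sx' nsx']] := (hs x, hs x').
  have [Cx|nC] := pselect (C x); have [Cx'|nC'] := pselect (C x').
  - by apply: fI; rewrite -sx// -sx'.
  - by case: (nC'); rewrite (nsx' nC') -xx' sx//; exact: Cgf.
  - by case: (nC); rewrite (nsx nC) xx' sx'//; exact: Cgf.
  - by rewrite (nsx nC) (nsx' nC') xx'.
have /choice[t ht] : forall y, exists x, s x = y.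
  move=> y; have [[n [x0 [h e]]]|nC] := pselect (C (g y)).
    case: n e => [e|n e]; first by case: h; exists y.
    move: e => /= /gI ->; exists (iter n (g \o f) x0); apply: (hs _).1.
    by exists n, x0.
  by exists (g y); apply: gI; rewrite -(hs _).2.
exists s, t; split=> [x|//|x]; first by apply: sI; rewrite ht.
by have [Cx|nC] := pselect (C x); [left; exact: (hs x).1 | right; exact: (hs x).2].
Qed.

Lemma fmap_ultra (T S : Type) (f : T -> S) (U : set_system T) :
  UltraFilter U -> UltraFilter (f @ U).
Proof.
move=> UU; split; first exact: fmap_proper_filter.
move=> H PH UH; apply/seteqP; split=> // B HB.
have [//|nB] := in_ultra_setVsetC (f @^-1` B) UU.
case: (@filter_not_empty _ H _); rewrite -(setICr B).
by apply: filterI => //; exact: UH.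
Qed.

(** * Folner sets and expansion *)

Section folner.
Context {R : realType} (G : groupType) (gens : seq G).
Hypothesis hg : generates gens.

(** The identity is included so that thickening enlarges a set. *)
Definition letters : seq G := (1 :: gens ++ [seq s^-1 | s <- gens])%g.

(** Multiplication is on the right, since the word metric is left invariant: this is the
    neighbourhood of radius 1. *)
Definition thicken (F : {fset G}) : {fset G} :=
  (\bigcup_(s <- letters) [fset (g * s)%g | g in F])%fset.

Lemma thickenP (F : {fset G}) y :
  reflect (exists g s, [/\ g \in F, s \in letters & y = (g * s)%g]) (y \in thicken F).
Proof.
apply: (iffP (bigfcupP _ _ _ _)) => [[s /andP[sl _] /imfsetP[g /= gF ->]]|[g [s [gF sl ->]]]].
  by exists g, s.
by exists s; rewrite ?sl//; apply/imfsetP; exists g.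
Qed.

Lemma sub_thicken F s : s \in letters -> ([fset (g * s)%g | g in F] `<=` thicken F)%fset.
Proof.
move=> sl; apply/fsubsetP => _ /imfsetP[g /= gF ->]; apply/thickenP.
by exists g, s.
Qed.

Lemma card_translate (F : {fset G}) (s : G) : #|` [fset (g * s)%g | g in F]%fset| = #|` F|.
Proof. by rewrite card_imfset//; exact: mulIg. Qed.

Lemma thicken_self (F : {fset G}) : (F `<=` thicken F)%fset.
Proof.
apply/fsubsetP => g gF; apply/thickenP; exists g, 1%g; split=> //; last by rewrite mulg1.
by rewrite inE eqxx.
Qed.

Lemma thicken_iter_dist n (F : {fset G}) y : y \in iter n thicken F ->
  exists2 x, x \in F & word_dist gens x y <= n%:R :> R.
Proof.
elim: n y => [|n IH] y /=.
  by move=> yF; exists y => //; rewrite /word_dist mulVg (word_length1 hg).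
move=> /thickenP[g [s [/IH[x xF xg] sl ->]]]; exists x => //.
rewrite /word_dist mulgA; apply: le_trans (word_lengthM hg _ _) _.
rewrite -natr1; apply: lerD => //.
move: sl; rewrite inE => /predU1P[->|sl]; first by rewrite (word_length1 hg).
have := @word_length_le R G gens [:: s]; rewrite big_seq1 /=; apply.
rewrite andbT; move: sl; rewrite mem_cat => /orP[->//|/mapP[t tg ->]].
by rewrite invgK tg orbT.
Qed.

Lemma sum_fset_subset (A B : {fset G}) (v : G -> R) : (A `<=` B)%fset ->
  \sum_(x <- B) v x = \sum_(x <- A) v x + \sum_(x <- B | x \notin A) v x.
Proof.
move=> AB; rewrite (bigID (mem A))/=; congr (_ + _).
rewrite -big_filter; apply: perm_big; apply: uniq_perm; rewrite ?filter_uniq ?fset_uniq//.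
move=> x; rewrite mem_filter /=; case xA : (x \in A) => //=.
by rewrite (fsubsetP AB).
Qed.

Lemma sum_fset_diff (A B : {fset G}) (v : G -> R) (M : R) : (A `<=` B)%fset ->
  (forall x, `|v x| <= M) ->
  `|\sum_(x <- B) v x - \sum_(x <- A) v x| <= M * (#|` B|%:R - #|` A|%:R).
Proof.
move=> AB vM; rewrite (sum_fset_subset v AB) addrAC subrr add0r.
have -> : #|` B|%:R - #|` A|%:R = \sum_(x <- B | x \notin A) 1 :> R.
  have := sum_fset_subset (fun=> 1) AB.
  by rewrite !big_const_seq !count_predT !iter_addr_0 => ->; rewrite addrAC subrr add0r.
rewrite mulr_sumr; apply: le_trans (ler_norm_sum _ _ _) _.
by apply: ler_sum => x _; rewrite mulr1.
Qed.

Definition average (F : {fset G}) (v : G -> R) : R := (\sum_(x <- F) v x) / #|` F|%:R.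

Lemma average_le (F : {fset G}) v M : 0 <= M -> (forall x, `|v x| <= M) ->
  `|average F v| <= M.
Proof.
move=> M0 vM; have [->|F0] := eqVneq F fset0.
  by rewrite /average big_seq_fset0 mul0r normr0.
have cF : 0 < #|` F|%:R :> R by rewrite ltr0n cardfs_gt0.
rewrite /average normrM normfV (ger0_norm (ltW cF)).
rewrite ler_pdivrMr//; apply: le_trans (ler_norm_sum _ _ _) _.
apply: (@le_trans _ _ (\sum_(x <- F) M)); first exact: ler_sum.
by rewrite big_const_seq count_predT iter_addr_0 mulr_natr.
Qed.

(** F and its translate F s both lie in the thickening and have |F| elements, so each misses at most
    |F| / (m + 1) of its points; both sums are compared with the sum over the thickening. *)
Lemma average_translate (F : {fset G}) v M s m : s \in letters ->
  (forall x, `|v x| <= M) -> (m.+1 * #|` thicken F| < m.+2 * #|` F|)%N ->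
  `|average F (fun t => v (t * s)%g) - average F v| <= 2 * M / m.+1%:R.
Proof.
move=> sl vM hF.
have M0 : 0 <= M := le_trans (normr_ge0 _) (vM 1%g).
have cF : 0 < #|` F|%:R :> R.
  by rewrite ltr0n lt0n; apply: contraTneq hF => ->; rewrite muln0.
have m0 : 0 < m.+1%:R :> R by rewrite ltr0n.
have hE : #|` thicken F|%:R - #|` F|%:R <= #|` F|%:R / m.+1%:R :> R.
  rewrite ler_pdivlMr// mulrBl -!natrM lerBlDl -natrD ler_nat.
  by rewrite mulnC [(_ * m.+1)%N]mulnC -mulSnr ltnW.
set Fs := [fset (g * s)%g | g in F]%fset.
have sFs : \sum_(x <- F) v (x * s)%g = \sum_(x <- Fs) v x.
  by rewrite /Fs big_imfset//= => x y _ _; exact: mulIg.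
have d1 := sum_fset_diff (thicken_self F) vM.
have d2 := sum_fset_diff (sub_thicken F sl) vM.
rewrite card_translate -/Fs in d2.
rewrite /average sFs -mulrBl normrM normfV (ger0_norm (ltW cF)).
rewrite ler_pdivrMr//.
apply: (@le_trans _ _ (2 * M * (#|` F|%:R / m.+1%:R))); last by rewrite mulrA mulrAC.
apply: (@le_trans _ _ (2 * (M * (#|` thicken F|%:R - #|` F|%:R)))); last first.
  by rewrite mulrA ler_wpM2l// mulr_ge0.
set T := \sum_(x <- thicken F) v x in d1 d2.
have -> : \sum_(x <- Fs) v x - \sum_(x <- F) v x =
  (T - \sum_(x <- F) v x) - (T - \sum_(x <- Fs) v x) by ring.
apply: le_trans (ler_normB _ _) _; lra.
Qed.

Lemma bounded_real_funP (I : Type) (u : I -> R) :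
  bounded_fun u <-> exists2 M : R, 0 <= M & forall i, `|u i| <= M.
Proof.
split=> [[M0 [_ hM]]|[M M0 hM]].
  exists (`|M0| + 1); first by rewrite addr_ge0.
  by move=> i; apply: hM => //; apply: le_lt_trans (ler_norm _) _; rewrite ltrDl.
exists M; split; first by rewrite num_real.
by move=> N hN i _; apply: le_trans (ltW hN).
Qed.

(** The mean is the limit of the averages over the sets [F m] along an ultrafilter refining
    convergence to infinity. *)
Lemma folner_amenable :
  (forall m : nat, exists F : {fset G}, (m.+1 * #|` thicken F| < m.+2 * #|` F|)%N) ->
  amenable R G.
Proof.
move=> /choice[F hF].
have [U [UU oU]] := @ultraFilterLemma nat \oo _.
(* The Folner sets are almost invariant on the right while [ltranslate] acts on the left; inversion
   exchanges the two sides. *)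
pose inv_fun (u : G -> R) (t : G) := u t^-1%g.
pose a (u : G -> R) (m : nat) : R := average (F m) (inv_fun u).
have a_cvg u : bounded_fun u -> a u @ U --> lim (a u @ U).
  move=> /bounded_real_funP[M M0 uM].
  (* The averages stay in a compact interval, where the image ultrafilter converges. *)
  have : compact `[- M, M]%classic by exact: segment_compact.
  rewrite compact_ultra => /(_ (a u @ U) (fmap_ultra _ UU))[].
    suff : U (a u @^-1` [set` `[- M, M]]) by [].
    apply: filterE => m /=; rewrite in_itv /= -ler_norml.
    by apply: (@average_le (F m) (inv_fun u) M M0) => x; exact: uM.
  by move=> l [_ /cvgP].
have bL c (u v : G -> R) : bounded_fun u -> bounded_fun v ->
    bounded_fun (fun t => c * u t + v t).
  move=> /bounded_real_funP[M M0 uM] /bounded_real_funP[N N0 vN].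
  apply/bounded_real_funP; exists (`|c| * M + N); first by rewrite addr_ge0 ?mulr_ge0.
  move=> t; apply: le_trans (ler_normD _ _) _; rewrite lerD// normrM.
  by rewrite ler_wpM2l.
have bT s (u : G -> R) : bounded_fun u -> bounded_fun (ltranslate s u).
  move=> /bounded_real_funP[M M0 uM]; apply/bounded_real_funP; exists M => // t.
  exact: uM.
have nF m : 0 < #|` F m|%:R :> R.
  by rewrite ltr0n lt0n; apply: contraTneq (hF m) => ->; rewrite muln0.
exists (fun u => lim (a u @ U)); split.
- move=> c u v bu bv; apply: cvg_lim => //.
  have -> : a (fun t => c * u t + v t) = (fun m => c * a u m + a v m).
    apply/funext => m; rewrite /a /average /inv_fun big_split/= -mulr_sumr.
    by rewrite mulrDl mulrA.
  by apply: cvgD; [apply: cvgMr; exact: a_cvg | exact: a_cvg].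
- move=> u bu u0; apply: (limr_ge (a_cvg u bu)).
  apply: filterE => m; rewrite /a /average divr_ge0 ?(ltW (nF m))//.
  by apply: sumr_ge0 => x _; exact: u0.
- apply: cvg_lim => //.
  have -> : a (fun=> 1) = (fun=> 1).
    apply/funext => m; rewrite /a /average /inv_fun big_const_seq count_predT iter_addr_0.
    by rewrite divff// gt_eqF.
  exact: cvg_cst.
(* Invariance under letters gives invariance under all words, by induction on the word. *)
suff letter s u : s \in letters -> bounded_fun u -> lim (a (ltranslate s u) @ U) = lim (a u @ U).
  move=> s u bu; have [w ww <-] := hg s.
  elim: w ww u bu => [|t w IH] /= ww u bu.
    rewrite big_nil (_ : ltranslate 1%g u = u)//.
    by apply/funext => x; rewrite /ltranslate invg1 mul1g.
  have /andP[ht hw] := ww; rewrite big_cons.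
  have -> : ltranslate (t * \prod_(j <- w) j)%g u =
      ltranslate t (ltranslate (\prod_(j <- w) j)%g u).
    by apply/funext => x; rewrite /ltranslate invgM mulgA.
  rewrite letter; [exact: IH | | exact: bT].
  rewrite inE mem_cat; apply/orP; right; case/orP: ht => [->//|ht].
  by apply/orP; right; apply/mapP; exists t^-1%g; rewrite ?invgK.
move=> sl bu; have /bounded_real_funP[M M0 uM] := bu.
apply/eqP; rewrite -subr_eq0; apply/eqP.
have c1 : (fun m => a (ltranslate s u) m - a u m) @ U --> lim (a (ltranslate s u) @ U) - lim (a u @ U).
  by apply: cvgB; apply: a_cvg => //; exact: bT.
apply: (cvg_unique _ c1) => //.
apply/cvgr0Pnorm_le => e e0.
have : \forall m \near \oo, 2 * M / m.+1%:R <= e.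
  near=> m; rewrite ler_pdivrMr ?ltr0n// -ler_pdivrMl//.
  near: m; exists (Num.Def.trunc (e^-1 * (2 * M))).+1 => // m /= hm.
  apply: le_trans (ltW (Num.Theory.truncnS_gt _)) _; rewrite ler_nat.
  exact: leqW.
move=> /oU; apply: filterS => m; apply: le_trans.
rewrite /a (_ : inv_fun (ltranslate s u) = fun t => inv_fun u (t * s)%g).
  by apply: average_translate => // x; exact: uM.
by apply/funext => t; rewrite /inv_fun /ltranslate invgM.
Unshelve. all: by end_near.
Qed.

(** Without Folner sets, some m makes each thickening gain at least |F| / (m + 1) points. This
    additive growth already suffices: C (m + 1) thickenings gain C |F|. *)
Lemma nonamenable_expansion : ~ amenable R G -> forall C : nat, exists n : nat,
  forall F : {fset G}, (C * #|` F| <= #|` iter n thicken F|)%N.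
Proof.
move=> nA C; have [m hm] : exists m : nat, forall F : {fset G},
    (m.+2 * #|` F| <= m.+1 * #|` thicken F|)%N.
  apply: contrapT => /forallNP h; apply: nA; apply: folner_amenable => m.
  by have /existsNP[F /negP] := h m; rewrite -ltnNge => hF; exists F.
have grow n F : ((m.+1 + n) * #|` F| <= m.+1 * #|` iter n thicken F|)%N.
  elim: n => [|n IH]; first by rewrite addn0.
  rewrite addnS mulSn; apply: leq_trans (hm _).
  rewrite mulSn leq_add//; elim: n {IH} => [|n IH] //=.
  exact: leq_trans IH (fsubset_leq_card (thicken_self _)).
exists (C * m.+1)%N => F; rewrite -(@leq_pmul2l m.+1)//; apply: leq_trans (grow _ F).
by rewrite mulnA leq_mul2r [(m.+1 * C)%N]mulnC leq_addl orbT.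
Qed.

End folner.

(** * Uniform Roe algebras without stabilisation *)

Section uniform_roe.
Context {R : realType} (p : exponent R).
Implicit Types (X Y : metricType R).

(** Here the index set is X itself with one-point fibres, so the finiteness clause is immediate and
    a selection of fibre points is the identity. *)
Lemma Bu_coarse_alg X : bounded_geometry X ->
  [/\ coarse_alg id id (Bu p X), subalgebra (Bu p X) & has_munits (Bu p X)].
Proof.
move=> bX; have transl (h : X -> X) (r : R) : (forall x, mdist x (h x) <= r) ->
    exists2 T, Bu p X T & forall x, scalar_entry T x (h x) = 1.
  move=> hr; have [N hN] := ball_card bX r.
  have hb : wc_bound (fun x : X => (predT x)%:R : R[i]) h 1 N.
    apply: ind_bound => y t ut ty; apply: (hN t y ut) => x /ty /= /eqP <-.
    by rewrite metric_sym.
  exists (wcop p hb); last by move=> x; rewrite scalar_entry_wcop eqxx mulr1.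
  apply: subset_closure; apply/fin_prop_uP; exists r => x y.
  rewrite scalar_entry_wcop mul1r; case: (h x =P y) => [<- _|]; last by rewrite eqxx.
  exact: hr.
split; last 2 first.
- apply: subalgebra_closure; split.
  + by apply/fin_prop_uP; exists 0 => k l; rewrite /scalar_entry bop0E eqxx.
  + move=> z S T /fin_prop_uP fS /fin_prop_uP fT; apply/fin_prop_uP.
    exact: (@propagatesL _ _ _ _ id).
  + move=> S T /fin_prop_uP fS /fin_prop_uP fT; apply/fin_prop_uP.
    exact: (@propagatesM _ _ _ _ id).
- move=> k l; apply: subset_closure; apply/fin_prop_uP; exists (mdist k l) => i j.
  rewrite scalar_entry_munit; case: (i =P k) => [->|_]; last by rewrite mul0r eqxx.
  by case: (l =P j) => [->|_]; rewrite ?mulr0 ?eqxx.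
split; [by apply: closure_propagation => T /fin_prop_uP | exact: transl |].
move=> T S _ _; split=> [x|j jP].
  by apply: (@sub_finite_set _ _ [set x]) => // k [].
have [x|U BU hU] := transl id 0; first by rewrite mdistxx.
by exists U => // x; rewrite (jP x).1 hU.
Qed.

Lemma Bu_rigid X Y : bounded_geometry X -> bounded_geometry Y -> (p : R) != 2 ->
  isometrically_isomorphic (Bu p X) (Bu p Y) -> coarsely_equivalent X Y.
Proof.
move=> bX bY p2 [phi iphi].
have [cX sX mX] := Bu_coarse_alg bX; have [cY sY mY] := Bu_coarse_alg bY.
by apply: (coarse_alg_rigid bX bY _ _ cX cY sX sY mX mY iphi) => //; left.
Qed.

Lemma Bu_bijection X Y (s : X -> Y) (t : Y -> X) : cancel s t -> cancel t s ->
  (forall r : R, exists r' : R, forall x x', mdist x x' <= r -> mdist (s x) (s x') <= r') ->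
  (forall r : R, exists r' : R, forall y y', mdist y y' <= r -> mdist (t y) (t y') <= r') ->
  isometrically_isomorphic (Bu p X) (Bu p Y).
Proof.
move=> st ts hs ht; exists (conjop st ts).
have -> : Bu p Y = conjop st ts @` Bu p X.
  rewrite /Bu (retraction_closure _ (conjop_retraction p st ts)); congr closure.
  apply/seteqP; split=> [T /fin_prop_uP[r hr]|_ [T /fin_prop_uP[r hr] <-]].
    have [r' hr'] := ht r; exists (conjop ts st T); last exact: (retrK (conjop_retraction p ts st)).
    apply/fin_prop_uP; exists r' => k l; rewrite scalar_entry_conjop => /hr /hr'.
    by rewrite !st.
  have [r' hr'] := hs r; apply/fin_prop_uP; exists r' => k l.
  by rewrite scalar_entry_conjop => /hr /hr'; rewrite !ts.
exact: (retraction_iso _ (conjop_retraction p st ts)).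
Qed.

End uniform_roe.

(** * Transfer of isomorphisms along embeddings *)

Section transfer.
Context {R : realType} (V V' W W' : normedModType R[i]).
Context (phi1 : bop V -> bop V') (psi1 : bop V' -> bop V).
Context (phi2 : bop W -> bop W') (psi2 : bop W' -> bop W).
Hypotheses (r1 : retraction phi1 psi1) (r2 : retraction phi2 psi2).

Lemma iso_push (A : set (bop V)) (B : set (bop W)) f : isometric_iso A B f ->
  isometric_iso (phi1 @` A) (phi2 @` B) (phi2 \o f \o psi1).
Proof.
move=> fi; apply: isometric_iso_comp (retraction_iso_inv A r1) _.
exact: isometric_iso_comp fi (retraction_iso B r2).
Qed.

Lemma iso_push_image (D : set (bop V)) (E : set (bop W)) f : f @` D = E ->
  (phi2 \o f \o psi1) @` (phi1 @` D) = phi2 @` E.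
Proof.
move=> <-; apply/seteqP; split=> [_ [_ [T DT <-] <-]|_ [_ [T DT <-] <-]].
  by exists (f T); [exists T | rewrite /= (retrK r1)].
by exists (phi1 T); [exists T | rewrite /= (retrK r1)].
Qed.

Lemma iso_pull (A : set (bop V)) (B : set (bop W)) f :
  isometric_iso (phi1 @` A) (phi2 @` B) f -> isometric_iso A B (psi2 \o f \o phi1).
Proof.
move=> fi; apply: isometric_iso_comp (retraction_iso A r1) _.
exact: isometric_iso_comp fi (retraction_iso_inv B r2).
Qed.

Lemma iso_pull_image (D : set (bop V)) (E : set (bop W)) f :
  f @` (phi1 @` D) = phi2 @` E -> (psi2 \o f \o phi1) @` D = E.
Proof.
move=> h; apply/seteqP; split=> [_ [T DT <-]|T ET].
  have [S ES /= <-] : (phi2 @` E) (f (phi1 T)) by rewrite -h; exists (phi1 T) => //; exists T.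
  by rewrite (retrK r2).
have [_ [S DS <-] e] : (f @` (phi1 @` D)) (phi2 T) by rewrite h; exists T.
by exists S => //=; rewrite e (retrK r2).
Qed.

End transfer.

Section nonamenable.
Context {R : realType}.

Lemma card_fibre (X Y : choiceType) (f : X -> Y) (N : nat) (A : {fset X}) :
  (forall y (t : seq X), uniq t -> (forall x, x \in t -> f x = y) -> (size t <= N)%N) ->
  (#|` A| <= N * #|` [fset f x | x in A]%fset|)%N.
Proof.
move=> hN; have := @sum_le_preim R X Y A f xpredT (fun=> 1) N (fun=> ler01) (fset_uniq A).
move=> /(_ _)/wrap[]; first by move=> y t ut ty; apply: (hN y t ut) => x /ty /eqP.
rewrite !big_const_seq !count_predT !iter_addr_0 -natrM ler_nat => /leq_trans; apply.
rewrite leq_mul2l; apply/orP; right; apply: uniq_leq_size; first exact: undup_uniq.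
move=> y; rewrite mem_undup => /mapP[x xA ->].
by apply/imfsetP; exists x.
Qed.

(** At most N points share an image under f, so |A| <= N |f(A)|, and expansion bounds this by the
    size of the n-neighbourhood of f(A). This is Hall's condition for the relation d(f x, y) <= n,
    and a matching is an injection at distance at most n from f. *)
Lemma nonamenable_injection (X : metricType R) (H : groupType) (gens : seq H)
    (hH : generates gens) (f : X -> word_space R hH) (c : R) :
  bounded_geometry X -> ~ amenable R H ->
  (forall x x', f x = f x' -> mdist x x' <= c) ->
  exists h : X -> word_space R hH, injective h /\
    exists r : R, forall x, mdist (f x) (h x) <= r.
Proof.
move=> bX nH fc; have [N hN] := ball_card bX c.
have [n hn] := nonamenable_expansion hH nH N.
have bH := @word_bounded_geometry R H gens hH.
pose nb x := fset_set [set y : word_space R hH | mdist (f x) y <= n%:R].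
have mem_nb x y : (y \in nb x) = (mdist (f x) y <= n%:R).
  by rewrite in_fset_set; [apply/idP/idP; rewrite in_setE | exact: ball_finite].
have [|h hI hnb] := @hall X (word_space R hH) nb; last first.
  by exists h; split=> //; exists n%:R => x; rewrite -mem_nb.
move=> A; pose fA : {fset H} := [fset (f x : H) | x in A]%fset.
apply: (@leq_trans (N * #|` fA|)).
  apply: card_fibre => y [|x0 t] // ut ty; apply: (hN _ x0 ut) => x xt.
  by apply: fc; rewrite (ty _ xt) ty// inE eqxx.
apply: leq_trans (hn fA) _.
apply: (@uniq_leq_size H); first exact: fset_uniq.
move=> y /(thicken_iter_dist (R := R) hH)[z /imfsetP[x /= xA ->] zy].
by apply/neighboursP; exists x; rewrite ?mem_nb.
Qed.

(** Pointwise agreement with one of the injections keeps the Cantor-Bernstein bijection close to f;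
    closeness to a coarse equivalence then controls both the bijection and its inverse. *)
Lemma nonamenable_bijection (G H : groupType) (gensG : seq G) (gensH : seq H)
    (hG : generates gensG) (hH : generates gensH) :
  ~ amenable R G -> ~ amenable R H ->
  coarsely_equivalent (word_space R hG) (word_space R hH) ->
  exists (s : word_space R hG -> word_space R hH) (t : word_space R hH -> word_space R hG),
    [/\ cancel s t, cancel t s,
     forall r : R, exists r' : R, forall x x', mdist x x' <= r -> mdist (s x) (s x') <= r' &
     forall r : R, exists r' : R, forall y y', mdist y y' <= r -> mdist (t y) (t y') <= r'].
Proof.
move=> nG nH [f [g [uf ug [C1 fg] [C2 gf]]]].
have bG := @word_bounded_geometry R G gensG hG.
have bH := @word_bounded_geometry R H gensH hH.
have fg' y : mdist (f (g y)) y <= C1 by exact: fg.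
have gf' x : mdist (g (f x)) x <= C2 by exact: gf.
have [|h1 [h1I [r1 hr1]]] := @nonamenable_injection _ _ _ hH f (C2 + C2) bG nH.
  move=> x x' fx; apply: le_trans (metric_triangle _ (g (f x)) _) _; apply: lerD.
    by rewrite metric_sym.
  by rewrite fx.
have [|h2 [h2I [r2 hr2]]] := @nonamenable_injection _ _ _ hG g (C1 + C1) bH nG.
  move=> y y' gy; apply: le_trans (metric_triangle _ (f (g y)) _) _; apply: lerD.
    by rewrite metric_sym.
  by rewrite gy.
have [s [t [st ts sP]]] := cantor_bernstein h1I h2I.
have pos (r : R) : 0 < Num.max r 1 by rewrite lt_max ltr01 orbT.
have [S2 S20 hS2] := uf _ (pos r2).
(* If s x = h1 x, its distance to f x is at most r1. If x = h2 (s x), then x is within r2 of g (s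
   x), so f x is within S2 of f (g (s x)), which is within C1 of s x. *)
pose D := Num.max r1 (S2 + C1).
have fs x : mdist (f x) (s x) <= D.
  have [->|xE] := sP x; first by rewrite /D le_max hr1.
  rewrite /D le_max; apply/orP; right; rewrite {1}xE.
  apply: le_trans (metric_triangle _ (f (g (s x))) _) _; apply: lerD => //.
  by apply: hS2; rewrite metric_sym le_max hr2.
exists s, t; split=> // r.
  have [S S0 hS] := uf _ (pos r); exists (D + (S + D)) => x x' xx'.
  apply: le_trans (metric_triangle _ (f x) _) _; apply: lerD; first by rewrite metric_sym.
  apply: le_trans (metric_triangle _ (f x') _) _; apply: lerD => //.
  by apply: hS; rewrite le_max xx'.
have [S S0 hS] := ug _ (pos (D + (r + D))); exists (C2 + (S + C2)) => y y' yy'.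
apply: le_trans (metric_triangle _ (g (f (t y))) _) _; apply: lerD; first by rewrite metric_sym.
apply: le_trans (metric_triangle _ (g (f (t y'))) _) _; apply: lerD => //.
apply: hS; rewrite le_max; apply/orP; left.
apply: le_trans (metric_triangle _ y _) _; apply: lerD; first by rewrite -{2}(ts y).
apply: le_trans (metric_triangle _ y' _) _; apply: lerD => //.
by rewrite metric_sym -{2}(ts y').
Qed.

End nonamenable.

Section group_equivalences.
Context {R : realType}.

Definition group_stable_iso (q : exponent R) (G H : groupType) :=
  isometrically_isomorphic
    (tensor_alg (crossed_product q G) (compact_ops q))
    (tensor_alg (crossed_product q H) (compact_ops q)).

Definition group_stable_diag_iso (q : exponent R) (G H : groupType) :=
  exists2 phi,
    isometric_iso
      (tensor_alg (crossed_product q G) (compact_ops q))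
      (tensor_alg (crossed_product q H) (compact_ops q)) phi &
    phi @` tensor_alg (crossed_linf q G) (C0_ops q) =
      tensor_alg (crossed_linf q H) (C0_ops q).

Lemma exponent_not2 : exists q : exponent R, (q : R) != 2.
Proof. by exists (Exponent (lexx 1)); rewrite /= lt_eqF// ltr1n. Qed.

Context (G H : groupType) (gensG : seq G) (gensH : seq H).
Context (hG : generates gensG) (hH : generates gensH).

Local Notation X := (word_space R hG).
Local Notation Y := (word_space R hH).
Local Notation qi := (quasi_isometric
  (word_dist gensG : G -> G -> R) (word_dist gensH : H -> H -> R)).

Let bX : bounded_geometry X := word_bounded_geometry hG.
Let bY : bounded_geometry Y := word_bounded_geometry hH.

Lemma qi_coarse : qi -> coarsely_equivalent X Y.
Proof. exact: (@quasi_isometric_coarse R X Y). Qed.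

Lemma qi_stable_diag q : qi -> group_stable_diag_iso q G H.
Proof.
move=> /qi_coarse /(stable_diag_iso q bX bY)[phi iphi dphi].
rewrite /group_stable_diag_iso (crossed_stable_alg q hG) (crossed_stable_alg q hH).
rewrite (crossed_stable_diag q hG) (crossed_stable_diag q hH).
have r1 := crossed2_retraction q hG; have r2 := crossed2_retraction q hH.
eexists; first exact: (iso_push r1 r2 iphi).
exact: (iso_push_image _ r1 dphi).
Qed.

Lemma stable_diag_qi q : group_stable_diag_iso q G H -> qi.
Proof.
rewrite /group_stable_diag_iso (crossed_stable_alg q hG) (crossed_stable_alg q hH).
rewrite (crossed_stable_diag q hG) (crossed_stable_diag q hH).
have r1 := crossed2_retraction q hG; have r2 := crossed2_retraction q hH.
move=> [phi iphi dphi]; apply: (coarse_quasi_isometric (hG := hG) (hH := hH)).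
have h1 := iso_pull r1 r2 iphi; have h2 := iso_pull_image r2 dphi.
have h3 := stable_rigid_diag bX bY h1 h2.
exact: h3.
Qed.

Lemma stable_iso_qi (q : exponent R) : (q : R) != 2 -> group_stable_iso q G H -> qi.
Proof.
rewrite /group_stable_iso (crossed_stable_alg q hG) (crossed_stable_alg q hH).
have r1 := crossed2_retraction q hG; have r2 := crossed2_retraction q hH.
move=> q2 [phi iphi]; apply: (coarse_quasi_isometric (hG := hG) (hH := hH)).
apply: (Bs_rigid bX bY q2); rewrite !Bs_tensor.
by eexists; exact: (iso_pull r1 r2 iphi).
Qed.

Lemma crossed_iso_qi (q : exponent R) : (q : R) != 2 ->
  isometrically_isomorphic (crossed_product q G) (crossed_product q H) -> qi.
Proof.
rewrite (crossed_productE q hG) (crossed_productE q hH).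
have r1 := crossed_retraction q hG; have r2 := crossed_retraction q hH.
move=> q2 [phi iphi]; apply: (coarse_quasi_isometric (hG := hG) (hH := hH)).
apply: (Bu_rigid bX bY q2).
by eexists; exact: (iso_pull r1 r2 iphi).
Qed.

Lemma qi_crossed_iso (q : exponent R) : ~ amenable R G -> ~ amenable R H -> qi ->
  isometrically_isomorphic (crossed_product q G) (crossed_product q H).
Proof.
move=> nG nH /qi_coarse /(nonamenable_bijection nG nH)[s [t [st ts hs ht]]].
have [phi iphi] := Bu_bijection q st ts hs ht.
rewrite (crossed_productE q hG) (crossed_productE q hH).
have r1 := crossed_retraction q hG; have r2 := crossed_retraction q hH.
by eexists; exact: (iso_push r1 r2 iphi).
Qed.

End group_equivalences.

Theorem theorem3p8 (R : realType) :
  [/\ forall (X Y : metricType R) (p : exponent R),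
        bounded_geometry X -> bounded_geometry Y -> (p : R) != 2 ->
        [/\ forall (s t : option nat)
              (A : set (bop (lp p (X * fiber s)%type)))
              (B : set (bop (lp p (Y * fiber t)%type))),
              roe_type A -> roe_type B ->
              isometrically_isomorphic A B -> coarsely_equivalent X Y,
            isometrically_isomorphic (Bs p X) (Bs p Y) ->
              coarsely_equivalent X Y &
            coarsely_equivalent X Y ->
              [/\ isometrically_isomorphic (UB p X) (UB p Y),
                  isometrically_isomorphic (Broe p X) (Broe p Y) &
                  isometrically_isomorphic (Bs p X) (Bs p Y)]],

      forall (X : metricType R) (q : exponent R), bounded_geometry X ->
        isometrically_isomorphic (Bs q X)
          (tensor_alg (Bu q X) (compact_ops q)),

      forall X Y : metricType R, bounded_geometry X -> bounded_geometry Y ->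
        let stable_iso (q : exponent R) :=
          isometrically_isomorphic
            (tensor_alg (Bu q X) (compact_ops q))
            (tensor_alg (Bu q Y) (compact_ops q)) in
        let stable_diag_iso (q : exponent R) :=
          exists2 phi,
            isometric_iso
              (tensor_alg (Bu q X) (compact_ops q))
              (tensor_alg (Bu q Y) (compact_ops q)) phi &
            phi @` tensor_alg (linf_ops q X) (C0_ops q) =
              tensor_alg (linf_ops q Y) (C0_ops q) in
        [<-> coarsely_equivalent X Y;
             forall q : exponent R, stable_diag_iso q;
             forall q : exponent R, stable_iso q;
             exists2 q : exponent R, (q : R) != 2 & stable_iso q;
             exists q : exponent R, stable_diag_iso q] &

      forall (G H : groupType) (gensG : seq G) (gensH : seq H),
        generates gensG -> generates gensH ->
        let qi := quasi_isometric
          (word_dist gensG : G -> G -> R) (word_dist gensH : H -> H -> R) in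
        let stable_iso (q : exponent R) :=
          isometrically_isomorphic
            (tensor_alg (crossed_product q G) (compact_ops q))
            (tensor_alg (crossed_product q H) (compact_ops q)) in
        let stable_diag_iso (q : exponent R) :=
          exists2 phi,
            isometric_iso
              (tensor_alg (crossed_product q G) (compact_ops q))
              (tensor_alg (crossed_product q H) (compact_ops q)) phi &
            phi @` tensor_alg (crossed_linf q G) (C0_ops q) =
              tensor_alg (crossed_linf q H) (C0_ops q) in
        let iso (q : exponent R) :=
          isometrically_isomorphic (crossed_product q G) (crossed_product q H) in
        [<-> qi;
             forall q : exponent R, stable_diag_iso q;
             forall q : exponent R, stable_iso q;
             exists2 q : exponent R, (q : R) != 2 & stable_iso q;
             exists q : exponent R, stable_diag_iso q] /\
        (~ amenable R G -> ~ amenable R H ->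
         [<-> qi;
              forall q : exponent R, stable_diag_iso q;
              forall q : exponent R, stable_iso q;
              exists2 q : exponent R, (q : R) != 2 & stable_iso q;
              exists q : exponent R, stable_diag_iso q;
              forall q : exponent R, iso q;
              exists2 q : exponent R, (q : R) != 2 & iso q])].
Proof.
(* An exponent other than 2 is what passes from all exponents to some exponent different from 2. *)
have [q1 q12] := @exponent_not2 R.
split.
- move=> X Y p bX bY p2; split.
  + move=> s t A B rA rB [phi iphi].
    (* Index 0 of each coefficient set provides the base points of the fibres. *)
    pose z (o : option nat) : fiber o := if o is Some n then ord0 else 0%N.
    have [cA sA mA] := roe_coarse_alg (z s) bX rA.
    have [cB sB mB] := roe_coarse_alg (z t) bY rB.
    by apply: (coarse_alg_rigid bX bY _ _ cA cB sA sB mA mB iphi) => //; left.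
  + exact: Bs_rigid.
  + move=> /(coarse_matching bX bY)[M]; split; exists (mconj p M).
    * exact: mconj_UB.
    * exact: mconj_Broe.
    * exact: mconj_Bs.
- move=> X q _; rewrite -Bs_tensor; exists id; split=> //.
  by split=> [T BT|S T _ _|T BT] //; exists T.
- move=> X Y bX bY stable_iso stable_diag_iso'.
  have A12 : coarsely_equivalent X Y -> forall q, stable_diag_iso' q.
    by move=> ce q; exact: stable_diag_iso.
  have A41 (q : exponent R) : (q : R) != 2 -> stable_iso q -> coarsely_equivalent X Y.
    by move=> q2 h; apply: (Bs_rigid bX bY q2); rewrite !Bs_tensor.
  tfae.
  + exact: A12.
  + by move=> h q; have [phi iphi _] := h q; exists phi.
  + by move=> h; exists q1.
  (* An arbitrary isomorphism need not respect the diagonal: it yields a coarse equivalence, which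
     in turn provides an isomorphism that does. *)
  + by move=> [q q2 /(A41 q q2)/A12 h]; exists q.
  + by move=> [q [phi iphi dphi]]; exact: (stable_rigid_diag bX bY iphi dphi).
move=> G H gensG gensH hG hH qi stable_iso stable_diag_iso' iso; split.
  tfae.
  + by move=> h q; exact: qi_stable_diag h.
  + by move=> h q; have [phi iphi _] := h q; exists phi.
  + by move=> h; exists q1.
  + by move=> [q q2 /(stable_iso_qi hG hH q2) h]; exists q; exact: qi_stable_diag h.
  + by move=> [q]; exact: stable_diag_qi.
move=> nG nH; tfae.
+ by move=> h q; exact: qi_stable_diag h.
+ by move=> h q; have [phi iphi _] := h q; exists phi.
+ by move=> h; exists q1.
+ by move=> [q q2 /(stable_iso_qi hG hH q2) h]; exists q; exact: qi_stable_diag h.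
+ by move=> [q0 /(stable_diag_qi hG hH) h] q; exact: (qi_crossed_iso hG hH).
+ by move=> h; exists q1.
+ by move=> [q q2]; exact: (crossed_iso_qi hG hH q2).
Qed.
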